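(* Let $(\xi,g,L)$ and $(\xi',g',L')$ be two triplets satisfying the Standard Assumptions (A) of the context, and let $(Y,Z,K)$ and $(Y',Z',K')$ be the solutions of the associated reflected BSDEs. Write $\overline\xi=\xi-\xi'$, $\overline g=g-g'$, $\overline L=L-L'$, $\overline Y=Y-Y'$, $\overline Z=Z-Z'$. Then, for some $C>0$ and for all $\delta>0$, one can find $\gamma>0$ such that $$E\Big[\int_0^Te^{\gamma t}(|\overline Y_t|^2+|\overline Z_t|^2)dt\Big]\le 2E\big[e^{\gamma T}|\overline\xi|^2\big]+\delta E\Big[\int_0^Te^{\gamma t}|\overline g(t,Y_t,Z_t)|^2dt\Big]+C\Big(E\Big[\sup_{t\in[0,T]}|e^{\gamma t}\overline L_t|^2\Big]\Big)^{1/2}\Psi_{0,T}^{1/2},$$ where $$\Psi_{0,T}=E\Big[|\xi|^2+\Big(\int_0^T|g(s,0,0)|ds\Big)^2+\sup_{s\in[0,T]}|L_s|^2+|\xi'|^2+\Big(\int_0^T|g'(s,0,0)|ds\Big)^2+\sup_{s\in[0,T]}|L'_s|^2\,\Big|\,\mathcal F_0\Big].$$ The constant $C$ only depends on the bound and the Lipschitz constant of $g$ and $g'$, while $\gamma$ only depends on $\delta$ and on the Lipschitz constant of $g$ and $g'$.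
   Context: **Probability space.** Fix $T>0$, $d\ge1$. $(\Omega,\mathcal F,P)$ is a complete probability space carrying a $d$-dimensional Brownian motion $W$ and a $\sigma$-field $\mathcal G$ independent of $W$ (generated by a countable family of further independent $d$-dimensional Brownian motions); $\mathbf F=(\mathcal F_t)_{t\in[0,T]}$ with $\mathcal F_t=\sigma\{W_r:r\le t\}\vee\mathcal G\vee\mathcal N_P$, $\mathcal N_P$ the $P$-null sets. In the inequality of the claim, the conditional expectation $\Psi_{0,T}$ is to be read as the corresponding unconditional expectation (i.e. with the conditioning on $\mathcal F_0$ dropped), the left-hand side being a number. **Spaces.** $S^2_{\mathbf F}([0,T])$: real continuous $\mathbf F$-adapted processes with $E[\sup_t|Y_t|^2]<\infty$. $L^2_{\mathbf F}([0,T];\mathbb R^d)$: $\mathbb R^d$-valued $\mathbf F$-progressively measurable processes with $E[\int_0^T|Z_t|^2dt]<\infty$. $A^{2,c}_{\mathbf F}([0,T])$: non-decreasing $K\in S^2_{\mathbf F}([0,T])$ with $K_0=0$. **Standard Assumptions (A)** on $(\xi,g,L)$: $g:\Omega\times[0,T]\times\mathbb R\times\mathbb R^d\to\mathbb R$ is measurable, $(g(t,y,z))_t$ is $\mathbf F$-progressively measurable for all $(y,z)$; (A1) there is $C_0\ge0$ (Lipschitz constant) with, $P$-a.s., for all $t,y_1,y_2,z_1,z_2$, $|g(t,y_1,z_1)-g(t,y_2,z_2)|\le C_0(|y_1-y_2|+|z_1-z_2|)$; (A2) $g(\cdot,0,0)\in L^2_{\mathbf F}([0,T];\mathbb R)$;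 $\xi\in L^2(\Omega,\mathcal F_T,P)$; $L\in S^2_{\mathbf F}([0,T])$; $L_T\le\xi$, $P$-a.s. **Reflected BSDE** with data $(\xi,g,L)$: its (unique) solution is the triplet $(Y,Z,K)\in S^2_{\mathbf F}([0,T])\times L^2_{\mathbf F}([0,T];\mathbb R^d)\times A^{2,c}_{\mathbf F}([0,T])$ with $Y_t=\xi+\int_t^Tg(s,Y_s,Z_s)ds+K_T-K_t-\int_t^TZ_sdW_s$, $t\in[0,T]$; $Y_t\ge L_t$ a.s. for all $t$; and $\int_0^T(Y_t-L_t)dK_t=0$. *)

(* Defs.v *)
From HB Require Import structures.
From mathcomp Require Import all_boot all_order all_algebra.
From mathcomp Require Import all_classical all_reals all_analysis.

Set Implicit Arguments.
Unset Strict Implicit.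
Unset Printing Implicit Defensive.

Import Order.TTheory GRing.Theory Num.Theory.
Import numFieldNormedType.Exports.

Local Open Scope classical_set_scope.
Local Open Scope ring_scope.

(* The library norm on row vectors is the sup norm, hence the Euclidean one
   is introduced here. *)
Definition edot (R : realType) (d : nat) (u v : 'rV[R]_d) : R :=
  \sum_(i < d) u 0 i * v 0 i.

Definition enorm (R : realType) (d : nat) (u : 'rV[R]_d) : R :=
  Num.sqrt (edot u u).

(* R^d with its Borel sigma-algebra. *)
Definition borel_rV (R : realType) (d : nat) :=
  g_sigma_algebraType (@open 'rV[R]_d).

(* Processes are functions of a real time, of which only the values at times
   in [0, T] matter. *)

(* Sets generating sigma(X_r, 0 <= r <= t). *)
Definition history (R : realType) (d : nat) (Omega : Type)
    (X : R -> Omega -> 'rV[R]_d) (t : R) : set (set Omega) :=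
  [set A | exists r (B : set (borel_rV R d)),
     [/\ r \in `[0, t], measurable B & A = X r @^-1` B]].

Definition indep (R : realType) (disp : measure_display)
    (Omega : measurableType disp) (P : probability Omega R)
    (F G : set (set Omega)) : Prop :=
  forall A B, F A -> G B -> P (A `&` B) = (P A * P B)%E.

Definition mutual_indep (R : realType) (disp : measure_display)
    (Omega : measurableType disp) (P : probability Omega R)
    (J : eqType) (F : J -> set (set Omega)) : Prop :=
  forall (s : seq J) (A : J -> set Omega), uniq s ->
    (forall j, j \in s -> F j (A j)) ->
    P (\bigcap_(j in [set` s]) A j) = (\prod_(j <- s) P (A j))%E.

Definition brownian_motion (R : realType) (d : nat) (disp : measure_display)
    (Omega : measurableType disp) (P : probability Omega R) (T : R)
    (W : R -> Omega -> 'rV[R]_d) : Prop :=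
  [/\ forall t, t \in `[0, T] ->
        measurable_fun setT (W t : Omega -> borel_rV R d),
      {ae P, forall w, W 0 w = 0},
      {ae P, forall w, {within `[0, T], continuous (fun t => W t w)}},
      forall s t, 0 <= s -> s < t -> t <= T ->
        forall B : 'I_d -> set R, (forall i, measurable (B i)) ->
        P [set w | forall i, B i ((W t w - W s w) 0 i)] =
        (\prod_(i < d) normal_prob 0%R (Num.sqrt (t - s)) (B i))%E
    & forall s t, 0 <= s -> s < t -> t <= T ->
        indep P <<s history W s >>
          [set A | exists B : set (borel_rV R d),
             measurable B /\ A = [set w | B (W t w - W s w)]] ].

Definition noise_sigma (R : realType) (d : nat) (Omega : Type) (T : R)
    (J : Type) (B : J -> R -> Omega -> 'rV[R]_d) : set (set Omega) :=
  <<s \bigcup_j history (B j) T >>.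

Definition noise_setting (R : realType) (d : nat) (disp : measure_display)
    (Omega : measurableType disp) (P : probability Omega R) (T : R)
    (W : R -> Omega -> 'rV[R]_d)
    (J : countType) (B : J -> R -> Omega -> 'rV[R]_d) : Prop :=
  [/\ measure_is_complete P,
      brownian_motion P T W,
      forall j, brownian_motion P T (B j),
      mutual_indep P (fun j => <<s history (B j) T >>)
    & indep P <<s history W T >> (noise_sigma T B)].

Definition brownian_filtration (R : realType) (d : nat)
    (disp : measure_display) (Omega : measurableType disp)
    (P : probability Omega R) (T : R) (W : R -> Omega -> 'rV[R]_d)
    (J : Type) (B : J -> R -> Omega -> 'rV[R]_d) (t : R) : set (set Omega) :=
  <<s history W t `|` noise_sigma T B `|` P.-negligible >>.

Definition adapted (R : realType) (Omega : pointedType) (T : R)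
    (F : R -> set (set Omega)) (X : R -> Omega -> R) : Prop :=
  forall t, t \in `[0, T] ->
    measurable_fun setT (X t : g_sigma_algebraType (F t) -> R).

Definition progressive (R : realType) (Omega : pointedType) (T : R)
    (F : R -> set (set Omega)) (disp : measure_display)
    (V : measurableType disp) (X : R -> Omega -> V) : Prop :=
  forall t, t \in `[0, T] ->
    measurable_fun (`[0, t] `*` setT)
      (fun p : R * g_sigma_algebraType (F t) => X p.1 p.2).

Definition path_sup2 (R : realType) (Omega : Type) (T : R)
    (X : R -> Omega -> R) (w : Omega) : \bar R :=
  ereal_sup [set (`|X t w| ^+ 2)%:E | t in `[0, T]].

Definition space_S2 (R : realType) (disp : measure_display)
    (Omega : measurableType disp) (P : probability Omega R) (T : R)
    (F : R -> set (set Omega)) (X : R -> Omega -> R) : Prop :=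
  [/\ adapted T F X,
      {ae P, forall w, {within `[0, T], continuous (fun t => X t w)}}
    & (\int[P]_w path_sup2 T X w < +oo)%E].

Definition space_L2 (R : realType) (disp : measure_display)
    (Omega : measurableType disp) (P : probability Omega R) (T : R)
    (F : R -> set (set Omega)) (X : R -> Omega -> R) : Prop :=
  progressive T F X /\
  (\int[P]_w \int[lebesgue_measure]_(t in `[0%R, T]) (`|X t w| ^+ 2)%:E
     < +oo)%E.

Definition space_L2_rV (R : realType) (d : nat) (disp : measure_display)
    (Omega : measurableType disp) (P : probability Omega R) (T : R)
    (F : R -> set (set Omega)) (Z : R -> Omega -> 'rV[R]_d) : Prop :=
  progressive T F (Z : R -> Omega -> borel_rV R d) /\
  (\int[P]_w \int[lebesgue_measure]_(t in `[0%R, T]) (enorm (Z t w) ^+ 2)%:E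
     < +oo)%E.

Definition space_A2c (R : realType) (disp : measure_display)
    (Omega : measurableType disp) (P : probability Omega R) (T : R)
    (F : R -> set (set Omega)) (K : R -> Omega -> R) : Prop :=
  [/\ space_S2 P T F K,
      {ae P, forall w, forall s t, 0 <= s -> s <= t -> t <= T ->
         K s w <= K t w}
    & {ae P, forall w, K 0 w = 0}].

(* sum_(i < n) h_i 1_(t_i, t_{i+1}] with h_i bounded and F_{t_i}-measurable. *)
Record simple_process (R : realType) (d : nat) (Omega : pointedType) (T : R)
    (F : R -> set (set Omega)) := SimpleProcess {
  sp_size : nat ;
  sp_time : nat -> R ;
  sp_coef : nat -> Omega -> 'rV[R]_d ;
  sp_time_ge0 : 0 <= sp_time 0%N ;
  sp_time_homo : forall i, (i < sp_size)%N -> sp_time i <= sp_time i.+1 ;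
  sp_time_leT : sp_time sp_size <= T ;
  sp_coef_measurable : forall i, (i < sp_size)%N ->
    measurable_fun setT
      (sp_coef i : g_sigma_algebraType (F (sp_time i)) -> borel_rV R d) ;
  sp_coef_bounded : exists M : R, forall i w, (i < sp_size)%N ->
    enorm (sp_coef i w) <= M }.

Definition sp_value (R : realType) (d : nat) (Omega : pointedType) (T : R)
    (F : R -> set (set Omega)) (H : simple_process d T F)
    (t : R) (w : Omega) : 'rV[R]_d :=
  \sum_(i < sp_size H)
     (if sp_time H i < t <= sp_time H i.+1 then sp_coef H i w else 0).

Definition sp_integral (R : realType) (d : nat) (Omega : pointedType) (T : R)
    (F : R -> set (set Omega)) (W : R -> Omega -> 'rV[R]_d)
    (H : simple_process d T F) (t : R) (w : Omega) : R :=
  \sum_(i < sp_size H)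
     edot (sp_coef H i w)
       (W (Num.min (sp_time H i.+1) t) w - W (Num.min (sp_time H i) t) w).

(* M is a continuous version of the Ito integral (\int_0^t Z_s dW_s)_t, i.e.
   the L^2-limit of the integrals of simple processes approximating Z. *)
Definition ito_integral (R : realType) (d : nat) (disp : measure_display)
    (Omega : measurableType disp) (P : probability Omega R) (T : R)
    (F : R -> set (set Omega)) (W Z : R -> Omega -> 'rV[R]_d)
    (M : R -> Omega -> R) : Prop :=
  [/\ adapted T F M,
      {ae P, forall w, {within `[0, T], continuous (fun t => M t w)}}
    & exists H : nat -> simple_process d T F,
        (\int[P]_w \int[lebesgue_measure]_(t in `[0%R, T])
           (enorm (sp_value (H n) t w - Z t w) ^+ 2)%:E)%E @[n --> \oo]
          --> 0%E /\
        forall t, t \in `[0, T] ->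
          (\int[P]_w (`|sp_integral W (H n) t w - M t w| ^+ 2)%:E)%E
            @[n --> \oo] --> 0%E ].

Definition standard_assumptions (R : realType) (d : nat)
    (disp : measure_display) (Omega : measurableType disp)
    (P : probability Omega R) (T : R) (F : R -> set (set Omega)) (C0 : R)
    (xi : Omega -> R) (g : Omega -> R -> R -> 'rV[R]_d -> R)
    (L : R -> Omega -> R) : Prop :=
  measurable_fun [set p : Omega * R * R * borel_rV R d | p.1.1.2 \in `[0, T]]
    (fun p : Omega * R * R * borel_rV R d => g p.1.1.1 p.1.1.2 p.1.2 p.2) /\
  (forall y z, progressive T F (fun t w => g w t y z)) /\
  {ae P, forall w, forall t y1 y2 z1 z2, t \in `[0, T] ->
     `|g w t y1 z1 - g w t y2 z2| <= C0 * (`|y1 - y2| + enorm (z1 - z2))} /\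
  space_L2 P T F (fun t w => g w t 0 0) /\
  measurable_fun setT (xi : g_sigma_algebraType (F T) -> R) /\
  (\int[P]_w (`|xi w| ^+ 2)%:E < +oo)%E /\
  space_S2 P T F L /\
  {ae P, forall w, L T w <= xi w}.

(* The path integral of f against dk on [0, T] vanishes; k is extended to a
   distribution function on the whole line by constants outside [0, T]. *)
Definition stieltjes_integral_eq0 (R : realType) (T : R) (f k : R -> R) :
    Prop :=
  exists kT : cumulative R R,
    (forall t, kT t = k (Num.max 0 (Num.min t T))) /\
    (\int[lebesgue_stieltjes_measure kT]_(t in `[0%R, T]) (f t)%:E = 0)%E.

Definition rbsde_solution (R : realType) (d : nat) (disp : measure_display)
    (Omega : measurableType disp) (P : probability Omega R) (T : R)
    (F : R -> set (set Omega)) (W : R -> Omega -> 'rV[R]_d)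
    (xi : Omega -> R) (g : Omega -> R -> R -> 'rV[R]_d -> R)
    (L : R -> Omega -> R)
    (Y : R -> Omega -> R) (Z : R -> Omega -> 'rV[R]_d) (K : R -> Omega -> R) :
    Prop :=
  space_S2 P T F Y /\
  space_L2_rV P T F Z /\
  space_A2c P T F K /\
  (exists M, ito_integral P T F W Z M /\
     {ae P, forall w, forall t, t \in `[0, T] ->
        Y t w = xi w
          + \int[lebesgue_measure]_(s in `[t, T]) g w s (Y s w) (Z s w)
          + K T w - K t w - (M T w - M t w)}) /\
  (forall t, t \in `[0, T] -> {ae P, forall w, L t w <= Y t w}) /\
  {ae P, forall w,
     stieltjes_integral_eq0 T (fun t => Y t w - L t w) (fun t => K t w)}.

Definition data_size (R : realType) (d : nat) (Omega : Type) (T : R)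
    (xi : Omega -> R) (g : Omega -> R -> R -> 'rV[R]_d -> R)
    (L : R -> Omega -> R) (w : Omega) : \bar R :=
  ((`|xi w| ^+ 2)%:E
   + (\int[lebesgue_measure]_(s in `[0%R, T]) `|g w s 0 0|%:E) ^+ 2
   + path_sup2 T L w)%E.

(* Main.v *)
(** The estimate is the energy inequality for e^(gamma t) |Y_t - Y'_t|^2.  It is
    not taken from Ito's formula but from the exact identity for the increments
    of e_i U_i^2 along uniform grids: the stochastic integral drops out since
    E[U_s (M_t - M_s)] = 0, its squared increments add up to E int |Z - Z'|^2
    by the Ito isometry, and those of the continuous finite variation part
    vanish in the limit.  The squares are split by
    (x + y)^2 >= 3/4 y^2 - 3 x^2, which costs 1/4 of E int e^(gamma t) |Z - Z'|^2
    and is paid for by the factor 2 in front of the terminal term.  By the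
    Skorokhod condition, int e^(gamma t) (Y - Y') d(K - K') is at most
    sup e^(gamma t) |L - L'| (K_T + K'_T), so that the Cauchy-Schwarz inequality
    leaves an a priori bound of E[K_T^2].  This bound comes from the same energy
    inequality, for the process Y_t + int_0^t g(s, 0, 0) ds; without the shift
    one would get int |g(s, 0, 0)|^2 ds in place of (int |g(s, 0, 0)| ds)^2.

    Almost sure properties of the paths are made sure by multiplying every
    process by the indicator of a set O of probability one.  The filtration
    contains the null sets, so this does not destroy adaptedness. *)
Require Import Defs.
From HB Require Import structures.
From mathcomp Require Import all_boot all_order all_algebra.
From mathcomp Require Import all_classical all_reals all_analysis.
From mathcomp Require Import measurable_realfun ring lra.


Set Implicit Arguments.
Unset Strict Implicit.
Unset Printing Implicit Defensive.

Import Order.TTheory GRing.Theory Num.Theory.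
Import numFieldNormedType.Exports.

Local Open Scope classical_set_scope.
Local Open Scope ring_scope.


(** * Square-integrable random variables *)

(** The quadratic variation of the Ito integral is not at hand path by path, since the integral is
    only an L2 limit of simple ones. The two sums that contain martingale increments are therefore
    evaluated in expectation on each fixed grid, while the other sums are treated path by path and
    pass to expectations by dominated convergence. The exponent is [2 / delta + 2 * C0' + 4 * C0' ^+
    2 + 1 / 2]. Young's inequality, with weights [delta / 2] for the driver difference and 1/4 for
    the integrand, produces the first three terms; 1/2 is left in front of the integral of the
    squared difference, and the whole inequality is doubled at the end. The difference of the
    drivers is split at the second driver evaluated along the first solution, so that only [C0']
    enters. The constant in front of the obstacle term does not see [delta], because the weight
    stays inside the supremum and only the unweighted variables K_T and K'_T are left. Their second
    moments come from the energy inequality with zero in the role of the second solution, and bring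
    in the horizon and both Lipschitz constants. *)

Lemma cvg0_le (R : realType) (u v : nat -> R) : (forall n, `|u n| <= v n) ->
  v n @[n --> \oo] --> (0 : R) -> u n @[n --> \oo] --> (0 : R).
Proof.
move=> uv cv; apply/cvgr0Pnorm_le => e e0.
move/cvgr0Pnorm_le: cv => /(_ _ e0) H.
near=> n; apply: (le_trans (uv n)); apply: (le_trans (ler_norm _)).
by near: n; exact: H.
Unshelve. all: by end_near. Qed.

Section square_integrable.
Context d (T : measurableType d) (R : realType) (P : probability T R).
Implicit Types X Y : T -> R.

Definition rint X := P.-integrable setT (EFin \o X).
Definition sqint X := measurable_fun setT X /\ rint (fun w => X w ^+ 2).

Lemma rint_measurable X : rint X -> measurable_fun setT X.
Proof. by move=> /measurable_int/measurable_EFinP. Qed.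

Lemma rint_le X Y : measurable_fun setT X -> (forall w, `|X w| <= Y w) ->
  rint Y -> rint X.
Proof.
move=> mX XY; apply: le_integrable => //; first exact/measurable_EFinP.
by move=> w _ /=; rewrite lee_fin (le_trans (XY w))// ler_norm.
Qed.

Lemma rint_bounded X (M : R) : measurable_fun setT X ->
  (forall w, `|X w| <= M) -> rint X.
Proof.
move=> mX XM; apply: (@rint_le _ (cst M)) => //.
exact: finite_measure_integrable_cst.
Qed.

Lemma rint_cst (c : R) : rint (fun=> c).
Proof. exact: finite_measure_integrable_cst. Qed.

Lemma rintD X Y : rint X -> rint Y -> rint (fun w => X w + Y w).
Proof. by move=> iX iY; have := integrableD measurableT iX iY. Qed.

Lemma rintB X Y : rint X -> rint Y -> rint (fun w => X w - Y w).
Proof. by move=> iX iY; have := integrableB measurableT iX iY. Qed.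

Lemma rintZ (c : R) X : rint X -> rint (fun w => c * X w).
Proof. by move=> iX; have := integrableZl measurableT c iX. Qed.

Lemma rint_norm X : rint X -> rint (fun w => `|X w|).
Proof. by move=> iX; have := integrable_norm iX. Qed.

Lemma rint_sum (I : Type) (s : seq I) (F : I -> T -> R) :
  (forall i, rint (F i)) -> rint (fun w => \sum_(i <- s) F i w).
Proof.
move=> iF; elim: s => [|i s IH].
  by under eq_fun do rewrite big_nil; exact: rint_cst.
by under eq_fun do rewrite big_cons; exact: rintD.
Qed.

Lemma integral_rint X : rint X -> (\int[P]_w (X w)%:E)%E = (\int[P]_w X w)%:E.
Proof. by move=> iX; rewrite /Rintegral fineK//; exact: integrable_fin_num. Qed.

Lemma rint_ge0 X : measurable_fun setT X -> (forall w, 0 <= X w) ->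
  (\int[P]_w (X w)%:E < +oo)%E -> rint X.
Proof.
move=> mX X0 oX; apply/integrableP; split; first exact/measurable_EFinP.
by under eq_integral => w _ do rewrite /= ger0_norm//.
Qed.

Lemma Rintegral_sum (I : Type) (s : seq I) (F : I -> T -> R) :
  (forall i, rint (F i)) ->
  \int[P]_w (\sum_(i <- s) F i w) = \sum_(i <- s) \int[P]_w F i w.
Proof.
move=> iF; elim: s => [|i s IH].
  under eq_Rintegral do rewrite big_nil.
  by rewrite big_nil Rintegral_cst// mul0r.
under eq_Rintegral do rewrite big_cons.
rewrite big_cons RintegralD ?IH//; [exact: iF|exact: rint_sum].
Qed.

Lemma le_Rint X Y : rint X -> rint Y -> (forall w, X w <= Y w) ->
  \int[P]_w X w <= \int[P]_w Y w.
Proof. by move=> iX iY XY; apply: le_Rintegral. Qed.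

Lemma Rintegral_ae_eq X Y : measurable_fun setT X -> measurable_fun setT Y ->
  {ae P, forall w, X w = Y w} -> \int[P]_w X w = \int[P]_w Y w.
Proof.
move=> mX mY XY; congr fine; apply: ae_eq_integral => //.
- exact/measurable_EFinP.
- exact/measurable_EFinP.
- by apply: filterS XY => w /= ->.
Qed.

Lemma sqint_rint X : sqint X -> rint X.
Proof.
move=> [mX iX]; apply: (@rint_le _ (fun w => 1 + X w ^+ 2)) => //.
  move=> w; have : 0 <= (`|X w| - 1) ^+ 2 by exact: sqr_ge0.
  by rewrite -(real_normK (num_real (X w))); have := normr_ge0 (X w); nra.
by apply: rintD => //; exact: rint_cst.
Qed.

Lemma sqint_mul X Y : sqint X -> sqint Y -> rint (fun w => X w * Y w).
Proof.
move=> [mX iX] [mY iY].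
apply: (@rint_le _ (fun w => X w ^+ 2 + Y w ^+ 2)); last exact: rintD.
  exact: measurable_funM.
move=> w; rewrite ler_norml; apply/andP; split.
  by have := sqr_ge0 (X w + Y w); have := sqr_ge0 (X w); have := sqr_ge0 (Y w); nra.
by have := sqr_ge0 (X w - Y w); have := sqr_ge0 (X w); have := sqr_ge0 (Y w); nra.
Qed.

Lemma sqint_le X Y : measurable_fun setT X -> (forall w, `|X w| <= Y w) ->
  sqint Y -> sqint X.
Proof.
move=> mX XY [mY iY]; split => //; apply: rint_le iY => //.
  exact: measurable_funX.
move=> w; rewrite normrX lerXn2r// ?nnegrE//.
exact: le_trans (XY w).
Qed.

Lemma sqint_bounded X (M : R) : measurable_fun setT X ->
  (forall w, `|X w| <= M) -> sqint X.
Proof.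
move=> mX XM; apply: (@sqint_le _ (fun=> M)) => //; split => //.
exact: rint_cst.
Qed.

Lemma sqintD X Y : sqint X -> sqint Y -> sqint (fun w => X w + Y w).
Proof.
move=> sX sY; have [mX iX] := sX; have [mY iY] := sY.
split; first exact: measurable_funD.
under eq_fun do rewrite sqrrD.
apply: rintD => //; apply: rintD => //.
under eq_fun do rewrite -mulr_natl.
by apply: rintZ; exact: sqint_mul.
Qed.

Lemma sqintZ (c : R) X : sqint X -> sqint (fun w => c * X w).
Proof.
move=> [mX iX]; split; first exact: measurable_funM.
by under eq_fun do rewrite exprMn; exact: rintZ.
Qed.

Lemma sqintN X : sqint X -> sqint (fun w => - X w).
Proof. by move=> /(sqintZ (-1)); under eq_fun do rewrite mulN1r. Qed.

Lemma sqintB X Y : sqint X -> sqint Y -> sqint (fun w => X w - Y w).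
Proof. by move=> sX /sqintN; exact: sqintD. Qed.

Lemma sqint_norm X : sqint X -> sqint (fun w => `|X w|).
Proof.
move=> [mX iX]; split; first exact: measurableT_comp.
by under eq_fun do rewrite real_normK ?num_real//.
Qed.

Lemma sqint_sum (I : Type) (s : seq I) (F : I -> T -> R) :
  (forall i, sqint (F i)) -> sqint (fun w => \sum_(i <- s) F i w).
Proof.
move=> iF; elim: s => [|i s IH].
  by under eq_fun do rewrite big_nil; apply: (@sqint_bounded _ 0) => // w; rewrite normr0.
by under eq_fun do rewrite big_cons; exact: sqintD.
Qed.

(** The polynomial [t ^+ 2 * a - 2 * t * b + c] is the expectation of [(t * X w - Y w) ^+ 2], hence
    nonnegative for every [t]. *)
Lemma cauchy_schwarz_sqr X Y : sqint X -> sqint Y ->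
  (\int[P]_w (X w * Y w)) ^+ 2 <= \int[P]_w (X w ^+ 2) * \int[P]_w (Y w ^+ 2).
Proof.
move=> sX sY; set a := \int[P]_w (X w ^+ 2); set b := \int[P]_w (X w * Y w).
set c := \int[P]_w (Y w ^+ 2).
have a0 : 0 <= a by apply: Rintegral_ge0 => w _; exact: sqr_ge0.
have H (t : R) : 0 <= t ^+ 2 * a - 2 * t * b + c.
  have : 0 <= \int[P]_w ((t * X w - Y w) ^+ 2).
    by apply: Rintegral_ge0 => w _; exact: sqr_ge0.
  rewrite (_ : \int[P]_w _ = \int[P]_w
      (t ^+ 2 * X w ^+ 2 - 2 * t * (X w * Y w) + Y w ^+ 2)); last first.
    by apply: eq_Rintegral => w _; ring.
  have iX := sX.2; have iY := sY.2; have iXY := sqint_mul sX sY.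
  rewrite RintegralD//; last by apply: rintB; exact: rintZ.
  rewrite RintegralB//; [|exact: rintZ|exact: rintZ].
  by rewrite !RintegralZl.
have [a_eq0|a_neq0] := eqVneq a 0.
  rewrite a_eq0 mul0r; have [->|b0] := eqVneq b 0; first by rewrite expr0n.
  (* With [a] = 0 the polynomial is affine in [t], and at this point it would take the value -1. *)
  have := H ((c + 1) / (2 * b)); rewrite a_eq0 mulr0 add0r.
  rewrite (_ : 2 * ((c + 1) / (2 * b)) * b = c + 1); first by lra.
  by field.
have a_gt0 : 0 < a by rewrite lt_neqAle eq_sym a_neq0.
(* The minimizer of the polynomial. *)
have := H (b / a).
rewrite (_ : _ + c = (a * c - b ^+ 2) / a); last by field.
by rewrite pmulr_lge0 ?invr_gt0// subr_ge0.
Qed.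

Lemma cauchy_schwarz_sqrt X Y : sqint X -> sqint Y ->
  `|\int[P]_w (X w * Y w)| <=
  Num.sqrt (\int[P]_w (X w ^+ 2)) * Num.sqrt (\int[P]_w (Y w ^+ 2)).
Proof.
move=> sX sY; rewrite -sqrtrM; last first.
  by apply: Rintegral_ge0 => w _; exact: sqr_ge0.
by rewrite -sqrtr_sqr ler_sqrt ?cauchy_schwarz_sqr// (le_trans _ (cauchy_schwarz_sqr sX sY)) ?sqr_ge0.
Qed.

(** Convergence and domination are asked at every point, which the cut-off processes below provide;
    measurability of the limit is then inherited from the sequence. *)
Lemma rint_dominated (X_ : nat -> T -> R) X G :
  (forall n, measurable_fun setT (X_ n)) ->
  (forall w, X_ n w @[n --> \oo] --> X w) ->
  (forall n w, `|X_ n w| <= G w) -> rint G ->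
  rint X /\ \int[P]_w X_ n w @[n --> \oo] --> \int[P]_w X w.
Proof.
move=> mX_ cX XG iG.
have mX : measurable_fun setT X.
  by apply: (measurable_fun_cvg (h := X_)) => // w _; exact: cX.
have cXE w : (EFin \o X_^~ w) @ \oo --> (X w)%:E.
  by apply/fine_cvgP; split; [exact: nearW|exact: cX].
have [iX _ cE] := @dominated_convergence _ _ _ P setT measurableT
  (fun n => EFin \o X_ n) (EFin \o X) (EFin \o G)
  (fun n => (measurable_EFinP _ _).2 (mX_ n)) ((measurable_EFinP _ _).2 mX)
  (aeW _ (fun w _ => cXE w)) iG (aeW _ (fun w n _ => XG n w)).
split => //.
by apply: fine_cvg; rewrite -integral_rint.
Qed.

End square_integrable.

(** * Gaussian moments and independence *)

Section density.
Local Open Scope ereal_scope.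
Context d (T : measurableType d) (R : realType).
Variables (mu nu : {measure set T -> \bar R}) (p : T -> R).
Hypothesis p_ge0 : forall x, (0 <= p x)%R.
Hypothesis mp : measurable_fun setT p.
Hypothesis nuE : forall A, measurable A -> nu A = \int[mu]_(x in A) (p x)%:E.

Import HBNNSimple.

(** Simple functions increasing to [f] reduce the claim to indicators of level sets, where it is
    [nuE]. Negative levels contribute nothing, since their level sets are empty. *)
Lemma ge0_integral_density (f : T -> \bar R) : (forall x, 0 <= f x) ->
  measurable_fun setT f ->
  \int[nu]_x f x = \int[mu]_x (f x * (p x)%:E).
Proof.
move=> f0 mf; pose h := nnsfun_approx measurableT mf.
have mpE : measurable_fun setT (EFin \o p) by exact/measurable_EFinP.
have -> : \int[nu]_x f x = lim (\int[nu]_x (EFin \o h n) x @[n --> \oo]).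
  have fE x : f x = lim ((EFin \o h n) x @[n --> \oo]).
    by apply/esym/cvg_lim => //; exact: cvg_nnsfun_approx.
  under eq_integral => x _ do rewrite fE.
  apply: monotone_convergence => //.
  - by move=> n; exact/measurable_EFinP.
  - by move=> n x _ /=; rewrite lee_fin.
  - by move=> x _ a b ab; rewrite lee_fin; exact/lefP/nd_nnsfun_approx.
have -> : \int[mu]_x (f x * (p x)%:E) =
    lim (\int[mu]_x ((EFin \o h n) x * (p x)%:E) @[n --> \oo]).
  have fg x : f x * (p x)%:E = lim (((EFin \o h n) x * (p x)%:E) @[n --> \oo]).
    by apply/esym/cvg_lim => //; apply: cvgeZr => //; exact: cvg_nnsfun_approx.
  under eq_integral => x _ do rewrite fg.
  apply: monotone_convergence => [//| | |].
  - by move=> n; apply: emeasurable_funM => //; exact/measurable_EFinP.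
  - by move=> n x _ /=; rewrite mule_ge0 ?lee_fin.
  - by move=> x _ a b ab/=; rewrite lee_wpmul2r ?lee_fin//; exact/lefP/nd_nnsfun_approx.
congr (lim _); apply/funext => A; apply/propext; rewrite /nbhs/=.
suff H n : \int[nu]_x (EFin \o h n) x = \int[mu]_x ((EFin \o h n) x * (p x)%:E).
  by under eq_fun do rewrite H.
under eq_integral => x _ do rewrite /= fimfunE -fsumEFin//.
have indich r : measurable_fun setT (fun x => (r * \1_(h n @^-1` [set r]) x)%:E).
  by apply/measurable_EFinP; exact: measurable_funM.
rewrite ge0_integral_fsum//; last by move=> m y Ey; exact: nnfun_muleindic_ge0.
transitivity (\int[mu]_x (\sum_(y \in range (h n))
    (y * \1_(h n @^-1` [set y]) x)%:E * (p x)%:E)); last first.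
  apply: eq_integral => x _; rewrite [in RHS]/= fimfunE -fsumEFin//.
  by rewrite ge0_mule_fsuml// => y; exact: nnfun_muleindic_ge0.
rewrite ge0_integral_fsum//; last 2 first.
  - by move=> y; apply: emeasurable_funM.
  - by move=> m y Ey; rewrite mule_ge0 ?lee_fin// -?lee_fin ?nnfun_muleindic_ge0.
apply: eq_fsbigr => r rhn.
rewrite integralZl_indic_nnsfun// integral_indic// setIT nuE//.
under [RHS]eq_integral do rewrite EFinM -muleA.
have [r0|r0] := leP 0%R r; last first.
  rewrite preimage_nnfun0// integral_set0 mule0 integral0_eq// => x _.
  by rewrite indicE in_set0 mul0e mule0.
rewrite ge0_integralZl//; last first.
  - by move=> x _; rewrite mule_ge0 ?lee_fin.
  - by apply: emeasurable_funM => //; exact/measurable_EFinP.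
congr (_ * _); rewrite [LHS]integral_mkcond; apply: eq_integral => x _.
rewrite patchE indicE; case: ifPn => _; by rewrite ?mul1e ?mul0e.
Qed.

End density.

Section normal_moments.
Context (R : realType) (s : R).
Hypothesis s0 : 0 < s.
Notation mu := (@lebesgue_measure R).
Let phi : R -> R := normal_pdf 0 s.

Let sN0 : s != 0. Proof. by rewrite gt_eqF. Qed.

Let phiE : phi = fun x => normal_peak s * expR (- x ^+ 2 / (s ^+ 2 *+ 2)).
Proof.
by rewrite /phi normal_pdfE//; apply/funext => x; rewrite /normal_fun subr0.
Qed.

Let phi_ge0 x : 0 <= phi x. Proof. exact: normal_pdf_ge0. Qed.

Let phiN x : phi (- x) = phi x. Proof. by rewrite phiE sqrrN. Qed.

Let cphi : continuous phi. Proof. exact: continuous_normal_pdf. Qed.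

Let is_derive_phi (x : R) : is_derive x (1 : R) phi (- x / s ^+ 2 * phi x).
Proof.
have H : is_derive x (1 : R) (fun x : R => - x ^+ 2 / (s ^+ 2 *+ 2)) (- x / s ^+ 2).
  rewrite (_ : (fun x : R => _) = (- (s ^+ 2 *+ 2)^-1) \*: (fun x : R => x ^+ 2)); last first.
    by apply/funext => y /=; rewrite /GRing.scale /=; ring.
  have HX : is_derive x (1 : R) (fun x : R => x ^+ 2) (2 * x).
    rewrite (_ : (fun x : R => x ^+ 2) = (id : R -> R) * id); last first.
      by apply/funext => y; rewrite expr2.
    by apply: is_derive_eq; rewrite /GRing.scale /=; ring.
  apply: is_derive_eq; rewrite /GRing.scale /=.
  by rewrite -[s ^+ 2 *+ 2]mulr_natr; field.
rewrite phiE.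
rewrite (_ : (fun x0 => _) = (normal_peak s) \*: (expR \o (fun x : R => - x ^+ 2 / (s ^+ 2 *+ 2)))); last first.
  by apply/funext.
have H2 := is_derive1_comp (is_derive_expR _) H.
apply: is_derive_eq; rewrite /GRing.scale /=.
by ring.
Qed.

(** The antiderivative that encodes integration by parts: it trades [x ^+ 2 * phi x] for
    [s ^+ 2 * phi x] up to a boundary term. *)
Let is_derive_xphi (x : R) :
  is_derive x (1 : R) (fun x => - (s ^+ 2 * x * phi x)) ((x ^+ 2 - s ^+ 2) * phi x).
Proof.
have Hp := is_derive_phi x.
rewrite (_ : (fun x => _) = (- s ^+ 2) \*: (id * phi)); last first.
  apply/funext => y; rewrite -[RHS]/(- s ^+ 2 * (y * phi y)); ring.
apply: is_derive_eq; rewrite /GRing.scale /=.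
by field.
Qed.

Let second_moment_itv (n : nat) :
  (\int[mu]_(x in `[0%R, n%:R]) (x ^+ 2 * phi x)%:E =
   (s ^+ 2)%:E * \int[mu]_(x in `[0%R, n%:R]) (phi x)%:E
   - (s ^+ 2 * n%:R * phi n%:R)%:E)%E.
Proof.
have [->|n0] := eqVneq n 0%N.
  by rewrite set_itv1 !integral_set1 mule0 !mulr0 mul0r sube0.
have nR : (0 : R) < n%:R by rewrite ltr0n lt0n.
have cf : continuous (fun x : R => (x ^+ 2 - s ^+ 2) * phi x).
  move=> x; apply: cvgM; last exact: cphi.
  by apply: cvgB; [exact: exprn_continuous|exact: cvg_cst].
have ipf (f : R -> R) : continuous f -> mu.-integrable `[0%R, n%:R] (EFin \o f).
  move=> cf'; apply: continuous_compact_integrable; first exact: segment_compact.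
  exact: continuous_subspaceT.
have cF : continuous (fun x => - (s ^+ 2 * x * phi x)).
  by move=> x; apply: differentiable_continuous; apply/derivable1_diffP; have [] := is_derive_xphi x.
have E0 : (\int[mu]_(x in `[0%R, n%:R]) ((x ^+ 2 - s ^+ 2) * phi x)%:E =
    (- (s ^+ 2 * n%:R * phi n%:R))%:E)%E.
  rewrite (@continuous_FTC2 R _ (fun x => - (s ^+ 2 * x * phi x)) _ _ nR
    (continuous_subspaceT cf)); first by rewrite mulr0 mul0r oppr0 sube0.
  - split => [x _| |]; first by have [] := is_derive_xphi x.
    + by apply: cvg_at_right_filter; exact: cF.
    + by apply: cvg_at_left_filter; exact: cF.
  - by move=> x _; rewrite derive1E; have [_ ->] := is_derive_xphi x.
rewrite -EFinN -E0.
rewrite -integralZl//; last exact: ipf.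
rewrite -integralD//; last 2 first.
- by apply: integrableZl => //; exact: ipf.
- exact: ipf.
by apply: eq_integral => x _; rewrite -EFinM -EFinD; congr EFin; ring.
Qed.

(** From [expR y >= 1 + y] with y = n^2 / (2 s^2), the quantity is at most the peak times n / (1 +
    n^2 / (2 s^2)), and the fraction is at most 4 s^2 / (n + 1). *)
Let cvg_nphi : n%:R * phi n%:R @[n --> \oo] --> (0 : R).
Proof.
apply: (@cvg0_le _ _ (fun n => normal_peak s * (s ^+ 2 *+ 2) * 2 * harmonic n)).
  move=> n; rewrite ger0_norm ?mulr_ge0//.
  rewrite phiE mulrCA -!mulrA ler_wpM2l ?normal_peak_ge0//.
  rewrite mulNr expRN /harmonic /=.
  have y0 : 0 < 1 + n%:R ^+ 2 / (s ^+ 2 *+ 2) :> R.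
    by rewrite ltr_pwDl// divr_ge0 ?sqr_ge0// mulrn_wge0 ?sqr_ge0.
  apply: (@le_trans _ _ (n%:R / (1 + n%:R ^+ 2 / (s ^+ 2 *+ 2)))).
    by rewrite ler_wpM2l// lef_pV2 ?posrE ?expR_gt0// expR_ge1Dx.
  have c0 : 0 < s ^+ 2 *+ 2 by rewrite mulrn_wgt0// exprn_gt0.
  have nn : n%:R <= n%:R ^+ 2 :> R by rewrite -natrX ler_nat; case: (n) => // m; rewrite -mulnn leq_pmulr.
  rewrite ler_pdivrMr// -(natr1 n).
  move: y0 nn c0; move: (s ^+ 2 *+ 2) (n%:R : R) (ler0n R n) => c m m0 y0 nn c0.
  rewrite (_ : c * _ * _ = 2 * (c + m ^+ 2) / (m + 1)); last by field; rewrite ?gt_eqF ?ltr_wpDl.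
  by rewrite ler_pdivlMr ?ltr_wpDl//; nra.
rewrite -(mulr0 (normal_peak s * (s ^+ 2 *+ 2) * 2)).
by apply: cvgMr; exact: cvg_harmonic.
Qed.

(** By symmetry the moment is twice an integral over the half-line. On [[0, n]] integration by parts
    reduces it to the mass of the density, and the boundary term at [n] vanishes in the limit. *)
Lemma normal_second_moment :
  (\int[normal_prob 0 s]_x (x ^+ 2)%:E = (s ^+ 2)%:E)%E.
Proof.
rewrite (@ge0_integral_density _ _ _ mu _ phi)//; last 3 first.
- exact: measurable_normal_pdf.
- by move=> x; rewrite lee_fin sqr_ge0.
- by apply/measurable_EFinP; exact: measurable_funX.
under eq_integral do rewrite -EFinM.
have nn : [set x : R | 0 <= x] = `[0, +oo[%classic.
  by apply/seteqP; split => x /=; rewrite in_itv/= andbT.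
rewrite ge0_symfun_integralT; last 3 first.
- by move=> x; rewrite mulr_ge0 ?sqr_ge0.
- by move=> x; apply: cvgM; [exact: exprn_continuous|exact: cphi].
- by move=> x /=; rewrite sqrrN phiN.
rewrite nn.
have I1 : (1 = 2%:E * \int[mu]_(x in `[0%R, +oo[) (phi x)%:E)%E.
  rewrite -[LHS](@integral_normal_pdf _ 0 s) (ge0_symfun_integralT phi_ge0 cphi) ?nn//.
  by move=> x; rewrite /comp phiN.
have c2 := @ge0_cvgn_integral R mu (fun x => x ^+ 2 * phi x)
  (fun x => mulr_ge0 (sqr_ge0 x) (phi_ge0 x))
  (measurable_funM (measurable_funX 2 (@measurable_id _ _ _)) (measurable_normal_pdf _ _)).
have c1 := @ge0_cvgn_integral R mu phi phi_ge0 (measurable_normal_pdf _ _).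
have c3 : ((s ^+ 2)%:E * \int[mu]_(x in `[0%R, n%:R]) (phi x)%:E
    - (s ^+ 2 * n%:R * phi n%:R)%:E)%E @[n --> \oo] -->
    ((s ^+ 2)%:E * \int[mu]_(x in `[0%R, +oo[) (phi x)%:E - 0%:E)%E.
  apply: cvgeB.
  - by rewrite fin_num_adde_defl.
  - by apply: cvgeZl; [|exact: c1].
  - apply/fine_cvgP; split; first exact: nearW.
    rewrite -(mulr0 (s ^+ 2)) /comp /=.
    by under eq_fun do rewrite -mulrA; apply: cvgMr; exact: cvg_nphi.
rewrite (cvg_unique _ c2 (_ : _ --> (s ^+ 2)%:E * \int[mu]_(x in `[0%R, +oo[) (phi x)%:E)%E)//; last first.
  by under eq_cvg do rewrite second_moment_itv; rewrite sube0 in c3.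
by rewrite muleCA -I1 mule1.
Qed.

Let integral_sym (f : R -> R) : (forall x, 0 <= f x) -> measurable_fun setT f ->
  (\int[normal_prob 0 s]_x (f (- x))%:E = \int[normal_prob 0 s]_x (f x)%:E)%E.
Proof.
move=> f0 mf.
have mN : measurable_fun setT (-%R : R -> R) by exact: oppr_measurable.
have mfN : measurable_fun setT (fun x : R => f (- x)) by exact: measurableT_comp.
have mphi : measurable_fun setT phi by exact: measurable_normal_pdf.
have dens (g : R -> R) : (forall x, 0 <= g x) -> measurable_fun setT g ->
    (\int[normal_prob 0 s]_x (g x)%:E = \int[mu]_x (g x * phi x)%:E)%E.
  move=> g0 mg; rewrite (@ge0_integral_density _ _ _ mu _ phi phi_ge0 mphi)//.
  exact: (measurableT_comp (@EFin_measurable _ setT) mg).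
rewrite dens// dens//.
have mfp : measurable_fun setT (fun x => f x * phi x) by exact: measurable_funM.
transitivity (\int[pushforward mu (-%R : _ -> measurableTypeR R)]_x (f x * phi x)%:E)%E.
  have mEfp : measurable_fun setT (fun x => (f x * phi x)%:E) by exact/measurable_EFinP.
  have fp0 : {in setT, forall x, (0 <= (f x * phi x)%:E)%E}.
    by move=> x _; rewrite lee_fin mulr_ge0.
  have mNR : measurable_fun setT (-%R : measurableTypeR R -> measurableTypeR R) by exact: mN.
  rewrite (ge0_integral_pushforward mNR mu measurableT mEfp fp0) preimage_setT.
  by apply: eq_integral => x _ /=; rewrite phiN.
apply: eq_measure_integral => A mA _.
exact: lebesgue_measureN.
Qed.

(** The second moment makes the identity integrable. It is then the difference of the positive part
    of x and the positive part of -x, which have the same integral by symmetry of the law. *)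
Lemma normal_first_moment : \int[normal_prob 0 s]_x x = 0.
Proof.
have sid : sqint (normal_prob 0 s) (id : R -> R).
  split; first exact: measurable_id.
  apply: rint_ge0 => [|x|]; [exact: measurable_funX|exact: sqr_ge0|].
  by rewrite normal_second_moment ltry.
pose p (x : R) := Num.max x 0.
have mp : measurable_fun setT p by apply: measurable_maxr.
have p0 x : 0 <= p x by rewrite /p le_max lexx orbT.
have ip : rint (normal_prob 0 s) p.
  apply: (@rint_le _ _ _ (normal_prob 0 s) p (fun x => `|x|) mp _
    (rint_norm (sqint_rint sid))) => x.
  by rewrite ger0_norm// /p ge_max ler_norm normr_ge0.
have ipN : rint (normal_prob 0 s) (fun x => p (- x)).
  apply: (@rint_le _ _ _ (normal_prob 0 s) (fun x => p (- x)) (fun x => `|x|) _ _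
    (rint_norm (sqint_rint sid))) => [|x].
    exact: (measurableT_comp mp (@oppr_measurable R setT)).
  by rewrite ger0_norm// /p ge_max -normrN ler_norm normr_ge0.
transitivity (\int[normal_prob 0 s]_x (p x - p (- x))).
  apply: eq_Rintegral => x _; rewrite /p; case: (lerP x 0) => x0.
    by rewrite max_l ?oppr_ge0// sub0r opprK.
  by rewrite max_r ?oppr_le0 ?ltW// subr0.
rewrite RintegralB//; apply/eqP; rewrite subr_eq0; apply/eqP.
by rewrite /Rintegral integral_sym.
Qed.

End normal_moments.

Section independence.
Context d (T : measurableType d) (R : realType) (P : probability T R).

(** The joint law agrees with the product of the two laws on rectangles, hence everywhere; Tonelli
    gives the integrability of the product and Fubini its expectation. *)
Lemma indep_expectationM (X Y : T -> R) : rint P X -> rint P Y ->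
  (forall A B : set R, measurable A -> measurable B ->
    P (X @^-1` A `&` Y @^-1` B) = (P (X @^-1` A) * P (Y @^-1` B))%E) ->
  rint P (fun w => X w * Y w) /\
  \int[P]_w (X w * Y w) = \int[P]_w X w * \int[P]_w Y w.
Proof.
move=> iX iY XY; have mX := rint_measurable iX; have mY := rint_measurable iY.
pose X' := mfun_Sub (mem_set mX : X \in mfun).
pose Y' := mfun_Sub (mem_set mY : Y \in mfun).
have mXY : measurable_fun setT (fun w => (X w, Y w)).
  exact: measurable_fun_pair.
pose XY' := mfun_Sub (mem_set mXY : (fun w => (X w, Y w)) \in mfun).
pose m1 := distribution P X'; pose m2 := distribution P Y'.
pose m' := distribution P XY'.
have m'E (C : set (R * R)) : measurable C -> (m1 \x m2)%E C = m' C.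
  apply: product_measure_unique => A B mA mB.
  exact: XY.
have mprod : measurable_fun setT (fun z : R * R => (z.1 * z.2)%:E).
  by apply/measurable_EFinP; apply: measurable_funM.
have iX1 : (\int[m1]_x `|x|%:E = (\int[P]_w `|X w|)%:E)%E.
  rewrite ge0_integral_pushforward//; last exact/measurable_EFinP.
  by rewrite preimage_setT -integral_rint//; exact: rint_norm.
have iY1 : (\int[m2]_x `|x|%:E = (\int[P]_w `|Y w|)%:E)%E.
  rewrite ge0_integral_pushforward//; last exact/measurable_EFinP.
  by rewrite preimage_setT -integral_rint//; exact: rint_norm.
have iX2 : (\int[m1]_x x%:E = (\int[P]_w X w)%:E)%E.
  by rewrite integral_pushforward// ?preimage_setT// -integral_rint.
have iY2 : (\int[m2]_x x%:E = (\int[P]_w Y w)%:E)%E.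
  by rewrite integral_pushforward// ?preimage_setT// -integral_rint.
have im2 : m2.-integrable setT (EFin : R -> \bar R).
  apply/integrableP; split; first exact/measurable_EFinP.
  by rewrite (_ : (\int[m2]_x `|x%:E|)%E = (\int[m2]_x `|x|%:E)%E)// iY1 ltry.
have im1 : m1.-integrable setT (EFin : R -> \bar R).
  apply/integrableP; split; first exact/measurable_EFinP.
  by rewrite (_ : (\int[m1]_x `|x%:E|)%E = (\int[m1]_x `|x|%:E)%E)// iX1 ltry.
have iprod : (m1 \x m2)%E.-integrable setT (fun z : R * R => (z.1 * z.2)%:E).
  apply/integrable12ltyP => //=.
  rewrite (_ : (\int[m1]_x _)%E =
      (\int[m1]_x (`|x|%:E * (\int[P]_w `|Y w|)%:E))%E); last first.
    apply: eq_integral => x _.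
    transitivity (\int[m2]_y (`|x|%:E * `|y|%:E))%E.
      by apply: eq_integral => y _; rewrite normrM EFinM.
    rewrite ge0_integralZl ?lee_fin//; first by rewrite iY1.
    by apply/measurable_EFinP; exact: normr_measurable.
  rewrite ge0_integralZr//; [by rewrite iX1 -EFinM ltry| |by rewrite lee_fin; apply: Rintegral_ge0].
  by apply/measurable_EFinP; exact: normr_measurable.
have ipXY : rint P (fun w => X w * Y w).
  apply/integrableP; split; first by apply/measurable_EFinP; exact: measurable_funM.
  have /integrableP[_] := iprod.
  rewrite (@eq_measure_integral _ _ _ setT m'); last by move=> A mA _; exact: m'E.
  rewrite ge0_integral_pushforward//; exact: measurableT_comp.
split => //.
apply: EFin_inj; rewrite -integral_rint// EFinM -iX2 -iY2.
transitivity (\int[m1 \x m2]_z (z.1 * z.2)%:E)%E.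
  rewrite [RHS](@eq_measure_integral _ _ _ setT m'); last by move=> A mA _; exact: m'E.
  by rewrite integral_pushforward.
rewrite -integral12_prod_meas1//= /fubini_F.
transitivity (\int[m1]_x (x%:E * (\int[P]_w Y w)%:E))%E.
  apply: eq_integral => x _.
  transitivity (\int[m2]_y (x%:E * y%:E))%E; first exact: eq_integral.
  by rewrite integralZl// iY2.
by rewrite integralZr// iY2.
Qed.

End independence.

(** * Filtration and Brownian increments *)

Section sub_sigma_algebra.
Context d (Omega : measurableType d) d' (V : measurableType d').
Implicit Types (G : set (set Omega)) (X : Omega -> V).

Lemma sigma_measurable_le G G' X : G `<=` <<s G' >> ->
  measurable_fun setT (X : g_sigma_algebraType G -> V) ->
  measurable_fun setT (X : g_sigma_algebraType G' -> V).
Proof.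
move=> GG' mX _ A mA; have := mX measurableT A mA.
by apply: smallest_sub => //; exact: smallest_sigma_algebra.
Qed.

Lemma sigma_measurable_ambient G X : G `<=` measurable ->
  measurable_fun setT (X : g_sigma_algebraType G -> V) ->
  measurable_fun setT X.
Proof.
move=> GG' mX _ A mA; have := mX measurableT A mA.
by apply: smallest_sub => //; exact: sigma_algebra_measurable.
Qed.

End sub_sigma_algebra.

Section coordinates.
Context (R : realType) (d : nat).

Lemma measurable_coord (i : 'I_d) :
  measurable_fun setT (fun u : borel_rV R d => (u : 'rV[R]_d) 0 i).
Proof.
apply: (measurability _ (RGenOpens.measurableE R)).
move=> _ [_ [a [b ->] <-]]; rewrite setTI; apply: sub_sigma_algebra.
have /continuousP := @coord_continuous R 1 d 0 i.
by apply; exact: interval_open.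
Qed.

End coordinates.

Section filtration.
Context (R : realType) (T : R) (d : nat) (disp : measure_display)
  (Omega : measurableType disp) (P : probability Omega R)
  (W : R -> Omega -> 'rV[R]_d) (J : countType) (B : J -> R -> Omega -> 'rV[R]_d).
Hypothesis hN : noise_setting P T W B.
Local Notation F := (brownian_filtration P T W B).

Let Pcomplete : measure_is_complete P. Proof. by have [] := hN. Qed.

Lemma history_measurable (X : R -> Omega -> 'rV[R]_d) t : t <= T ->
  (forall r, r \in `[0, T] -> measurable_fun setT (X r : Omega -> borel_rV R d)) ->
  history X t `<=` measurable.
Proof.
move=> tT mX A [r [C [r0t mC ->]]]; rewrite -[X in measurable X]setTI.
apply: (mX r) => //; move: r0t; rewrite !in_itv/= => /andP[-> /le_trans].
exact.
Qed.

Lemma noise_measurable : noise_sigma T B `<=` measurable.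
Proof.
apply: smallest_sub; first exact: sigma_algebra_measurable.
move=> A [j _]; apply: history_measurable => // r rT.
by have [_ _ /(_ j)[mB _ _ _ _] _ _] := hN; exact: mB.
Qed.

Lemma brownian_measurable r : r \in `[0, T] ->
  measurable_fun setT (W r : Omega -> borel_rV R d).
Proof. by have [_ [mW _ _ _ _] _ _ _] := hN; exact: mW. Qed.

Lemma filtration_measurable t : t <= T -> F t `<=` measurable.
Proof.
move=> tT; apply: smallest_sub; first exact: sigma_algebra_measurable.
rewrite !subUset; split; first split.
- by apply: history_measurable => // r; exact: brownian_measurable.
- exact: noise_measurable.
- exact: Pcomplete.
Qed.

Lemma filtration_le s t : s <= t -> F s `<=` F t.
Proof.
move=> st; apply: smallest_sub; first exact: smallest_sigma_algebra.
apply: (subset_trans _ (@sub_sigma_algebra _ setT _)).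
rewrite !subUset; split; first split.
- move=> A [r [C [r0t mC ->]]]; left; left; exists r, C; split => //.
  by move: r0t; rewrite !in_itv/= => /andP[-> /le_trans]; exact.
- by move=> A; left; right.
- by move=> A; right.
Qed.

Lemma filtration_negligible t : P.-negligible `<=` F t.
Proof. by move=> A NA; apply: sub_sigma_algebra; right. Qed.

Lemma filtration_brownian s t k : 0 <= s -> s <= t ->
  measurable_fun setT (fun w : g_sigma_algebraType (F t) => W s w 0 k).
Proof.
move=> s0 st; apply: (measurableT_comp (measurable_coord k)) => _ A mA.
rewrite setTI; apply: sub_sigma_algebra; apply: sub_sigma_algebra; left; left.
by exists s, A; split => //; rewrite in_itv/= s0.
Qed.

(** One clause for each independence assumption: the first separates [D] from the noise, the second
    from the past of [W]. *)
Definition increment_event s t (D : set Omega) : Prop :=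
  <<s history W T >> D /\
  exists C : set (borel_rV R d), measurable C /\ D = [set w | C (W t w - W s w)].

Lemma history_brownian_measurable r k : 0 <= r -> r <= T ->
  measurable_fun setT (fun w : g_sigma_algebraType (history W T) => W r w 0 k).
Proof.
move=> r0 rT; apply: (measurableT_comp (measurable_coord k)) => _ A mA.
rewrite setTI; apply: sub_sigma_algebra.
by exists r, A; split => //; rewrite in_itv/= r0.
Qed.

(** Both sides are finite measures in [A]. They coincide on a pi-system whose generated
    sigma-algebra contains [F s]. *)
Lemma indep_filtration_increment s t A D : 0 <= s -> s < t -> t <= T ->
  F s A -> increment_event s t D -> P (A `&` D) = (P A * P D)%E.
Proof.
move=> s0 st tT FA DD.
have [_ [mW _ _ _ indW] _ _ indN] := hN.
have sT : s <= T by rewrite (le_trans (ltW st)).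
have t0 : 0 <= t by rewrite (le_trans s0)// ltW.
have HWT D' : <<s history W s >> D' -> <<s history W T >> D'.
  apply: smallest_sub; first exact: smallest_sigma_algebra.
  apply: (subset_trans _ (@sub_sigma_algebra _ setT _)).
  move=> A' [r [C [r0t mC ->]]]; exists r, C; split => //.
  by move: r0t; rewrite !in_itv/= => /andP[-> /le_trans]; exact.
have mHT : <<s history W T >> `<=` measurable.
  apply: smallest_sub; first exact: sigma_algebra_measurable.
  by apply: history_measurable => // r; exact: brownian_measurable.
have [DT DC] := DD.
have mD : measurable D by exact: mHT.
(* Events that agree, off a null set, with the intersection of a past event of [W] and a noise
   event. All generators of [F s] are of this form, and the form is stable under intersection, which
   the union of the three generating families is not. *)
pose Pi := [set E : set Omega | measurable E /\ exists A N Z : set Omega,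
  [/\ <<s history W s >> A, noise_sigma T B N, P.-negligible Z &
    forall w, ~ Z w -> (E w <-> A w /\ N w)]].
have PiI : setI_closed Pi.
  move=> E1 E2 [mE1 [A1 [N1 [Z1 [hA1 hN1 hZ1 E1E]]]]] [mE2 [A2 [N2 [Z2 [hA2 hN2 hZ2 E2E]]]]].
  split; first exact: measurableI.
  exists (A1 `&` A2), (N1 `&` N2), (Z1 `|` Z2); split.
  - exact: (@measurableI _ (g_sigma_algebraType (history W s))).
  - exact: (@measurableI _ (g_sigma_algebraType (\bigcup_j history (B j) T))).
  - exact: negligibleU.
  - move=> w /not_orP[/E1E e1 /E2E e2]; rewrite /setI /=; tauto.
have PiT : Pi setT.
  split => //; exists setT, setT, set0; split; [| |exact: negligible_set0|by []].
  - exact: (@measurableT _ (g_sigma_algebraType (history W s))).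
  - exact: (@measurableT _ (g_sigma_algebraType (\bigcup_j history (B j) T))).
have FPi : F s `<=` <<s Pi >>.
  apply: smallest_sub; first exact: smallest_sigma_algebra.
  apply: (subset_trans _ (@sub_sigma_algebra _ setT _)).
  rewrite !subUset; split; first split.
  - move=> E hE; have sE : <<s history W s >> E by exact: sub_sigma_algebra.
    split; first by apply: mHT; exact: HWT.
    exists E, setT, set0; split; [exact: sE| |exact: negligible_set0|].
      exact: (@measurableT _ (g_sigma_algebraType (\bigcup_j history (B j) T))).
    by move=> w _; split => [|[]].
  - move=> E hE; split; first exact: noise_measurable.
    exists setT, E, set0; split; [|exact: hE|exact: negligible_set0|].
      exact: (@measurableT _ (g_sigma_algebraType (history W s))).
    by move=> w _; split => [|[]].
  - move=> E hE; split; first exact: Pcomplete.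
    exists set0, setT, E; split; [| |exact: hE|].
    + exact: (@measurable0 _ (g_sigma_algebraType (history W s))).
    + exact: (@measurableT _ (g_sigma_algebraType (\bigcup_j history (B j) T))).
    + by move=> w nE; split => [|[]].
have PDfin : P D \is a fin_num by exact: fin_num_measure.
have PD0 : 0 <= fine (P D) by rewrite fine_ge0.
pose m2 := mscale (NngNum PD0) P.
pose m1 := mrestr P mD.
suff : m1 A = m2 A by rewrite /m1 /mrestr /m2 /mscale /= fineK// muleC.
have PiM : Pi `<=` measurable by move=> E [].
apply: (g_sigma_algebra_measure_unique Pi PiM (fun=> setT)) => //.
- by rewrite bigcup_const.
- move=> E [mE [A1 [N1 [Z1 [hA1 hN1 hZ1 E1E]]]]].
  have mA1 : measurable A1 by apply: mHT; exact: HWT.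
  have mN1 : measurable N1 by exact: noise_measurable.
  have aeP (X Y : set Omega) : measurable X -> measurable Y ->
      (forall w, ~ Z1 w -> (X w <-> Y w)) -> P X = P Y.
    move=> mX mY XY; rewrite -(setIT X) -(setIT Y) -!integral_indic//.
    apply: ae_eq_integral => //.
    - exact/measurable_EFinP.
    - exact/measurable_EFinP.
    - have [Z [mZ Z0 ZZ]] := hZ1; exists Z; split => // w /= nw; apply: ZZ.
      apply: contrapT => nZ; apply: nw => _; rewrite !indicE.
      have [h1 h2] := XY _ nZ.
      by rewrite (_ : (w \in X) = (w \in Y))//; apply/idP/idP; rewrite !inE.
  change (P (E `&` D) = ((fine (P D))%:E * P E)%E); rewrite fineK//.
  rewrite (aeP E (A1 `&` N1))//; [|exact: measurableI].
  rewrite (aeP (E `&` D) (A1 `&` D `&` N1)); [| | |]; last first.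
  + by move=> w /E1E; rewrite /setI /=; tauto.
  + by apply: measurableI => //; exact: measurableI.
  + exact: measurableI.
  (* [A1] and [D] both belong to the history of [W], so the noise event splits off before the
     independence of increments separates [A1] from [D]. *)
  rewrite (indN (A1 `&` D) N1)//; last first.
    by apply: (@measurableI _ (g_sigma_algebraType (history W T))) => //; exact: HWT.
  rewrite (indN A1 N1)//; last exact: HWT.
  rewrite (indW s t)//.
  by rewrite muleAC muleC muleA.
- move=> _; change (P (setT `&` D) < +oo)%E.
  by rewrite setTI ltey_eq PDfin.
- exact: FPi.
Qed.

End filtration.

(** * Moments of Brownian increments *)

Section increments.
Context (R : realType) (T : R) (d : nat) (disp : measure_display)
  (Omega : measurableType disp) (P : probability Omega R)
  (W : R -> Omega -> 'rV[R]_d) (J : countType) (B : J -> R -> Omega -> 'rV[R]_d).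
Hypothesis hN : noise_setting P T W B.
Local Notation F := (brownian_filtration P T W B).

Definition increment s t (k : 'I_d) (w : Omega) : R := (W t w - W s w) 0 k.

Lemma incrementE s t k w : increment s t k w = W t w 0 k - W s w 0 k.
Proof. by rewrite /increment !mxE. Qed.

Lemma increment_measurable_history s t k : 0 <= s -> s <= t -> t <= T ->
  measurable_fun setT (increment s t k : g_sigma_algebraType (history W T) -> R).
Proof.
move=> s0 st tT; rewrite (_ : increment s t k = fun w => W t w 0 k - W s w 0 k); last first.
  by apply/funext => w; rewrite incrementE.
by apply: measurable_funB; apply: history_brownian_measurable => //;
  [exact: le_trans st|exact: le_trans tT].
Qed.

Lemma increment_filtration s t k : 0 <= s -> s <= t ->
  measurable_fun setT (increment s t k : g_sigma_algebraType (F t) -> R).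
Proof.
move=> s0 st; rewrite (_ : increment s t k = fun w => W t w 0 k - W s w 0 k); last first.
  by apply/funext => w; rewrite incrementE.
by apply: measurable_funB; apply: filtration_brownian => //; exact: le_trans st.
Qed.

Lemma increment_measurable s t k : 0 <= s -> s <= t -> t <= T ->
  measurable_fun setT (increment s t k).
Proof.
move=> s0 st tT; apply: (@sigma_measurable_ambient _ _ _ _ (F t)).
  exact: (filtration_measurable hN).
exact: increment_filtration.
Qed.

Lemma increment_law s t k (A : set R) : 0 <= s -> s < t -> t <= T ->
  measurable A ->
  P (increment s t k @^-1` A) = normal_prob 0 (Num.sqrt (t - s)) A.
Proof.
move=> s0 st tT mA.
have [_ [_ _ _ lawW _] _ _ _] := hN.
have := lawW s t s0 st tT (fun i => if i == k then A else setT).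
rewrite (_ : [set w | _] = increment s t k @^-1` A); last first.
  apply/seteqP; split => w /=; first by move=> /(_ k); rewrite eqxx.
  by move=> Aw i; case: eqP => // ->.
move=> ->; last by move=> i; case: ifP.
rewrite (bigD1 k)//= eqxx big1 ?mule1// => i /negbTE ->.
exact: probability_setT.
Qed.

Lemma increment_pair_law s t k l (A A' : set R) : 0 <= s -> s < t -> t <= T ->
  k != l -> measurable A -> measurable A' ->
  P (increment s t k @^-1` A `&` increment s t l @^-1` A') =
  (P (increment s t k @^-1` A) * P (increment s t l @^-1` A'))%E.
Proof.
move=> s0 st tT kl mA mA'.
rewrite !increment_law//.
have [_ [_ _ _ lawW _] _ _ _] := hN.
have := lawW s t s0 st tT (fun i => if i == k then A else if i == l then A' else setT).
rewrite (_ : [set w | _] = increment s t k @^-1` A `&` increment s t l @^-1` A'); last first.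
  apply/seteqP; split => w /=.
    by move=> H; split; [have := H k|have := H l]; rewrite eqxx// eq_sym (negbTE kl).
  by move=> [Aw A'w] i; case: eqP => [->|] //; case: eqP => [->|].
move=> ->; last by move=> i; case: ifP => //; case: ifP.
rewrite (bigD1 k)//= eqxx (bigD1 l)/=; last by rewrite eq_sym.
rewrite eq_sym (negbTE kl) eqxx big1 ?mule1// => i /andP[/negbTE -> /negbTE ->].
exact: probability_setT.
Qed.

Lemma increment_refl s k : increment s s k = fun=> 0.
Proof. by apply/funext => w; rewrite incrementE subrr. Qed.

Let increment_integral s t k (f : R -> \bar R) : 0 <= s -> s < t -> t <= T ->
  measurable_fun setT f -> (forall x, 0 <= f x)%E ->
  (\int[P]_w f (increment s t k w) = \int[normal_prob 0 (Num.sqrt (t - s))]_x f x)%E.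
Proof.
move=> s0 st tT mf f0; have mI := increment_measurable k s0 (ltW st) tT.
pose X : {mfun Omega >-> measurableTypeR R} :=
  @mfun_Sub _ _ Omega (measurableTypeR R) (increment s t k) (mem_set mI).
transitivity (\int[distribution P X]_x f x)%E.
  by rewrite ge0_integral_pushforward.
apply: eq_measure_integral => A mA _.
exact: increment_law.
Qed.

Lemma increment_sqint s t k : 0 <= s -> s <= t -> t <= T ->
  sqint P (increment s t k).
Proof.
move=> s0; rewrite le_eqVlt => /predU1P[<- _|st tT].
  by rewrite increment_refl; apply: (@sqint_bounded _ _ _ _ _ 0) => // w; rewrite normr0.
have mI := increment_measurable k s0 (ltW st) tT.
split => //; apply: rint_ge0 => [|x|]; [exact: measurable_funX|exact: sqr_ge0|].
rewrite (increment_integral k (f := fun x => (x ^+ 2)%:E))//.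
- by rewrite normal_second_moment ?ltry// sqrtr_gt0 subr_gt0.
- by apply/measurable_EFinP; exact: measurable_funX.
- by move=> x; rewrite lee_fin sqr_ge0.
Qed.

Lemma increment_mean s t k : 0 <= s -> s <= t -> t <= T ->
  \int[P]_w increment s t k w = 0.
Proof.
move=> s0; rewrite le_eqVlt => /predU1P[<- _|st tT].
  by rewrite increment_refl Rintegral_cst// mul0r.
have mI := increment_measurable k s0 (ltW st) tT.
pose X : {mfun Omega >-> measurableTypeR R} :=
  @mfun_Sub _ _ Omega (measurableTypeR R) (increment s t k) (mem_set mI).
have st0 : 0 < Num.sqrt (t - s) by rewrite sqrtr_gt0 subr_gt0.
rewrite -(normal_first_moment st0) /Rintegral; congr fine.
transitivity (\int[distribution P X]_x x%:E)%E.
  rewrite integral_pushforward ?preimage_setT//.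
  exact: sqint_rint (increment_sqint k s0 (ltW st) tT).
apply: eq_measure_integral => A mA _.
exact: increment_law.
Qed.

Lemma increment_variance s t k l : 0 <= s -> s <= t -> t <= T ->
  \int[P]_w (increment s t k w * increment s t l w) = (t - s) *+ (k == l).
Proof.
move=> s0; rewrite le_eqVlt => /predU1P[<- _|st tT].
  by rewrite !increment_refl subrr mul0rn; under eq_Rintegral do rewrite mulr0;
    rewrite Rintegral_cst// mul0r.
have [->|kl] := eqVneq k l; last first.
  have [_ ->] := indep_expectationM (sqint_rint (increment_sqint k s0 (ltW st) tT))
    (sqint_rint (increment_sqint l s0 (ltW st) tT))
    (fun A A' mA mA' => increment_pair_law s0 st tT kl mA mA').
  by rewrite (increment_mean k)// ?mul0r// ltW.
rewrite mulr1n /Rintegral; under eq_integral do rewrite -expr2.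
rewrite (increment_integral l (f := fun x => (x ^+ 2)%:E))//.
- by rewrite normal_second_moment ?sqrtr_gt0 ?subr_gt0//= sqr_sqrtr// subr_ge0 ltW.
- by apply/measurable_EFinP; exact: measurable_funX.
- by move=> x; rewrite lee_fin sqr_ge0.
Qed.

Let indep_mul s t (X : Omega -> R) (phi : 'rV[R]_d -> R) :
  0 <= s -> s < t -> t <= T ->
  measurable_fun setT (X : g_sigma_algebraType (F s) -> R) ->
  measurable_fun setT (phi : borel_rV R d -> R) ->
  measurable_fun setT ((fun w => phi (W t w - W s w)) : g_sigma_algebraType (history W T) -> R) ->
  rint P X -> rint P (fun w => phi (W t w - W s w)) ->
  rint P (fun w => X w * phi (W t w - W s w)) /\
  \int[P]_w (X w * phi (W t w - W s w)) =
  \int[P]_w X w * \int[P]_w phi (W t w - W s w).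
Proof.
move=> s0 st tT mX mphi mphiW iX iphi.
apply: indep_expectationM => // A A' mA mA'.
apply: (indep_filtration_increment hN s0 st tT).
  have := mX measurableT A mA; rewrite setTI.
  by apply: smallest_sub => //; exact: smallest_sigma_algebra.
split; first by have := mphiW measurableT A' mA'; rewrite setTI.
exists (phi @^-1` A'); split => //.
by rewrite -[X in measurable X]setTI; exact: mphi.
Qed.

(** [X] is independent of the increment, whose mean is zero. The case [s] = [t] is separate because
    the Gaussian law is prescribed only for [s < t]. *)
Lemma orth_increment s t k X : 0 <= s -> s <= t -> t <= T ->
  measurable_fun setT (X : g_sigma_algebraType (F s) -> R) -> rint P X ->
  rint P (fun w => X w * increment s t k w) /\
  \int[P]_w (X w * increment s t k w) = 0.
Proof.
move=> s0; rewrite le_eqVlt => /predU1P[<- _ _ _|st tT mX iX].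
  rewrite increment_refl; under eq_fun do rewrite mulr0.
  by split; [exact: rint_cst|rewrite Rintegral_cst// mul0r].
rewrite -[in X in _ /\ X](mulr0 (\int[P]_w X w)) -(increment_mean k s0 (ltW st) tT).
apply: (indep_mul (phi := fun u => u 0 k)) => //.
- exact: measurable_coord.
- exact: increment_measurable_history (ltW st) tT.
- exact: sqint_rint (increment_sqint k s0 (ltW st) tT).
Qed.

Lemma quad_increment s t k l X : 0 <= s -> s <= t -> t <= T ->
  measurable_fun setT (X : g_sigma_algebraType (F s) -> R) -> rint P X ->
  rint P (fun w => X w * (increment s t k w * increment s t l w)) /\
  \int[P]_w (X w * (increment s t k w * increment s t l w)) =
  \int[P]_w X w * ((t - s) *+ (k == l)).
Proof.
move=> s0; rewrite le_eqVlt => /predU1P[<- _ _ _|st tT mX iX].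
  rewrite !increment_refl; under eq_fun do rewrite mulr0 mulr0.
  rewrite subrr mul0rn mulr0.
  by split; [exact: rint_cst|rewrite Rintegral_cst// mul0r].
rewrite -(increment_variance k l s0 (ltW st) tT).
apply: (indep_mul (phi := fun u => u 0 k * u 0 l)) => //.
- by apply: measurable_funM; exact: measurable_coord.
- by apply: measurable_funM; exact: increment_measurable_history (ltW st) tT.
- exact: sqint_mul (increment_sqint k s0 (ltW st) tT) (increment_sqint l s0 (ltW st) tT).
Qed.

End increments.

(** * Ito isometry for step sums *)

Lemma Rintegral_bigsum d (T : measurableType d) (R : realType)
    (mu : {measure set T -> \bar R}) (D : set T) (I : Type) (r : seq I)
    (F : I -> T -> R) : measurable D ->
  (forall i, mu.-integrable D (EFin \o F i)) ->
  mu.-integrable D (EFin \o (fun x => \sum_(i <- r) F i x)) /\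
  \int[mu]_(x in D) (\sum_(i <- r) F i x) = \sum_(i <- r) \int[mu]_(x in D) F i x.
Proof.
move=> mD iF; elim: r => [|i r [IH1 IH2]].
  split; last by under eq_Rintegral do rewrite big_nil; rewrite big_nil Rintegral_cst// mul0r.
  rewrite (_ : EFin \o _ = cst 0%E); first exact: integrable0.
  by apply/funext => x /=; rewrite big_nil.
have -> : (fun x => \sum_(i0 <- i :: r) F i0 x) = (fun x => F i x + \sum_(i0 <- r) F i0 x).
  by apply/funext => x; rewrite big_cons.
split; last by rewrite RintegralD// IH2 big_cons.
by have := integrableD mD (iF i) IH1.
Qed.

Section step_sums.
Context (R : realType) (T : R) (d : nat) (disp : measure_display)
  (Omega : measurableType disp) (P : probability Omega R)
  (W : R -> Omega -> 'rV[R]_d) (J : countType) (B : J -> R -> Omega -> 'rV[R]_d).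
Hypothesis hN : noise_setting P T W B.
Local Notation F := (brownian_filtration P T W B).
Local Notation incr := (increment W).

Definition fmeas (t : R) (X : Omega -> R) :=
  measurable_fun setT (X : g_sigma_algebraType (F t) -> R).

Lemma fmeas_le s t X : s <= t -> fmeas s X -> fmeas t X.
Proof.
move=> st; apply: sigma_measurable_le => A FA; apply: sub_sigma_algebra.
exact: filtration_le FA.
Qed.

Lemma fmeas_measurable t X : t <= T -> fmeas t X -> measurable_fun setT X.
Proof. by move=> tT; apply: sigma_measurable_ambient; exact: (filtration_measurable hN). Qed.

Definition bounded_rv (X : Omega -> R) := exists M : R, forall w, `|X w| <= M.

Lemma bounded_rvM X Y : bounded_rv X -> bounded_rv Y -> bounded_rv (fun w => X w * Y w).
Proof.
move=> [M XM] [N YN]; exists (M * N) => w; rewrite normrM ler_pM//.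
Qed.

Lemma bounded_mul_sqint X Y : measurable_fun setT X -> bounded_rv X ->
  sqint P Y -> sqint P (fun w => X w * Y w).
Proof.
move=> mX [M XM] sY; apply: (@sqint_le _ _ _ _ _ (fun w => M * `|Y w|)).
- exact: measurable_funM mX sY.1.
- by move=> w; rewrite normrM ler_wpM2r.
- exact/sqintZ/sqint_norm.
Qed.

Lemma incr_split s u t k w : incr s t k w = incr s u k w + incr u t k w.
Proof. by rewrite !incrementE; ring. Qed.

(** The longer increment is split at [b]: the part after [b] is orthogonal to everything known at
    [b], and the part before [b] leaves a product of two coordinates of one increment. *)
Let common_left c b b' k l X : 0 <= c -> c <= b -> b <= b' -> b' <= T ->
  fmeas c X -> bounded_rv X ->
  \int[P]_w (X w * (incr c b k w * incr c b' l w)) =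
  \int[P]_w X w * ((b - c) *+ (k == l)).
Proof.
move=> c0 cb bb' b'T fX bX; have bT := le_trans bb' b'T.
have cT := le_trans cb bT; have cb' := le_trans cb bb'.
have b0 := le_trans c0 cb.
have mX := fmeas_measurable cT fX.
have [M XM] := bX; have iX := rint_bounded P mX XM.
have [i1 <-] := quad_increment hN k l c0 cb bT fX iX.
have sV : sqint P (fun w => X w * incr c b k w).
  by apply: bounded_mul_sqint => //; exact: (increment_sqint hN).
have fV : fmeas b (fun w => X w * incr c b k w).
  apply: measurable_funM; last exact: increment_filtration.
  exact: fmeas_le fX.
have [i2 e2] := orth_increment hN l b0 bb' b'T fV (sqint_rint sV).
rewrite -[RHS]addr0 -[X in _ = _ + X]e2 -RintegralD//.
by apply: eq_Rintegral => w _; rewrite (incr_split c b b' l w); ring.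
Qed.

(** The length of the intersection of the intervals ]a, b] and ]a', b']. *)
Definition overlap (a b a' b' : R) := Num.max 0 (Num.min b b' - Num.max a a').

(** The part of the first increment that precedes [a'] is known at [a'], hence orthogonal to the
    second one; what is left, if anything, are two increments with the common left endpoint [a']. *)
Let two_increments_le a b a' b' k l X X' :
  0 <= a -> a <= b -> b <= T -> a <= a' -> a' <= b' -> b' <= T ->
  fmeas a X -> bounded_rv X -> fmeas a' X' -> bounded_rv X' ->
  \int[P]_w ((X w * incr a b k w) * (X' w * incr a' b' l w)) =
  \int[P]_w (X w * X' w) * (overlap a b a' b' *+ (k == l)).
Proof.
move=> a0 ab bT aa' a'b' b'T fX bX fX' bX'.
have b0 := le_trans a0 ab; have a'0 := le_trans a0 aa'.
have a'T := le_trans a'b' b'T; have aT := le_trans ab bT.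
have mX := fmeas_measurable aT fX; have mX' := fmeas_measurable a'T fX'.
have fXX' : fmeas a' (fun w => X w * X' w).
  by apply: measurable_funM => //; exact: fmeas_le fX.
have bXX' := bounded_rvM bX bX'.
have mXX' : measurable_fun setT (fun w => X w * X' w) by exact: measurable_funM.
rewrite /overlap (max_r aa').
have orth u : a <= u -> u <= a' ->
    rint P (fun w => (X w * X' w) * incr a u k w * incr a' b' l w) /\
    \int[P]_w ((X w * X' w) * incr a u k w * incr a' b' l w) = 0.
  move=> au ua'; apply: (orth_increment hN) => //.
    apply: measurable_funM => //; apply: (fmeas_le ua').
    exact: increment_filtration.
  apply: sqint_rint; apply: bounded_mul_sqint => //.
  by apply: (increment_sqint hN) => //; exact: le_trans a'T.
have [ba'|a'b] := leP b a'.
  rewrite max_l ?mul0rn ?mulr0; last by rewrite subr_le0 ge_min ba'.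
  have [_ <-] := orth b ab ba'.
  by apply: eq_Rintegral => w _; ring.
have [i1 e1] := orth a' aa' (lexx _).
have a'b_ := ltW a'b.
transitivity (\int[P]_w ((X w * X' w) * (incr a' b k w * incr a' b' l w))).
  rewrite -[RHS]add0r -[X in _ = X + _]e1 -RintegralD//; last first.
    under eq_fun do rewrite mulrA.
    apply: sqint_mul (increment_sqint hN _ a'0 a'b' b'T).
    by apply: bounded_mul_sqint => //; exact: (increment_sqint hN).
  by apply: eq_Rintegral => w _; rewrite (incr_split a a' b k w); ring.
have m0 : 0 <= Num.min b b' - a' by rewrite subr_ge0 le_min a'b_.
rewrite max_r//.
have [bb'|b'b] := leP b b'; first exact: common_left.
have b'b_ := ltW b'b.
rewrite eq_sym -(common_left l k a'0 a'b' b'b_ bT fXX' bXX').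
by apply: eq_Rintegral => w _; rewrite (mulrC (incr _ _ l _)).
Qed.

Lemma two_increments a b a' b' k l X X' :
  0 <= a -> a <= b -> b <= T -> 0 <= a' -> a' <= b' -> b' <= T ->
  fmeas a X -> bounded_rv X -> fmeas a' X' -> bounded_rv X' ->
  \int[P]_w ((X w * incr a b k w) * (X' w * incr a' b' l w)) =
  \int[P]_w (X w * X' w) * (overlap a b a' b' *+ (k == l)).
Proof.
move=> a0 ab bT a'0 a'b' b'T fX bX fX' bX'.
have [aa'|/ltW a'a] := leP a a'; first exact: two_increments_le.
transitivity (\int[P]_w (X' w * incr a' b' l w * (X w * incr a b k w))).
  by apply: eq_Rintegral => w _; rewrite mulrC.
rewrite two_increments_le//; congr (_ * _).
  by apply: eq_Rintegral => w _; rewrite mulrC.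
by rewrite /overlap [Num.min b' b]minC [Num.max a' a]maxC [l == k]eq_sym.
Qed.

Section step.
Variables (I : finType) (a b : I -> R) (h : I -> Omega -> 'rV[R]_d) (s t : R).
Hypotheses (s0 : 0 <= s) (tT : t <= T).
Hypothesis sa : forall i, s <= a i.
Hypothesis ab : forall i, a i <= b i.
Hypothesis bt : forall i, b i <= t.
Hypothesis fh : forall i k, fmeas (a i) (fun w => h i w 0 k).
Hypothesis bh : forall i k, bounded_rv (fun w => h i w 0 k).

(** The intervals may overlap and come in any order. The difference of two simple integrals thus has
    this form without a common refinement of their subdivisions. *)
Definition step_sum w := \sum_i edot (h i w) (W (b i) w - W (a i) w).

Definition step_value r w : 'rV[R]_d :=
  \sum_i (if a i < r <= b i then h i w else 0).

Let a0 i : 0 <= a i. Proof. exact: le_trans (sa i). Qed.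
Let bT i : b i <= T. Proof. exact: le_trans tT. Qed.
Let aT i : a i <= T. Proof. exact: le_trans (bT i). Qed.
Let mh i k : measurable_fun setT (fun w => h i w 0 k).
Proof. exact: fmeas_measurable (aT i) (@fh i k). Qed.

Let step_sumE w : step_sum w =
  \sum_(p : I * 'I_d) h p.1 w 0 p.2 * incr (a p.1) (b p.1) p.2 w.
Proof.
rewrite /step_sum -(pair_bigA _ (fun i k => h i w 0 k * incr (a i) (b i) k w)).
by [].
Qed.

Let sqint_term p : sqint P (fun w => h p.1 w 0 p.2 * incr (a p.1) (b p.1) p.2 w).
Proof. by apply: bounded_mul_sqint => //; exact: (increment_sqint hN). Qed.

Lemma step_sum_sqint : sqint P step_sum.
Proof.
rewrite (_ : step_sum = fun w => \sum_(p : I * 'I_d)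
  h p.1 w 0 p.2 * incr (a p.1) (b p.1) p.2 w); last by apply/funext => w.
exact: sqint_sum.
Qed.

Lemma step_sum_orth X : fmeas s X -> sqint P X -> \int[P]_w (X w * step_sum w) = 0.
Proof.
move=> fX sX.
transitivity (\int[P]_w (\sum_(p : I * 'I_d)
    X w * (h p.1 w 0 p.2 * incr (a p.1) (b p.1) p.2 w))).
  by apply: eq_Rintegral => w _; rewrite step_sumE mulr_sumr.
rewrite Rintegral_sum => [|p]; last exact: sqint_mul.
rewrite big1// => -[i k] _ /=.
have iV : rint P (fun w => X w * h i w 0 k).
  have [M hM] := @bh i k.
  by apply: sqint_mul => //; exact: sqint_bounded (mh i k) hM.
have fV : fmeas (a i) (fun w => X w * h i w 0 k).
  by apply: measurable_funM; [exact: (fmeas_le (sa i) fX)|exact: fh].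
have [_ <-] := orth_increment hN k (a0 i) (ab i) (bT i) fV iV.
by apply: eq_Rintegral => w _; rewrite mulrA.
Qed.

Let step_var := \sum_i \sum_j \int[P]_w (edot (h i w) (h j w)) *
  overlap (a i) (b i) (a j) (b j).

Let rint_hh i j k : rint P (fun w => h i w 0 k * h j w 0 k).
Proof.
have [M hM] := bounded_rvM (@bh i k) (@bh j k).
by apply: rint_bounded hM; exact: measurable_funM.
Qed.

Let step_sum_var : \int[P]_w (step_sum w ^+ 2) = step_var.
Proof.
transitivity (\int[P]_w (\sum_(p : I * 'I_d) \sum_(q : I * 'I_d)
    (h p.1 w 0 p.2 * incr (a p.1) (b p.1) p.2 w) *
    (h q.1 w 0 q.2 * incr (a q.1) (b q.1) q.2 w))).
  by apply: eq_Rintegral => w _; rewrite step_sumE expr2 big_distrlr.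
rewrite Rintegral_sum => [|p]; last by apply: rint_sum => q; exact: sqint_mul.
rewrite -(pair_bigA _ (fun i k => \int[P]_w (\sum_(q : I * 'I_d)
    (h i w 0 k * incr (a i) (b i) k w) *
    (h q.1 w 0 q.2 * incr (a q.1) (b q.1) q.2 w)))) /=.
apply: eq_bigr => i _.
transitivity (\sum_k \sum_j \int[P]_w (h i w 0 k * h j w 0 k) *
    overlap (a i) (b i) (a j) (b j)).
  apply: eq_bigr => k _.
  rewrite Rintegral_sum => [|q]; last exact: (sqint_mul (sqint_term (i, k)) (sqint_term q)).
  rewrite -(pair_bigA _ (fun j l => \int[P]_w
    ((h i w 0 k * incr (a i) (b i) k w) * (h j w 0 l * incr (a j) (b j) l w)))) /=.
  apply: eq_bigr => j _.
  rewrite (bigD1 k)//= two_increments// eqxx mulr1n big1 ?addr0// => l lk.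
  by rewrite two_increments// eq_sym (negbTE lk) mulr0n mulr0.
rewrite exchange_big; apply: eq_bigr => j _.
by rewrite -mulr_suml Rintegral_sum.
Qed.

Let step_value_norm r w : enorm (step_value r w) ^+ 2 =
  \sum_i \sum_j edot (h i w) (h j w) *
    \1_`]Num.max (a i) (a j), Num.min (b i) (b j)] r.
Proof.
rewrite /enorm sqr_sqrtr; last by apply: sumr_ge0 => k _; rewrite -expr2 sqr_ge0.
rewrite /edot /step_value.
transitivity (\sum_(k < d) \sum_i \sum_j h i w 0 k * h j w 0 k *
    \1_`]Num.max (a i) (a j), Num.min (b i) (b j)] r).
  apply: eq_bigr => k _; rewrite !summxE big_distrlr /=.
  apply: eq_bigr => i _; apply: eq_bigr => j _.
  rewrite indicE mem_setE in_itv/= gt_max le_min.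
  case: (a i < r) => /=; last by rewrite !mxE mul0r mulr0.
  case: (r <= b i) => /=; last by rewrite !mxE mul0r andbF mulr0.
  case: (a j < r) => /=; last by rewrite !mxE !mulr0.
  by case: (r <= b j) => /=; rewrite ?mulr1// !mxE !mulr0.
rewrite exchange_big; apply: eq_bigr => i _.
rewrite exchange_big; apply: eq_bigr => j _.
by rewrite mulr_suml.
Qed.

(** Both sides equal the double sum of the expected products of the coefficients times the overlaps:
    on the left since a product of two interval indicators integrates to the overlap, on the right
    by the covariance of two increments. *)
Lemma step_isometry :
  (\int[P]_w \int[lebesgue_measure]_(r in `]s, t]) (enorm (step_value r w) ^+ 2)%:E
   = (\int[P]_w (step_sum w ^+ 2))%:E)%E.
Proof.
have iedot i j : rint P (fun w => edot (h i w) (h j w)) by exact: rint_sum.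
have inner w : (\int[lebesgue_measure]_(r in `]s, t]) (enorm (step_value r w) ^+ 2)%:E =
    (\sum_i \sum_j edot (h i w) (h j w) * overlap (a i) (b i) (a j) (b j))%:E)%E.
  have ind i j : lebesgue_measure.-integrable `]s, t]
      (EFin \o (fun r => edot (h i w) (h j w) *
        (\1_`]Num.max (a i) (a j), Num.min (b i) (b j)] r : R))).
    rewrite (_ : _ \o _ = fun r => ((edot (h i w) (h j w))%:E *
      (\1_`]Num.max (a i) (a j), Num.min (b i) (b j)] r)%:E)%E)//.
    apply: integrableZl => //; apply: (integrableS measurableT) => //.
    exact: integrable_indic_itv.
  have indv i j : \int[lebesgue_measure]_(r in `]s, t]) (edot (h i w) (h j w) *
        (\1_`]Num.max (a i) (a j), Num.min (b i) (b j)] r : R)) =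
      edot (h i w) (h j w) * overlap (a i) (b i) (a j) (b j).
    rewrite RintegralZl//; last first.
      by apply: (integrableS measurableT) => //; exact: integrable_indic_itv.
    congr (_ * _); rewrite /Rintegral integral_indic// setIidl; last first.
      move=> r /=; rewrite !in_itv/= => /andP[h1 h2]; apply/andP; split.
        by rewrite (le_lt_trans _ h1)// le_max sa.
      by rewrite (le_trans h2)// ge_min bt.
    change (fine (lebesgue_measure [set` `]Num.max (a i) (a j), Num.min (b i) (b j)]]) =
      overlap (a i) (b i) (a j) (b j)).
    rewrite lebesgue_measure_itv/= lte_fin /overlap.
    have [h1|h1] := ltP (Num.max (a i) (a j)) (Num.min (b i) (b j)).
      by rewrite -EFinD [RHS]max_r// subr_ge0 ltW.
    by rewrite [RHS]max_l// subr_le0.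
  have [i2 e2] : lebesgue_measure.-integrable `]s, t]
      (EFin \o (fun r => \sum_i \sum_j edot (h i w) (h j w) *
        (\1_`]Num.max (a i) (a j), Num.min (b i) (b j)] r : R))) /\
     \int[lebesgue_measure]_(r in `]s, t]) (\sum_i \sum_j edot (h i w) (h j w) *
        (\1_`]Num.max (a i) (a j), Num.min (b i) (b j)] r : R)) =
     \sum_i \sum_j edot (h i w) (h j w) * overlap (a i) (b i) (a j) (b j).
    have mD : measurable (`]s, t]%classic : set (measurableTypeR R)) by exact: measurable_itv.
    have H i := Rintegral_bigsum (index_enum I) mD (ind i).
    have [i1 e1] := Rintegral_bigsum (index_enum I) mD (fun i => (H i).1).
    split => //; rewrite e1; apply: eq_bigr => i _; rewrite (H i).2.
    by apply: eq_bigr => j _; exact: indv.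
  rewrite -e2 /Rintegral fineK; last exact: integrable_fin_num.
  by apply: eq_integral => r _; rewrite step_value_norm.
under eq_integral => w _ do rewrite inner.
have ioj i j : rint P (fun w => edot (h i w) (h j w) * overlap (a i) (b i) (a j) (b j)).
  by under eq_fun do rewrite mulrC; exact: rintZ.
rewrite integral_rint; last by apply: rint_sum => i; exact: rint_sum.
congr EFin; rewrite step_sum_var Rintegral_sum => [|i]; last exact: rint_sum.
apply: eq_bigr => i _; rewrite Rintegral_sum//; apply: eq_bigr => j _.
rewrite RintegralZr; [by []|exact: measurableT|exact: iedot].
Qed.

End step.

End step_sums.

(** * Jointly measurable processes *)

Section joint_measurability.
Context (R : realType) (T : R) (disp : measure_display)
  (Omega : measurableType disp) (P : probability Omega R).
Notation mu := (@lebesgue_measure R).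

(** Measurability for the product with the ambient sigma-algebra, with no reference to the
    filtration: the form used by Fubini arguments. *)
Definition jmeas (f : R -> Omega -> R) :=
  measurable_fun (`[0, T] `*` setT) (fun p : R * Omega => f p.1 p.2).

Let mD0 : measurable (`[0%R, T] `*` [set: Omega]).
Proof. by apply: measurableX => //; exact: measurable_itv. Qed.

Lemma jmeasD f g : jmeas f -> jmeas g -> jmeas (fun r w => f r w + g r w).
Proof. by move=> mf mg; apply: measurable_funD. Qed.

Lemma jmeasB f g : jmeas f -> jmeas g -> jmeas (fun r w => f r w - g r w).
Proof. by move=> mf mg; apply: measurable_funB. Qed.

Lemma jmeasM f g : jmeas f -> jmeas g -> jmeas (fun r w => f r w * g r w).
Proof. by move=> mf mg; apply: measurable_funM. Qed.

Lemma jmeasX f n : jmeas f -> jmeas (fun r w => f r w ^+ n).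
Proof. by move=> mf; apply: measurable_funX. Qed.

Lemma jmeas_norm f : jmeas f -> jmeas (fun r w => `|f r w|).
Proof. by move=> mf; apply: measurableT_comp. Qed.

Lemma jmeas_cst (c : R) : jmeas (fun _ _ => c).
Proof. exact: measurable_cst. Qed.

Lemma jmeas_time (f : R -> R) : measurable_fun setT f -> jmeas (fun r _ => f r).
Proof.
move=> mf; apply: measurable_funTS.
by apply: (measurableT_comp mf); exact: measurable_fst.
Qed.

Lemma jmeas_rv (X : Omega -> R) : measurable_fun setT X -> jmeas (fun _ w => X w).
Proof.
move=> mf; apply: measurable_funTS.
by apply: (measurableT_comp mf); exact: measurable_snd.
Qed.

Lemma jmeas_sum (I : Type) (s : seq I) (f : I -> R -> Omega -> R) :
  (forall i, jmeas (f i)) -> jmeas (fun r w => \sum_(i <- s) f i r w).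
Proof.
move=> mf; rewrite /jmeas.
exact: (@measurable_sum _ _ _ _ _ s (fun i (p : R * Omega) => f i p.1 p.2)).
Qed.

Lemma jmeas_section f w : jmeas f ->
  measurable_fun (`[0, T]%classic : set (measurableTypeR R)) (f^~ w).
Proof.
move=> mf; have mp := @pair2_measurable _ _ R Omega w.
apply: (@measurable_comp _ _ _ _ _ _ (`[0, T] `*` setT) (fun p => f p.1 p.2)
  _ (fun r => (r, w))) => //.
- by move=> _ [r rT <-].
- exact: measurable_funTS.
Qed.

Section iterated.
Variable D : set (measurableTypeR R).
Hypotheses (mD : measurable D) (DT : D `<=` `[0, T]).

Lemma jmeas_sectionS f w : jmeas f -> measurable_fun D (f^~ w).
Proof.
by move=> /(jmeas_section w); apply: measurable_funS.
Qed.

Lemma iterint_measurable f : jmeas f -> (forall r w, 0 <= f r w) ->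
  measurable_fun setT (fun w => (\int[mu]_(r in D) (f r w)%:E)%E).
Proof.
move=> mf f0.
(* Tonelli's theorem integrates over the whole second factor, hence the swap of the two variables
   and the extension by zero outside [D]. *)
pose G (z : Omega * measurableTypeR R) : \bar R :=
  ((fun p : R * Omega => (f p.1 p.2)%:E) \_ (D `*` setT)) (z.2, z.1).
have mG : measurable_fun setT G.
  apply: (measurableT_comp (f := ((fun p : R * Omega => (f p.1 p.2)%:E) \_ (D `*` setT)))
    (g := fun z : Omega * measurableTypeR R => (z.2, z.1))).
    apply/(measurable_restrictT _ _).1; first exact: measurableX.
    apply/measurable_EFinP; apply: measurable_funS mf => //.
    by move=> [r w] [/= rD _]; split => //; exact: DT.
  exact: measurable_swap.
have G0 z : (0 <= G z)%E by rewrite /G patchE; case: ifP => // _; rewrite lee_fin.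
have := @measurable_fun_fubini_tonelli_F _ _ Omega (measurableTypeR R) R mu G mG G0.
rewrite /fubini_F; apply: eq_measurable_fun => w _ /=.
rewrite [RHS]integral_mkcond; apply: eq_integral => r _.
by rewrite /G !patchE in_setX in_setT andbT.
Qed.

Lemma iterint_ge0 (f : R -> Omega -> R) w : (forall r w, 0 <= f r w) ->
  (0 <= \int[mu]_(r in D) (f r w)%:E)%E.
Proof. by move=> f0; apply: integral_ge0 => r _; rewrite lee_fin. Qed.

Lemma iterint_linear f g (a b : R) : jmeas f -> jmeas g ->
  (forall r w, 0 <= f r w) -> (forall r w, 0 <= g r w) -> 0 <= a -> 0 <= b ->
  (\int[P]_w \int[mu]_(r in D) (a * f r w + b * g r w)%:E =
   a%:E * \int[P]_w \int[mu]_(r in D) (f r w)%:E +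
   b%:E * \int[P]_w \int[mu]_(r in D) (g r w)%:E)%E.
Proof.
move=> mf mg f0 g0 a0 b0.
have mfw w := jmeas_sectionS w mf; have mgw w := jmeas_sectionS w mg.
transitivity (\int[P]_w (a%:E * \int[mu]_(r in D) (f r w)%:E +
   b%:E * \int[mu]_(r in D) (g r w)%:E))%E.
  apply: eq_integral => w _.
  transitivity (\int[mu]_(r in D) (a%:E * (f r w)%:E + b%:E * (g r w)%:E))%E.
    by apply: eq_integral => r _; rewrite EFinD !EFinM.
  rewrite ge0_integralD//; [|by move=> r _; rewrite mule_ge0 ?lee_fin|
    by apply: measurable_funeM; exact/measurable_EFinP|
    by move=> r _; rewrite mule_ge0 ?lee_fin|
    by apply: measurable_funeM; exact/measurable_EFinP].
  have Zl (h : R -> R) (c : R) : (forall r, 0 <= h r) -> measurable_fun D h -> 0 <= c ->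
      (\int[mu]_(r in D) (c%:E * (h r)%:E) = c%:E * \int[mu]_(r in D) (h r)%:E)%E.
    move=> h0 mh c0; apply: ge0_integralZl_EFin => //.
      by move=> r _; rewrite lee_fin.
    exact/measurable_EFinP.
  by rewrite !Zl.
have mF := iterint_measurable mf f0; have mG := iterint_measurable mg g0.
rewrite ge0_integralD//; [|by move=> w _; rewrite mule_ge0 ?lee_fin ?iterint_ge0|
    by apply: measurable_funeM|
    by move=> w _; rewrite mule_ge0 ?lee_fin ?iterint_ge0|
    by apply: measurable_funeM].
rewrite ge0_integralZl_EFin//; last by move=> w _; exact: iterint_ge0.
by rewrite ge0_integralZl_EFin//; move=> w _; exact: iterint_ge0.
Qed.

Lemma iterint_le f g : jmeas f -> jmeas g ->
  (forall r w, 0 <= f r w) -> (forall r w, f r w <= g r w) ->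
  (\int[P]_w \int[mu]_(r in D) (f r w)%:E <=
   \int[P]_w \int[mu]_(r in D) (g r w)%:E)%E.
Proof.
move=> mf mg f0 fg; have g0 r w : 0 <= g r w by exact: le_trans (fg r w).
apply: ge0_le_integral => //.
- by move=> w _; exact: iterint_ge0.
- exact: iterint_measurable.
- exact: iterint_measurable.
move=> w _; apply: ge0_le_integral => //.
- by move=> r _; rewrite lee_fin.
- by apply/measurable_EFinP; exact: jmeas_sectionS.
- by apply/measurable_EFinP; exact: jmeas_sectionS.
- by move=> r _; rewrite lee_fin.
Qed.

End iterated.

End joint_measurability.

(** * Simple processes and the Ito integral *)

Section simple_processes.
Context (R : realType) (T : R) (d : nat) (disp : measure_display)
  (Omega : measurableType disp) (P : probability Omega R)
  (W : R -> Omega -> 'rV[R]_d) (J : countType) (B : J -> R -> Omega -> 'rV[R]_d).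
Hypothesis hN : noise_setting P T W B.
Local Notation F := (brownian_filtration P T W B).
Local Notation fmeas := (fmeas T P W B).

(** This is progressive measurability at time [T], combined with the inclusion of [F T] in the
    ambient sigma-algebra, which rests on the completeness of [P]. *)
Lemma progressive_measurable d' (V : measurableType d') (X : R -> Omega -> V) :
  0 <= T -> progressive T F X ->
  measurable_fun (`[0, T] `*` setT) (fun p : R * Omega => X p.1 p.2).
Proof.
move=> T0 /(_ T); rewrite in_itv/= T0 lexx => /(_ isT) pX.
have mid : measurable_fun setT
    (fun p : R * Omega => (p.1, p.2 : g_sigma_algebraType (F T))).
  apply: (@measurable_fun_pair _ _ _ (R * Omega)%type R (g_sigma_algebraType (F T))) => //.
  move=> _ A mA; rewrite setTI.
  rewrite (_ : _ @^-1` A = (snd : R * Omega -> Omega) @^-1` A)//.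
  rewrite -[X in measurable X]setTI; apply: measurable_snd => //.
  move: A mA; apply: smallest_sub; first exact: sigma_algebra_measurable.
  exact: (filtration_measurable hN).
have mD : measurable (`[0%R, T] `*` [set: g_sigma_algebraType (F T)]).
  by apply: measurableX => //; exact: measurable_itv.
apply: (measurable_comp mD _ pX (measurable_funTS mid)).
by move=> _ [[r w] [/= rT _] <-].
Qed.

Lemma progressive_coord (Z : R -> Omega -> 'rV[R]_d) k : 0 <= T ->
  progressive T F (Z : R -> Omega -> borel_rV R d) ->
  jmeas T (fun r w => Z r w 0 k).
Proof.
move=> T0 pZ; rewrite /jmeas.
exact: measurableT_comp (measurable_coord k) (progressive_measurable T0 pZ).
Qed.

Lemma enorm_sqr (u : 'rV[R]_d) : enorm u ^+ 2 = \sum_k u 0 k ^+ 2.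
Proof.
rewrite /enorm sqr_sqrtr; first by apply: eq_bigr => k _; rewrite expr2.
by apply: sumr_ge0 => k _; rewrite -expr2 sqr_ge0.
Qed.

Lemma enorm_ge0 (u : 'rV[R]_d) : 0 <= enorm u.
Proof. exact: sqrtr_ge0. Qed.

Lemma coord_le_enorm (u : 'rV[R]_d) k : `|u 0 k| <= enorm u.
Proof.
rewrite -(@ler_pXn2r _ 2)// ?nnegrE ?enorm_ge0// enorm_sqr real_normK ?num_real//.
by rewrite (bigD1 k)//= lerDl sumr_ge0// => i _; exact: sqr_ge0.
Qed.

Lemma edotBr (u v v' : 'rV[R]_d) : edot u (v - v') = edot u v - edot u v'.
Proof.
rewrite /edot -sumrB; apply: eq_bigr => k _; rewrite !mxE; ring.
Qed.

Lemma edot0r (u : 'rV[R]_d) : edot u 0 = 0.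
Proof. by rewrite /edot big1// => k _; rewrite mxE mulr0. Qed.

Lemma edotNl (u v : 'rV[R]_d) : edot (- u) v = - edot u v.
Proof. by rewrite /edot -sumrN; apply: eq_bigr => k _; rewrite mxE mulNr. Qed.

Section clamp.
Variables (s t : R).
Hypotheses (s0 : 0 <= s) (st : s <= t) (tT : t <= T).

(** The projection onto [s, t]. Clamping the subdivision turns the increment of a simple integral
    over [s, t] into a step sum whose intervals all lie in [s, t]. *)
Definition clamp x := Num.max s (Num.min x t).

Let clamp_increment x w : W (Num.min x t) w - W (Num.min x s) w = W (clamp x) w - W s w.
Proof.
rewrite /clamp; case: (leP x s) => xs.
  by rewrite (min_l (le_trans xs st)) (max_l xs) !subrr.
have [xt|tx] := leP x t; first by rewrite (max_r (ltW xs)).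
by rewrite (max_r st).
Qed.

Section one_process.
Variable H : simple_process d T F.
Notation tau := (sp_time H).
Notation m := (sp_size H).

Lemma sp_time_le i j : (i <= j)%N -> (j <= m)%N -> tau i <= tau j.
Proof.
move=> /subnKC <-; elim: (j - i)%N => [|n IH]; first by rewrite addn0.
rewrite addnS => h; apply: le_trans (sp_time_homo _); last exact: h.
by apply: IH; exact: ltnW.
Qed.

Lemma sp_time_in i : (i <= m)%N -> 0 <= tau i <= T.
Proof.
move=> im; rewrite (le_trans (sp_time_ge0 H) (sp_time_le _ _))//=.
exact: le_trans (sp_time_le im _) (sp_time_leT H).
Qed.

(** A coefficient whose time [tau i] exceeds [t] is not known at the clamped time, which is [t]. Its
    clamped interval is empty, so it may be replaced by 0. *)
Definition clamped_coef i w : 'rV[R]_d := if tau i <= t then sp_coef H i w else 0.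

Lemma clamp_ge x : s <= clamp x. Proof. by rewrite le_max lexx. Qed.

Lemma clamp_le x : clamp x <= t.
Proof. by rewrite ge_max st ge_min lexx orbT. Qed.

Lemma clamp_homo x y : x <= y -> clamp x <= clamp y.
Proof.
by move=> xy; rewrite ge_max !le_max lexx/= le_min !ge_min xy lexx !orbT.
Qed.

Lemma clamped_coef_fmeas (i : 'I_m) k :
  fmeas (clamp (tau i)) (fun w => clamped_coef i w 0 k).
Proof.
rewrite /clamped_coef; case: (boolP (tau i <= t)) => it /=; last first.
  by under eq_fun do rewrite mxE; exact: measurable_cst.
apply: (@fmeas_le _ _ _ _ _ _ _ _ _ (tau i)).
  by rewrite le_max min_l// lexx orbT.
exact: measurableT_comp (measurable_coord k) (sp_coef_measurable (ltn_ord i)).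
Qed.

Lemma clamped_coef_bounded (i : 'I_m) k : bounded_rv (fun w => clamped_coef i w 0 k).
Proof.
have [M HM] := sp_coef_bounded H; exists (Num.max M 0) => w; rewrite /clamped_coef; case: (boolP (tau i <= t)) => it /=; last by rewrite mxE normr0 le_max lexx orbT.
by rewrite (le_trans (coord_le_enorm _ k))// (le_trans (HM i w (ltn_ord i)))// le_max lexx.
Qed.

Lemma sp_integral_clamp w : sp_integral W H t w - sp_integral W H s w =
  \sum_(i < m) edot (clamped_coef i w) (W (clamp (tau i.+1)) w - W (clamp (tau i)) w).
Proof.
rewrite /sp_integral -sumrB; apply: eq_bigr => i _.
rewrite -edotBr (_ : _ - _ - _ = W (clamp (tau i.+1)) w - W (clamp (tau i)) w); last first.
  have swap (a b a' b' : 'rV[R]_d) : a - b - (a' - b') = a - a' - (b - b').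
    by rewrite !opprB [b' - a']addrC addrACA [- b + b']addrC.
  by rewrite swap !clamp_increment opprB addrA subrK.
rewrite /clamped_coef; case: ifPn => //; rewrite -ltNge => tlt.
rewrite /clamp (min_r (ltW tlt)) min_r; last first.
  by rewrite (le_trans (ltW tlt))// sp_time_le.
by rewrite subrr !edot0r.
Qed.

Lemma sp_value_clamp r w : s < r <= t -> sp_value H r w =
  \sum_(i < m) (if clamp (tau i) < r <= clamp (tau i.+1) then clamped_coef i w else 0).
Proof.
move=> /andP[sr rt]; apply: eq_bigr => i _.
rewrite /clamp gt_max le_max sr/= gt_min (ltNge t) rt orbF le_min rt andbT.
rewrite (leNgt r s) sr/= /clamped_coef.
case: ifPn => // /andP[ir _].
by rewrite (le_trans (ltW ir) rt).
Qed.

Lemma sp_value_jmeas k : jmeas T (fun r w => sp_value H r w 0 k).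
Proof.
rewrite (_ : (fun r w => _) = fun r w => \sum_(i < m)
    (\1_`]tau i, tau i.+1] r * sp_coef H i w 0 k)); last first.
  apply/funext => r; apply/funext => w; rewrite /sp_value summxE.
  apply: eq_bigr => i _; rewrite indicE mem_setE in_itv/=.
  by case: ifPn => _; rewrite ?mul1r// mxE mul0r.
apply: jmeas_sum => i; apply: jmeasM.
  by apply: jmeas_time; exact: measurable_indic.
apply: jmeas_rv; apply: (sigma_measurable_ambient (filtration_measurable hN (t := tau i) _)).
  by have /andP[] := sp_time_in (ltnW (ltn_ord i)).
exact: measurableT_comp (measurable_coord k) (sp_coef_measurable (ltn_ord i)).
Qed.

End one_process.

Section two_processes.
Variables H H' : simple_process d T F.
(** The disjoint union of the two subdivisions; the coefficients of the second process enter with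
    the opposite sign. *)
Let I : finType := ('I_(sp_size H) + 'I_(sp_size H'))%type.
Let ha (i : I) : R := match i with
  | inl j => clamp (sp_time H j) | inr j => clamp (sp_time H' j) end.
Let hb (i : I) : R := match i with
  | inl j => clamp (sp_time H j.+1) | inr j => clamp (sp_time H' j.+1) end.
Let hh (i : I) (w : Omega) : 'rV[R]_d := match i with
  | inl j => clamped_coef H j w | inr j => - clamped_coef H' j w end.

Definition sp_diff w := (sp_integral W H t w - sp_integral W H s w)
  - (sp_integral W H' t w - sp_integral W H' s w).

Let sp_diffE w : sp_diff w = step_sum W ha hb hh w.
Proof.
rewrite /sp_diff !sp_integral_clamp /step_sum big_sumType/=; congr (_ + _).
by rewrite -sumrN; apply: eq_bigr => i _; rewrite edotNl.
Qed.

Let value_diffE r w : s < r <= t ->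
  sp_value H r w - sp_value H' r w = step_value ha hb hh r w.
Proof.
move=> rst; rewrite !sp_value_clamp// /step_value big_sumType/=; congr (_ + _).
by rewrite -sumrN; apply: eq_bigr => i _; case: ifP => //; rewrite oppr0.
Qed.

Let sa i : s <= ha i. Proof. by case: i => j; exact: clamp_ge. Qed.
Let bt i : hb i <= t. Proof. by case: i => j; exact: clamp_le. Qed.
Let ab i : ha i <= hb i.
Proof. by case: i => j; apply: clamp_homo; exact: sp_time_homo. Qed.
Let fh i k : fmeas (ha i) (fun w => hh i w 0 k).
Proof.
case: i => j /=; first exact: clamped_coef_fmeas.
under eq_fun do rewrite mxE.
exact: measurable_funN (@clamped_coef_fmeas H' j k).
Qed.
Let bh i k : bounded_rv (fun w => hh i w 0 k).
Proof.
case: i => j /=; first exact: clamped_coef_bounded.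
have [M HM] := clamped_coef_bounded j k.
by exists M => w; rewrite mxE normrN.
Qed.

Lemma sp_diff_sqint : sqint P sp_diff.
Proof.
rewrite (_ : sp_diff = step_sum W ha hb hh); last exact/funext.
exact: (step_sum_sqint hN s0 tT).
Qed.

Lemma sp_diff_orth X : fmeas s X -> sqint P X -> \int[P]_w (X w * sp_diff w) = 0.
Proof.
move=> fX sX; rewrite (_ : sp_diff = step_sum W ha hb hh); last exact/funext.
exact: (step_sum_orth hN s0 tT).
Qed.

Lemma sp_diff_isometry :
  (\int[P]_w \int[lebesgue_measure]_(r in `]s, t])
     (enorm (sp_value H r w - sp_value H' r w) ^+ 2)%:E
   = (\int[P]_w (sp_diff w ^+ 2))%:E)%E.
Proof.
rewrite (_ : sp_diff = step_sum W ha hb hh); last exact/funext.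
rewrite -(step_isometry hN s0 tT sa ab bt fh bh).
apply: eq_integral => w _; apply: eq_integral => r.
by rewrite inE/= in_itv/= => rst; rewrite value_diffE.
Qed.

End two_processes.
End clamp.
End simple_processes.

(** * Comparison of squares up to a small error *)

Lemma le_of_eta (R : realType) (A b c : R) : 0 <= c ->
  (forall eta, 0 < eta -> eta <= 1 -> A <= b + eta * c) -> A <= b.
Proof.
move=> c0 H; apply/ler_addgt0Pr => e e0.
pose eta := Num.min 1 (e / (c + 1)).
have c1 : 0 < c + 1 by rewrite ltr_wpDl.
have eta0 : 0 < eta by rewrite lt_min ltr01 divr_gt0.
have eta1 : eta <= 1 by rewrite ge_min lexx.
apply: (le_trans (H eta eta0 eta1)); rewrite lerD2l.
apply: (@le_trans _ _ (eta * (c + 1))); first by rewrite ler_pM2l// lerDl.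
by rewrite -ler_pdivlMr// ge_min lexx orbT.
Qed.

(** A perturbation bound that stays within squares: the factor of the main term is as close to 1 as
    desired, and the large weight of the error is harmless because the error can be made small after
    [eta] is fixed. *)
Lemma sqr_le_eta (R : realType) (eta x y : R) : 0 < eta ->
  x ^+ 2 <= (1 + eta) * y ^+ 2 + (1 + eta^-1) * (x - y) ^+ 2.
Proof.
move=> e0; rewrite -subr_ge0.
rewrite (_ : _ - _ = eta * (y - eta^-1 * (x - y)) ^+ 2).
  by rewrite mulr_ge0 ?sqr_ge0// ltW.
by field; rewrite gt_eqF.
Qed.

Lemma enorm_sqr_le_eta (R : realType) d (eta : R) (x y : 'rV[R]_d) : 0 < eta ->
  enorm x ^+ 2 <= (1 + eta) * enorm y ^+ 2 + (1 + eta^-1) * enorm (x - y) ^+ 2.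
Proof.
move=> e0; rewrite !enorm_sqr !mulr_sumr -big_split/=.
by apply: ler_sum => k _; rewrite !mxE; exact: sqr_le_eta.
Qed.

Lemma enorm_distrC (R : realType) d (x y : 'rV[R]_d) : enorm (x - y) = enorm (y - x).
Proof.
rewrite /enorm /edot; congr (Num.sqrt _).
by apply: eq_bigr => k _; rewrite !mxE; ring.
Qed.

Lemma sqr_sub_le2 (R : realType) (a b z z' : R) :
  (a - b - (z - z')) ^+ 2 <= 2 * (a - z) ^+ 2 + 2 * (b - z') ^+ 2.
Proof.
rewrite -subr_ge0 (_ : _ - _ = (a - z + (b - z')) ^+ 2); first exact: sqr_ge0.
by ring.
Qed.

Lemma sqr_le4 (R : realType) (a b c e : R) :
  (a - b + (e - c)) ^+ 2 <= 4 * a ^+ 2 + 4 * b ^+ 2 + (4 * e ^+ 2 + 4 * c ^+ 2).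
Proof.
rewrite -subr_ge0 (_ : _ - _ = (a + b) ^+ 2 + (a - e) ^+ 2 + (a + c) ^+ 2
  + (b + e) ^+ 2 + (b - c) ^+ 2 + (e + c) ^+ 2); last by ring.
by rewrite !addr_ge0// sqr_ge0.
Qed.

(** * Orthogonality and isometry of the Ito integral *)

Section ito.
Context (R : realType) (T : R) (d : nat) (disp : measure_display)
  (Omega : measurableType disp) (P : probability Omega R)
  (W : R -> Omega -> 'rV[R]_d) (J : countType) (B : J -> R -> Omega -> 'rV[R]_d).
Hypothesis hN : noise_setting P T W B.
Local Notation F := (brownian_filtration P T W B).
Local Notation fmeas := (fmeas T P W B).
Notation mu := (@lebesgue_measure R).
Implicit Types (Z : R -> Omega -> 'rV[R]_d) (M : R -> Omega -> R).

Lemma jmeas_enorm2 Z : (forall k, jmeas T (fun r w => Z r w 0 k)) ->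
  jmeas T (fun r w => enorm (Z r w) ^+ 2).
Proof.
move=> mZ; rewrite (_ : (fun r w => _) = fun r w => \sum_k Z r w 0 k ^+ 2).
  by apply: jmeas_sum => k; exact: jmeasX.
by apply/funext => r; apply/funext => w; rewrite enorm_sqr.
Qed.

Lemma jmeas_enorm2B Z Z' : (forall k, jmeas T (fun r w => Z r w 0 k)) ->
  (forall k, jmeas T (fun r w => Z' r w 0 k)) ->
  jmeas T (fun r w => enorm (Z r w - Z' r w) ^+ 2).
Proof.
move=> mZ mZ'; apply: (@jmeas_enorm2 (fun r w => Z r w - Z' r w)) => k.
rewrite (_ : (fun r w => _) = fun r w => Z r w 0 k - Z' r w 0 k).
  exact: jmeasB.
by apply/funext => r; apply/funext => w; rewrite !mxE.
Qed.

Lemma sp_integral_measurable (H : simple_process d T F) t : 0 <= t -> t <= T ->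
  measurable_fun setT (sp_integral W H t).
Proof.
move=> t0 tT; apply: measurable_sum => i; rewrite /edot; apply: measurable_sum => k.
have i1 := sp_time_in (ltnW (ltn_ord i)); have i2 := sp_time_in (ltn_ord i).
have mW r : 0 <= r -> r <= T -> measurable_fun setT (fun w => W r w 0 k).
  move=> r0 rT; apply: (measurableT_comp (measurable_coord k)).
  by apply: (brownian_measurable hN); rewrite in_itv/= r0.
apply: measurable_funM.
  apply: (sigma_measurable_ambient (filtration_measurable hN (t := sp_time H i) _)).
    by case/andP: i1.
  exact: measurableT_comp (measurable_coord k) (sp_coef_measurable (ltn_ord i)).
under eq_fun do rewrite !mxE.
case/andP: i1 => i10 i1T; case/andP: i2 => i20 i2T.
by apply: measurable_funB; apply: mW; rewrite ?le_min ?i10 ?i20 ?t0 ?ge_min ?tT ?orbT.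
Qed.

Lemma cvge0_near (u : nat -> \bar R) (eta : R) : 0 < eta ->
  u n @[n --> \oo] --> 0%E -> \forall n \near \oo, (u n <= eta%:E)%E.
Proof.
move=> e0 /fine_cvgP[fu /cvgr0Pnorm_le/(_ _ e0) cu].
near=> n; rewrite -(@fineK _ (u n)); last by near: n.
by rewrite lee_fin; apply: (le_trans (ler_norm _)); near: n.
Unshelve. all: by end_near. Qed.

(** All three convergences run along the same sequence, so one simple process serves both endpoints
    and the integrand. *)
Lemma ito_approx Z M s t (eta : R) : ito_integral P T F W Z M ->
  s \in `[0, T] -> t \in `[0, T] -> 0 < eta ->
  exists H : simple_process d T F,
  [/\ (\int[P]_w \int[mu]_(r in `[0%R, T])
        (enorm (sp_value H r w - Z r w) ^+ 2)%:E <= eta%:E)%E,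
      (\int[P]_w (`|sp_integral W H s w - M s w| ^+ 2)%:E <= eta%:E)%E &
      (\int[P]_w (`|sp_integral W H t w - M t w| ^+ 2)%:E <= eta%:E)%E].
Proof.
move=> [_ _ [H [cH cM]]] sT tT e0; near \oo => n; exists (H n); split.
- by near: n; exact: cvge0_near.
- by near: n; apply: cvge0_near => //; exact: cM.
- by near: n; apply: cvge0_near => //; exact: cM.
Unshelve. all: by end_near. Qed.

Section difference.
Variables (Z Z' : R -> Omega -> 'rV[R]_d) (M M' : R -> Omega -> R) (s t : R).
Hypotheses (pZ : progressive T F (Z : R -> Omega -> borel_rV R d))
  (pZ' : progressive T F (Z' : R -> Omega -> borel_rV R d)).
Hypotheses (iM : ito_integral P T F W Z M) (iM' : ito_integral P T F W Z' M').
Hypotheses (s0 : 0 <= s) (st : s <= t) (tT : t <= T).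

Let N w := (M t w - M' t w) - (M s w - M' s w).
Let Bq := (\int[P]_w \int[mu]_(r in `]s, t]) (enorm (Z r w - Z' r w) ^+ 2)%:E)%E.

Let t0 : 0 <= t. Proof. exact: le_trans st. Qed.
Let sT : s <= T. Proof. exact: le_trans tT. Qed.
Let T0 : 0 <= T. Proof. exact: le_trans tT. Qed.

Let L2err (H : simple_process d T F) M0 r (eta : R) :
  adapted T F M0 -> 0 <= r -> r <= T ->
  (\int[P]_w (`|sp_integral W H r w - M0 r w| ^+ 2)%:E <= eta%:E)%E ->
  sqint P (fun w => sp_integral W H r w - M0 r w) /\
  \int[P]_w ((sp_integral W H r w - M0 r w) ^+ 2) <= eta.
Proof.
move=> aM r0 rT; under eq_integral do rewrite real_normK ?num_real//.
move=> le_eta.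
have mD : measurable_fun setT (fun w => sp_integral W H r w - M0 r w).
  apply: measurable_funB; first exact: sp_integral_measurable.
  apply: (sigma_measurable_ambient (filtration_measurable hN rT)).
  by apply: aM; rewrite in_itv/= r0.
have sD : sqint P (fun w => sp_integral W H r w - M0 r w).
  split => //; apply: rint_ge0 => [|w|]; [exact: measurable_funX|exact: sqr_ge0|].
  exact: le_lt_trans le_eta (ltry _).
by split => //; rewrite -lee_fin -integral_rint//; exact: sD.2.
Qed.

Let jZ k : jmeas T (fun r w => Z r w 0 k). Proof. exact: (progressive_coord hN). Qed.
Let jZ' k : jmeas T (fun r w => Z' r w 0 k). Proof. exact: (progressive_coord hN). Qed.

Let stT : (`]s, t]%classic : set R) `<=` `[0, T].
Proof.
move=> r /=; rewrite !in_itv/= => /andP[sr rt].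
by rewrite (le_trans s0 (ltW sr)) (le_trans rt).
Qed.

(** The error of the increment is a signed sum of four endpoint errors, each of second moment at
    most [eta], whence 16 = 4 * 4. The integrand has two errors, whence 4 = 2 * 2. *)
Let ito_pair_approx (eta : R) : 0 < eta ->
  exists H H' : simple_process d T F,
  [/\ sqint P (fun w => N w - sp_diff s t H H' w),
      \int[P]_w ((N w - sp_diff s t H H' w) ^+ 2) <= 16 * eta &
      (\int[P]_w \int[mu]_(r in `]s, t])
        (enorm (sp_value H r w - sp_value H' r w - (Z r w - Z' r w)) ^+ 2)%:E
        <= (4 * eta)%:E)%E].
Proof.
move=> e0.
have sI : s \in `[0, T] by rewrite in_itv/= s0.
have tI : t \in `[0, T] by rewrite in_itv/= t0.
have [H [HZ Hs Ht]] := ito_approx iM sI tI e0.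
have [H' [HZ' Hs' Ht']] := ito_approx iM' sI tI e0.
have [aM _ _] := iM; have [aM' _ _] := iM'.
have [s1 e1] := L2err aM s0 sT Hs; have [s2 e2] := L2err aM t0 tT Ht.
have [s3 e3] := L2err aM' s0 sT Hs'; have [s4 e4] := L2err aM' t0 tT Ht'.
exists H, H'.
pose a w := sp_integral W H s w - M s w.
pose b w := sp_integral W H t w - M t w.
pose c w := sp_integral W H' s w - M' s w.
pose e w := sp_integral W H' t w - M' t w.
have NE : (fun w => N w - sp_diff s t H H' w) = (fun w => a w - b w + (e w - c w)).
  by apply/funext => w; rewrite /N /sp_diff /a /b /c /e; ring.
have sN : sqint P (fun w => N w - sp_diff s t H H' w).
  by rewrite NE; apply: sqintD; exact: sqintB.
split => //.
- apply: (@le_trans _ _ (\int[P]_w (4 * a w ^+ 2 + 4 * b w ^+ 2 + (4 * e w ^+ 2 + 4 * c w ^+ 2)))).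
    apply: le_Rint; first exact: sN.2.
      by apply: rintD; apply: rintD; apply: rintZ; [exact: s1.2|exact: s2.2|exact: s4.2|exact: s3.2].
    move=> w; rewrite (congr1 (fun f => f w) NE).
    exact: sqr_le4.
  rewrite RintegralD//; last 2 first.
  + by apply: rintD; apply: rintZ; [exact: s1.2|exact: s2.2].
  + by apply: rintD; apply: rintZ; [exact: s4.2|exact: s3.2].
  rewrite RintegralD//; [|exact: rintZ s1.2|exact: rintZ s2.2].
  rewrite RintegralD//; [|exact: rintZ s4.2|exact: rintZ s3.2].
  rewrite !RintegralZl//; [|exact: s3.2|exact: s4.2|exact: s2.2|exact: s1.2].
  by move: e1 e2 e3 e4; rewrite /a /b /c /e; lra.
pose f r w := enorm (sp_value H r w - Z r w) ^+ 2.
pose g r w := enorm (sp_value H' r w - Z' r w) ^+ 2.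
have jf : jmeas T f by apply: jmeas_enorm2B => // k; exact: (sp_value_jmeas hN).
have jg : jmeas T g by apply: jmeas_enorm2B => // k; exact: (sp_value_jmeas hN).
have f0 r w : 0 <= f r w by exact: sqr_ge0.
have g0 r w : 0 <= g r w by exact: sqr_ge0.
have mst : measurable (`]s, t]%classic : set (measurableTypeR R)) by exact: measurable_itv.
have sub h : jmeas T h -> (forall r w, 0 <= h r w) ->
    (\int[P]_w \int[mu]_(r in `[0%R, T]) (h r w)%:E <= eta%:E)%E ->
    (\int[P]_w \int[mu]_(r in `]s, t]) (h r w)%:E <= eta%:E)%E.
  move=> jh h0; apply: le_trans; apply: ge0_le_integral => //.
  - by move=> w _; exact: iterint_ge0.
  - exact: (iterint_measurable (T := T)).
  - by apply: (iterint_measurable (T := T)) => //; exact: measurable_itv.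
  - move=> w _; apply: ge0_subset_integral => //.
    + by apply/measurable_EFinP; exact: jmeas_section.
    + by move=> r _; rewrite lee_fin.
apply: (@le_trans _ _ (\int[P]_w \int[mu]_(r in `]s, t]) (2 * f r w + 2 * g r w)%:E)%E).
  apply: (iterint_le (T := T)) => //.
  - apply: (jmeas_enorm2B (Z := fun r w => sp_value H r w - sp_value H' r w)
      (Z' := fun r w => Z r w - Z' r w)) => k.
    + rewrite (_ : (fun r w => _) = fun r w => sp_value H r w 0 k - sp_value H' r w 0 k).
        by apply: jmeasB; exact: (sp_value_jmeas hN).
      by apply/funext => r; apply/funext => w; rewrite !mxE.
    + rewrite (_ : (fun r w => _) = fun r w => Z r w 0 k - Z' r w 0 k).
        exact: jmeasB.
      by apply/funext => r; apply/funext => w; rewrite !mxE.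
  - by apply: jmeasD; apply: jmeasM => //; exact: jmeas_cst.
  - by move=> r w; exact: sqr_ge0.
  - move=> r w; rewrite /f /g !enorm_sqr !mulr_sumr -big_split/=.
    apply: ler_sum => k _; rewrite !mxE.
    exact: sqr_sub_le2.
rewrite (iterint_linear (T := T))//.
apply: (@le_trans _ _ (2%:E * eta%:E + 2%:E * eta%:E)%E).
  have two0 : (0 <= 2%:E :> \bar R)%E by rewrite lee_fin.
  exact: (leeD (lee_wpmul2l two0 (sub f jf f0 HZ)) (lee_wpmul2l two0 (sub g jg g0 HZ'))).
by rewrite -EFinM -EFinD lee_fin; lra.
Qed.

Lemma ito_sqint : sqint P N.
Proof.
have [H [H' [sD _ _]]] := ito_pair_approx ltr01.
rewrite (_ : N = fun w => (N w - sp_diff s t H H' w) + sp_diff s t H H' w).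
  by apply: sqintD => //; exact: (sp_diff_sqint hN).
by apply/funext => w; rewrite subrK.
Qed.

(** Subtracting the simple approximation does not change the expectation, since that approximation
    is orthogonal to [X]. By Cauchy-Schwarz the square of the expectation is then arbitrarily
    small. *)
Lemma ito_orth X : fmeas s X -> sqint P X -> \int[P]_w (X w * N w) = 0.
Proof.
move=> fX sX; apply/eqP; rewrite -sqrf_eq0 eq_le sqr_ge0 andbT.
set x2 := \int[P]_w (X w ^+ 2).
have x0 : 0 <= x2 by apply: Rintegral_ge0 => w _; exact: sqr_ge0.
apply: (@le_of_eta _ _ _ (x2 * 16)) => [|eta e0 _]; first by rewrite mulr_ge0.
have [H [H' [sD eD _]]] := ito_pair_approx e0.
have sS := sp_diff_sqint hN s0 st tT H H'.
have -> : \int[P]_w (X w * N w) = \int[P]_w (X w * (N w - sp_diff s t H H' w)).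
  rewrite -[LHS]subr0 -(sp_diff_orth hN s0 st tT H H' fX sX) -RintegralB//.
  - by apply: eq_Rintegral => w _; ring.
  - exact: sqint_mul ito_sqint.
  - exact: sqint_mul.
rewrite add0r; apply: (le_trans (cauchy_schwarz_sqr sX sD)).
by rewrite mulrCA ler_wpM2l// mulrC.
Qed.

(** By the isometry for simple processes one number [An] is both the second moment of the
    approximating increment and the squared norm of its integrand. It is compared with each side of
    the claim up to an error of order [eta]. *)
Lemma ito_isometry : Bq = (\int[P]_w (N w ^+ 2))%:E.
Proof.
have sN := ito_sqint; set A := \int[P]_w (N w ^+ 2).
have A0 : 0 <= A by apply: Rintegral_ge0 => w _; exact: sqr_ge0.
have B0 : (0 <= Bq)%E.
  by apply: integral_ge0 => w _; apply: integral_ge0 => r _; rewrite lee_fin sqr_ge0.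
have mst : measurable (`]s, t]%classic : set (measurableTypeR R)) by exact: measurable_itv.
have key (eta : R) : 0 < eta -> eta <= 1 -> exists An : R,
    [/\ A <= (1 + eta) * An + 32 * eta, An <= (1 + eta) * A + 32 * eta,
      (An%:E <= (1 + eta)%:E * Bq + (8 * eta)%:E)%E &
      (Bq <= (1 + eta)%:E * An%:E + (8 * eta)%:E)%E].
  (* The approximation has accuracy [eta ^+ 2], because the errors get multiplied by [1 + eta^-1]
     and the product is at most [2 * eta]. *)
  move=> e0 e1; have e20 : 0 < eta ^+ 2 by rewrite exprn_gt0.
  have [H [H' [sD eD eZ]]] := ito_pair_approx e20.
  have sS := sp_diff_sqint hN s0 st tT H H'.
  have iv0 : 0 <= 1 + eta^-1 by rewrite addr_ge0// invr_ge0 ltW.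
  have e10 : 0 <= 1 + eta by rewrite addr_ge0// ltW.
  have ivE : (1 + eta^-1) * eta ^+ 2 = eta ^+ 2 + eta by field; rewrite gt_eqF.
  have ee : eta ^+ 2 <= eta by rewrite expr2 ger_pMr.
  have RL (X Y : Omega -> R) : sqint P X -> sqint P Y ->
      \int[P]_w ((X w - Y w) ^+ 2) <= 16 * eta ^+ 2 ->
      \int[P]_w (X w ^+ 2) <= (1 + eta) * \int[P]_w (Y w ^+ 2) + 32 * eta.
    move=> sX sY eXY; have sXY := sqintB sX sY.
    apply: (@le_trans _ _ (\int[P]_w ((1 + eta) * Y w ^+ 2 + (1 + eta^-1) * (X w - Y w) ^+ 2))).
      apply: le_Rint; first exact: sX.2.
        by apply: rintD; apply: rintZ; [exact: sY.2|exact: sXY.2].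
      by move=> w; exact: sqr_le_eta.
    rewrite RintegralD//; [|exact: rintZ sY.2|exact: rintZ sXY.2].
    rewrite !RintegralZl//; [|exact: sXY.2|exact: sY.2].
    rewrite lerD2l (le_trans (ler_wpM2l iv0 eXY))// mulrCA ivE; nra.
  pose V r w := sp_value H r w - sp_value H' r w.
  pose Zb r w := Z r w - Z' r w.
  have jV k : jmeas T (fun r w => V r w 0 k).
    rewrite (_ : (fun r w => _) = fun r w => sp_value H r w 0 k - sp_value H' r w 0 k).
      by apply: jmeasB; exact: (sp_value_jmeas hN).
    by apply/funext => r; apply/funext => w; rewrite !mxE.
  have jZb k : jmeas T (fun r w => Zb r w 0 k).
    rewrite (_ : (fun r w => _) = fun r w => Z r w 0 k - Z' r w 0 k).
      exact: jmeasB.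
    by apply/funext => r; apply/funext => w; rewrite !mxE.
  have jVZ := jmeas_enorm2B jV jZb.
  have KL (f g : R -> Omega -> R) : jmeas T f -> jmeas T g ->
      (forall r w, 0 <= f r w) -> (forall r w, 0 <= g r w) ->
      (forall r w, f r w <= (1 + eta) * g r w + (1 + eta^-1) * enorm (V r w - Zb r w) ^+ 2) ->
      (\int[P]_w \int[mu]_(r in `]s, t]) (f r w)%:E <=
       (1 + eta)%:E * \int[P]_w \int[mu]_(r in `]s, t]) (g r w)%:E + (8 * eta)%:E)%E.
    move=> jf jg f0 g0 fg.
    apply: (@le_trans _ _ (\int[P]_w \int[mu]_(r in `]s, t])
      ((1 + eta) * g r w + (1 + eta^-1) * enorm (V r w - Zb r w) ^+ 2)%:E)%E).
      apply: (iterint_le (T := T)) => //.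
      by apply: jmeasD; apply: jmeasM => //; exact: jmeas_cst.
    rewrite (iterint_linear (T := T))//; last by move=> r w; exact: sqr_ge0.
    apply: leeD => //.
    apply: (@le_trans _ _ ((1 + eta^-1)%:E * (4 * eta ^+ 2)%:E)%E).
      by apply: lee_wpmul2l => //; rewrite lee_fin.
    by rewrite -EFinM lee_fin mulrCA ivE; nra.
  exists (\int[P]_w (sp_diff s t H H' w ^+ 2)); split.
  - exact: RL.
  - apply: RL => //; apply: le_trans eD.
    by apply: le_Rint => [||w]; [exact: (sqintB sS sN).2|exact: sD.2|rewrite -sqrrN opprB].
  - rewrite -(sp_diff_isometry hN s0 st tT).
    apply: (KL (fun r w => enorm (V r w) ^+ 2) (fun r w => enorm (Zb r w) ^+ 2)).
    + exact: jmeas_enorm2.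
    + exact: jmeas_enorm2.
    + by move=> r w; exact: sqr_ge0.
    + by move=> r w; exact: sqr_ge0.
    + by move=> r w; exact: enorm_sqr_le_eta.
  - rewrite -(sp_diff_isometry hN s0 st tT).
    apply: (KL (fun r w => enorm (Zb r w) ^+ 2) (fun r w => enorm (V r w) ^+ 2)).
    + exact: jmeas_enorm2.
    + exact: jmeas_enorm2.
    + by move=> r w; exact: sqr_ge0.
    + by move=> r w; exact: sqr_ge0.
    + move=> r w; have := enorm_sqr_le_eta (Zb r w) (V r w) e0.
      by rewrite enorm_distrC.
(* The comparison at [eta] = 1 already gives finiteness, after which both sides are real numbers. *)
have Bfin : Bq \is a fin_num.
  have [An [_ _ _ h]] := key _ ltr01 (lexx _).
  rewrite ge0_fin_numE//; apply: (le_lt_trans h).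
  by rewrite -EFinM -EFinD ltry.
move: key B0; rewrite -(fineK Bfin); set b := fine Bq => key; rewrite lee_fin => b0.
congr EFin; apply/eqP; rewrite eq_le; apply/andP; split.
(* The two comparisons are composed and [eta * eta <= eta] is applied: 3 = 2 + 1 and 72 = 32 + 32 +
   8. In the other direction 48 = 8 + 8 + 32. *)
- apply: (@le_of_eta _ _ _ (3 * A + 72)) => [|eta e0 e1]; first lra.
  have [An [_ h2 _ h4]] := key eta e0 e1.
  move: h4; rewrite -EFinM -EFinD lee_fin => h4.
  have : (1 + eta) * An <= (1 + eta) * ((1 + eta) * A + 32 * eta) by rewrite ler_wpM2l// addr_ge0// ltW.
  have he : eta * eta <= eta by rewrite ger_pMr.
  have hA : eta * eta * A <= eta * A by rewrite ler_wpM2r.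
  by lra.
- apply: (@le_of_eta _ _ _ (3 * b + 48)) => [|eta e0 e1]; first lra.
  have [An [h1 _ h3 _]] := key eta e0 e1.
  move: h3; rewrite -EFinM -EFinD lee_fin => h3.
  have : (1 + eta) * An <= (1 + eta) * ((1 + eta) * b + 8 * eta) by rewrite ler_wpM2l// addr_ge0// ltW.
  have he : eta * eta <= eta by rewrite ger_pMr.
  have hA : eta * eta * b <= eta * b by rewrite ler_wpM2r.
  by lra.
Qed.

End difference.
End ito.

(** * Sums along uniform grids *)

Section uniform_grid.
Context (R : realType) (T : R).
Hypothesis T0 : 0 < T.
Notation mu := (@lebesgue_measure R).

Definition grid (n i : nat) : R := T * (i%:R / n.+1%:R).

Lemma grid0 n : grid n 0 = 0. Proof. by rewrite /grid mul0r mulr0. Qed.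

Lemma gridT n : grid n n.+1 = T.
Proof. by rewrite /grid divff ?mulr1// pnatr_eq0. Qed.

Lemma grid_le n i j : (i <= j)%N -> grid n i <= grid n j.
Proof. by move=> ij; rewrite ler_pM2l// ler_pM2r ?invr_gt0 ?ltr0n// ler_nat. Qed.

Lemma grid_ge0 n i : 0 <= grid n i. Proof. by rewrite -(grid0 n) grid_le. Qed.

Lemma grid_leT n i : (i <= n.+1)%N -> grid n i <= T.
Proof. by move=> ?; rewrite -[leRHS](gridT n) grid_le. Qed.

Lemma grid_step n i : grid n i.+1 - grid n i = T / n.+1%:R.
Proof. by rewrite /grid -mulrBr -mulrBl -natrB// subSnn div1r. Qed.

Lemma grid_itv n i : (i <= n.+1)%N -> grid n i \in `[0, T].
Proof. by move=> h; rewrite in_itv/= grid_ge0 grid_leT. Qed.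

(** Uniform continuity phrased with the mesh of the grids. Compactness enters in its near-covering
    form, which turns a local modulus at each point into one eventual statement about [n]. *)
Lemma uniform_continuity (X : R -> R) (e : R) : 0 < e ->
  {within `[0, T], continuous X} ->
  \forall n \near \oo, forall x y, x \in `[0, T] -> y \in `[0, T] ->
    `|x - y| <= T / n.+1%:R -> `|X x - X y| <= e.
Proof.
move=> e0 /subspace_continuousP cX.
have /compact_near_coveringP nc := @segment_compact R 0 T.
have H := nc nat \oo (fun n x => x \in `[0, T] -> forall y, y \in `[0, T] ->
    `|x - y| <= T / n.+1%:R -> `|X x - X y| <= e) _.
suff : \forall n \near \oo, `[0, T] `<=` (fun x => x \in `[0, T] -> forall y, y \in `[0, T] ->
    `|x - y| <= T / n.+1%:R -> `|X x - X y| <= e).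
  by apply: filterS => n h x y xT yT; exact: (h x).
apply: H => x xT.
have e2 : 0 < e / 2 by rewrite divr_gt0.
have /cvgrPdist_le/(_ _ e2) := cX x xT.
rewrite near_withinE => /nbhs_ballP[del /= del0 Hdel].
have del2 : 0 < del / 2 by rewrite divr_gt0.
near=> x' n => x'T y yT x'y.
have xx' : `|x - x'| < del / 2.
  by near: x'; exact: (near_ball x (del / 2) del2).
have hn : T / n.+1%:R < del / 2.
  near: n; apply: filterS (near_infty_natSinv_lt (PosNum (divr_gt0 del2 T0))) => n /=.
  by rewrite ltr_pdivlMr// mulrC.
rewrite -(subrK (X x) (X x')) -addrA (splitr e).
apply: (le_trans (ler_normD _ _)); apply: lerD.
  rewrite distrC; apply: Hdel => //.
  by apply: (lt_le_trans xx'); rewrite ler_pdivrMr// ler_pMr// ler1n.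
apply: Hdel => //; rewrite /ball/=.
rewrite -(subrK x' x) -addrA (splitr del).
by apply: (le_lt_trans (ler_normD _ _)); apply: ltrD => //; exact: le_lt_trans hn.
Unshelve. all: by end_near. Qed.

Lemma Rintegral_grid (f : R -> R) n m : (m <= n.+1)%N ->
  mu.-integrable `]0, T] (EFin \o f) ->
  \int[mu]_(r in `]0, grid n m]) f r =
  \sum_(i < m) \int[mu]_(r in `]grid n i, grid n i.+1]) f r.
Proof.
move=> mn fi; elim: m mn => [|m IH] mn.
  by rewrite grid0 set_itvoc0 Rintegral_set0 big_ord0.
rewrite big_ord_recr/= -IH; last exact: ltnW.
have := @Rintegral_itvB R f (BRight 0) (BRight (grid n m.+1)) (grid n m) _ _ _.
rewrite !bnd_simp => <-; [by rewrite subrKC| |exact: grid_ge0|exact: grid_le].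
apply: integrableS fi => //; apply: subset_itvl.
by rewrite bnd_simp grid_leT.
Qed.

(** Since [f] is nonnegative, its integral against [k] vanishes on each cell. The value of [f] at
    the left endpoint is at most [f r + e] throughout the cell, and integrating this inequality
    against [k] leaves only the term with [e]. *)
Lemma stieltjes_grid (f k : R -> R) (e : R) : 0 < e ->
  {within `[0, T], continuous f} -> (forall t, t \in `[0, T] -> 0 <= f t) ->
  stieltjes_integral_eq0 T f k ->
  \forall n \near \oo, forall i, (i < n.+1)%N ->
    f (grid n i) * (k (grid n i.+1) - k (grid n i)) <=
    e * (k (grid n i.+1) - k (grid n i)).
Proof.
move=> e0 cf f0 [kT [kTE if0]].
have := uniform_continuity e0 cf; apply: filterS => n H i ni.
have gi := grid_itv (ltnW ni : (i <= n.+1)%N); have gi1 := grid_itv ni.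
have kE j : (j <= n.+1)%N -> k (grid n j) = kT (grid n j).
  move=> jn; rewrite kTE (min_l (grid_leT jn)) max_r//; exact: grid_ge0.
rewrite !kE//; last exact: ltnW.
set nu := lebesgue_stieltjes_measure kT in if0.
have nuE : nu `]grid n i, grid n i.+1]%classic = (kT (grid n i.+1) - kT (grid n i))%:E.
  rewrite /nu /lebesgue_stieltjes_measure /measure_extension.
  rewrite measurable_mu_extE; last exact: is_ocitv.
  by apply: wlength_itv_bnd; exact: grid_le.
have mf : measurable_fun (`[0, T]%classic : set (measurableTypeR R)) f.
  apply: subspace_continuous_measurable_fun => //; exact: measurable_itv.
have sub (r : R) : r \in `]grid n i, grid n i.+1] -> r \in `[0, T].
  rewrite !in_itv/= => /andP[h1 h2].
  by rewrite (le_trans (grid_ge0 n i) (ltW h1)) (le_trans h2 (grid_leT ni)).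
have ige0 : (0 <= \int[nu]_(r in `]grid n i, grid n i.+1]) (f r)%:E)%E.
  by apply: integral_ge0 => r rI; rewrite lee_fin; apply: f0; exact: sub.
have i0 : (\int[nu]_(r in `]grid n i, grid n i.+1]) (f r)%:E = 0)%E.
  apply/eqP; rewrite eq_le ige0 andbT -if0; apply: ge0_subset_integral => //.
  exact/measurable_EFinP.
have mI : measurable (`]grid n i, grid n i.+1]%classic : set (measurableTypeR R)).
  exact: measurable_itv.
rewrite -lee_fin !EFinM -nuE -!integral_cst//.
apply: (@le_trans _ _ (\int[nu]_(r in `]grid n i, grid n i.+1]) ((f r)%:E + e%:E))%E).
  apply: ge0_le_integral => //.
  - by move=> r _; rewrite lee_fin f0.
  - apply: emeasurable_funD => //; apply/measurable_EFinP.
    by apply: measurable_funS mf => //; exact: measurable_itv.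
  - move=> r rI; rewrite -EFinD lee_fin -lerBlDl.
    apply: le_trans (ler_norm _) (H _ _ gi (sub _ rI) _).
    move: rI; rewrite /= in_itv/= => /andP[h1 h2].
    by rewrite distrC ger0_norm ?subr_ge0 ?(ltW h1)// -(grid_step n i) lerD2r.
rewrite ge0_integralD//; [by rewrite i0 add0e|by move=> r /sub /f0; rewrite lee_fin| |
  by move=> r _; rewrite lee_fin ltW].
by apply/measurable_EFinP; apply: measurable_funS mf => //; exact: measurable_itv.
Qed.

Lemma continuous_bounded (X : R -> R) : {within `[0, T], continuous X} ->
  exists2 M : R, 0 <= M & forall r, r \in `[0, T] -> `|X r| <= M.
Proof.
move=> cX.
have /compact_bounded[M [_ HM]] := continuous_compact cX (@segment_compact R 0 T).
exists (`|M| + 1) => [|r rT]; first by rewrite addr_ge0.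
by apply: (HM (`|M| + 1)); [rewrite ltr_pwDr// ler_norm|exists r].
Qed.

Lemma grid_subset n i : (i < n.+1)%N ->
  (`]grid n i, grid n i.+1] `<=` (`]0, T] : set R))%classic.
Proof.
move=> ni r /=; rewrite !in_itv/= => /andP[h1 h2].
by rewrite (le_lt_trans (grid_ge0 n i) h1) (le_trans h2 (grid_leT ni)).
Qed.

Lemma integrable_continuousM (X f : R -> R) : {within `[0, T], continuous X} ->
  mu.-integrable `]0, T] (EFin \o f) ->
  mu.-integrable `]0, T] (EFin \o (fun r => X r * f r)).
Proof.
move=> cX fi; have [M M0 HM] := continuous_bounded cX.
have mX : measurable_fun (`[0, T]%classic : set (measurableTypeR R)) X.
  by apply: subspace_continuous_measurable_fun => //; exact: measurable_itv.
rewrite (_ : EFin \o _ = (EFin \o X) \* (EFin \o f))%E//.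
have sub : (`]0, T] `<=` (`[0, T] : set R))%classic.
  by apply: subset_itvr; rewrite bnd_simp.
apply: integrableMr => //.
  by apply: measurable_funS mX => //; exact: measurable_itv.
exists M; split; first exact: num_real.
by move=> x Mx r /= rT; apply: le_trans (ltW Mx); apply: HM; exact: sub.
Qed.

(** The evaluation points are left free: the increments of the weight come with right endpoints, the
    driver with left ones. *)
Lemma riemann_sum_cvg (X f : R -> R) (p : nat -> nat -> R) :
  {within `[0, T], continuous X} -> mu.-integrable `]0, T] (EFin \o f) ->
  (forall n i, (i < n.+1)%N -> p n i \in `[grid n i, grid n i.+1]) ->
  \sum_(i < n.+1) X (p n i) * \int[mu]_(r in `]grid n i, grid n i.+1]) f r
    @[n --> \oo] --> \int[mu]_(r in `]0, T]) (X r * f r).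
Proof.
move=> cX fi pI; apply/cvgrPdist_le => e e0.
have fni : mu.-integrable `]0, T] (EFin \o (fun r => `|f r|)).
  exact: (integrable_norm fi).
set I := \int[mu]_(r in `]0, T]) `|f r|.
have I0 : 0 <= I by exact: Rintegral_ge0.
have I1 : 0 < I + 1 by rewrite ltr_wpDl.
have e'0 : 0 < e / (I + 1) by rewrite divr_gt0.
have iXf := integrable_continuousM cX fi.
have := uniform_continuity e'0 cX; apply: filterS => n H.
have Xf := Rintegral_grid (leqnn n.+1) iXf.
have If := Rintegral_grid (leqnn n.+1) fni.
rewrite gridT in Xf If; rewrite Xf -sumrB.
apply: (le_trans (ler_norm_sum _ _ _)).
apply: (@le_trans _ _ (\sum_(i < n.+1) e / (I + 1) *
    \int[mu]_(r in `]grid n i, grid n i.+1]) `|f r|)); last first.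
  rewrite -mulr_sumr -If -/I mulrAC ler_pdivrMr// ler_pM2l//.
  by rewrite lerDl.
apply: ler_sum => i _.
have iS (h : R -> R) : mu.-integrable `]0, T] (EFin \o h) ->
    mu.-integrable `]grid n i, grid n i.+1] (EFin \o h).
  by move=> ih; apply: integrableS ih => //; exact: grid_subset.
have iZ (c : R) (h : R -> R) : mu.-integrable `]0, T] (EFin \o h) ->
    mu.-integrable `]grid n i, grid n i.+1] (EFin \o (fun r => c * h r)).
  move=> ih; rewrite (_ : EFin \o _ = (fun r => c%:E * (h r)%:E)%E)//.
  by apply: integrableZl => //; exact: iS.
have iD : mu.-integrable `]grid n i, grid n i.+1]
    (EFin \o (fun r => X r * f r - X (p n i) * f r)).
  rewrite (_ : EFin \o _ = (EFin \o (fun r => (X r * f r)%R)) \-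
    (EFin \o (fun r => (X (p n i) * f r)%R)))%E//.
  by apply: integrableB => //; [exact: iS|exact: iZ].
rewrite -RintegralZl//; last exact: iS.
rewrite -RintegralB//; [|exact: iS|exact: iZ].
apply: (le_trans (le_normr_Rintegral _ iD)) => //.
rewrite -RintegralZl//; last exact: iS.
apply: le_Rintegral => //; [exact: (integrable_norm iD)|exact: iZ|].
move=> r rI; rewrite -mulrBl normrM ler_wpM2r//.
have rT := grid_subset (ltn_ord i) rI.
have p1 := pI n i (ltn_ord i); move: p1 rI rT; rewrite /= !in_itv/=.
move=> /andP[p1 p2] /andP[r1 r2] /andP[r3 r4].
apply: H; rewrite ?in_itv/=.
- by rewrite (ltW r3) r4.
- by rewrite (le_trans (grid_ge0 n i) p1) (le_trans p2 (grid_leT (ltn_ord i))).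
- by rewrite -(grid_step n i) ler_norml; lra.
Qed.

(** One factor of each square is bounded by the largest increment of [V], which tends to 0 by
    uniform continuity; the other factors sum to at most [V T - V 0]. *)
Lemma quadratic_variation_cvg (D V : R -> R) : {within `[0, T], continuous V} ->
  (forall x y, 0 <= x -> x <= y -> y <= T -> `|D y - D x| <= V y - V x) ->
  \sum_(i < n.+1) (D (grid n i.+1) - D (grid n i)) ^+ 2 @[n --> \oo] --> (0 : R).
Proof.
move=> cV DV; apply/cvgr0Pnorm_le => e e0.
have V0 : 0 <= V T - V 0.
  by apply: le_trans (DV 0 T (lexx _) (ltW T0) (lexx _)).
have V1 : 0 < V T - V 0 + 1 by rewrite ltr_wpDl.
have e'0 : 0 < e / (V T - V 0 + 1) by rewrite divr_gt0.
have := uniform_continuity e'0 cV; apply: filterS => n H.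
rewrite ger0_norm; last by apply: sumr_ge0 => i _; exact: sqr_ge0.
apply: (@le_trans _ _ (\sum_(i < n.+1) e / (V T - V 0 + 1) *
    (V (grid n i.+1) - V (grid n i)))); last first.
  rewrite -mulr_sumr -(big_mkord xpredT (fun i => V (grid n i.+1) - V (grid n i))).
  rewrite telescope_sumr// gridT grid0 mulrAC ler_pdivrMr// ler_pM2l//.
  by rewrite lerDl.
apply: ler_sum => i _.
have i1 := grid_itv (ltn_ord i); have i0 := grid_itv (ltnW (ltn_ord i)).
have d1 := DV _ _ (grid_ge0 n i) (grid_le n (leqnSn i)) (grid_leT (ltn_ord i)).
have d0 : 0 <= V (grid n i.+1) - V (grid n i) by exact: le_trans d1.
have d2 : V (grid n i.+1) - V (grid n i) <= e / (V T - V 0 + 1).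
  apply: (le_trans (ler_norm _)); apply: H => //.
  by rewrite -(grid_step n i) ger0_norm// subr_ge0 grid_le.
rewrite -real_normK ?num_real// expr2.
by apply: ler_pM => //; exact: le_trans d2.
Qed.

End uniform_grid.

(** * Discrete energy identity *)

(** The increment of e_i u_i^2 is (e_{i+1} - e_i) u_{i+1}^2 + e_i (u_{i+1}^2 - u_i^2). In this
    splitting the factor of [dm i] in the linear term is [e i * u i], known at the left endpoint, as
    orthogonality to martingale increments requires. *)
Lemma discrete_energy (R : realType) (e u f c dm : nat -> R) m :
  (forall i, 0 <= e i) ->
  (forall i, (i < m)%N -> u i.+1 - u i = - f i - c i + dm i) ->
  \sum_(i < m) (e i.+1 - e i) * u i.+1 ^+ 2 - 2 * \sum_(i < m) e i * u i * f i
  - 2 * \sum_(i < m) e i * u i * c i + 2 * \sum_(i < m) e i * u i * dm i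
  + 3 / 4 * \sum_(i < m) e i * dm i ^+ 2 - 3 * \sum_(i < m) e i * (f i + c i) ^+ 2
  <= e m * u m ^+ 2 - e 0 * u 0 ^+ 2.
Proof.
move=> e0; elim: m => [|m IH] du.
  by rewrite !big_ord0 subrr !mulr0 !subr0 !addr0.
rewrite !big_ord_recr/=.
have {}IH := IH (fun i im => du i (ltnW im)).
have uS : u m.+1 = u m - f m - c m + dm m by rewrite -[LHS](subrK (u m)) du//; ring.
set S1 := \sum_(i < m) _ in IH *; set S2 := \sum_(i < m) _ in IH *.
set S3 := \sum_(i < m) _ in IH *; set S4 := \sum_(i < m) _ in IH *.
set S5 := \sum_(i < m) _ in IH *; set S6 := \sum_(i < m) _ in IH *.
rewrite -subr_ge0 in IH; rewrite -subr_ge0.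
(* The last square is exactly what gets discarded: with x = f + c, (dm - x)^2 = 3/4 dm^2 - 3 x^2 +
   (dm / 2 - 2 x)^2. *)
rewrite (_ : _ - _ = (e m * u m ^+ 2 - e 0 * u 0 ^+ 2 - (S1 - 2 * S2 - 2 * S3 + 2 * S4 + 3 / 4 * S5 - 3 * S6))
  + e m * (dm m / 2 - 2 * (f m + c m)) ^+ 2).
  by rewrite addr_ge0// mulr_ge0// sqr_ge0.
by rewrite uS; field.
Qed.

(** * Limits and bounds of the drift and variation sums of a path *)

Section energy_paths.
Context (R : realType) (T gamma : R).
Hypotheses (T0 : 0 < T) (g0 : 0 <= gamma).
Notation mu := (@lebesgue_measure R).
Local Notation grid := (grid T).
Local Notation e := (fun t : R => expR (gamma * t)).

Lemma expR_homo (s t : R) : s <= t -> e s <= e t.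
Proof. by move=> st; rewrite ler_expR ler_wpM2l. Qed.

Lemma continuous_expRM : continuous e.
Proof.
move=> x; apply: continuous_comp; last exact: continuous_expR.
exact: mulrl_continuous.
Qed.

Lemma Rintegral_expRM (s t : R) : s <= t ->
  \int[mu]_(r in `]s, t]) (gamma * e r) = e t - e s.
Proof.
rewrite le_eqVlt => /predU1P[->|st].
  by rewrite set_itvoc0 Rintegral_set0 subrr.
have cf : continuous (fun r => gamma * e r).
  by move=> x; apply: cvgMr; exact: continuous_expRM.
have ic : mu.-integrable `[s, t] (EFin \o (fun r => gamma * e r)).
  apply: continuous_compact_integrable; first exact: segment_compact.
  exact: continuous_subspaceT.
rewrite Rintegral_itv_obnd_cbnd; last first.
  by apply: integrableS ic => //; apply: subset_itvr; rewrite bnd_simp.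
have dE (x : R) : is_derive x (1 : R) e (gamma * e x).
  have H : is_derive x (1 : R) (fun x : R => gamma * x) gamma.
    rewrite (_ : (fun x : R => _) = gamma \*: (id : R -> R)); last by apply/funext.
    by apply: is_derive_eq; rewrite /GRing.scale /= mulr1.
  have H2 := is_derive1_comp (is_derive_expR _) H.
  by apply: is_derive_eq; rewrite /GRing.scale /= mulrC.
rewrite /Rintegral (@continuous_FTC2 R _ e _ _ st (continuous_subspaceT cf))//.
- split => [x _| |]; first by have [] := dE x.
  + by apply: cvg_at_right_filter; exact: continuous_expRM.
  + by apply: cvg_at_left_filter; exact: continuous_expRM.
- by move=> x _; rewrite derive1E; have [_ ->] := dE x.
Qed.

Lemma integrable_expRM : mu.-integrable `]0, T] (EFin \o (fun r => gamma * e r)).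
Proof.
have ic : mu.-integrable `[0, T] (EFin \o (fun r => gamma * e r)).
  apply: continuous_compact_integrable; first exact: segment_compact.
  by apply: continuous_subspaceT => x; apply: cvgMr; exact: continuous_expRM.
by apply: integrableS ic => //; apply: subset_itvr; rewrite bnd_simp.
Qed.

Section path.
Variables (U f : R -> R).
Hypothesis cU : {within `[0, T], continuous U}.
Hypothesis fi0 : mu.-integrable `[0, T] (EFin \o f).

Let fi : mu.-integrable `]0, T] (EFin \o f).
Proof. by apply: integrableS fi0 => //; apply: subset_itvr; rewrite bnd_simp. Qed.

Let cwM (X Y : R -> R) : {within `[0, T], continuous X} ->
  {within `[0, T], continuous Y} -> {within `[0, T], continuous (fun r => X r * Y r)}.
Proof. by move=> cX cY x; apply: cvgM; [exact: cX|exact: cY]. Qed.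

Let ceU : {within `[0, T], continuous (fun r => e r * U r)}.
Proof. by apply: cwM => //; exact/continuous_subspaceT/continuous_expRM. Qed.

Definition drift_sum n : R :=
  \sum_(i < n.+1) (e (grid n i.+1) - e (grid n i)) * U (grid n i.+1) ^+ 2
  - 2 * \sum_(i < n.+1) e (grid n i) * U (grid n i) *
      \int[mu]_(r in `]grid n i, grid n i.+1]) f r.

Definition drift_integral : R :=
  \int[mu]_(r in `]0, T]) (gamma * e r * U r ^+ 2 - 2 * (e r * U r * f r)).

Lemma drift_integrable :
  mu.-integrable `]0, T] (EFin \o (fun r => U r * U r * (gamma * e r))) /\
  mu.-integrable `]0, T] (EFin \o (fun r => e r * U r * f r)).
Proof.
split; first by apply: integrable_continuousM => //; [exact: cwM|exact: integrable_expRM].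
exact: integrable_continuousM.
Qed.

Lemma drift_sum_cvg : drift_sum n @[n --> \oo] --> drift_integral.
Proof.
have c1 := riemann_sum_cvg T0 (cwM cU cU) integrable_expRM (p := fun n i => grid n i.+1) _.
have c2 := riemann_sum_cvg T0 ceU fi (p := fun n i => grid n i) _.
have [i1 i2] := drift_integrable.
rewrite /drift_integral.
rewrite (_ : \int[mu]_(r in _) _ = \int[mu]_(r in `]0, T]) (U r * U r * (gamma * e r)) -
   2 * \int[mu]_(r in `]0, T]) (e r * U r * f r)); last first.
  rewrite -RintegralZl// -RintegralB//.
    by apply: eq_Rintegral => r _; ring.
  rewrite (_ : EFin \o _ = (fun r => 2%:E * (e r * U r * f r)%R%:E)%E)//.
  exact: integrableZl.
apply: cvgB; last apply: cvgMr.
- apply: cvg_trans (c1 _); last first.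
    by move=> n i _; rewrite in_itv/= lexx andbT grid_le.
  apply: near_eq_cvg; apply: nearW => n; apply: eq_bigr => i _.
  by rewrite Rintegral_expRM ?grid_le// expr2 mulrC.
- apply: c2.
  by move=> n i _; rewrite in_itv/= lexx grid_le.
Qed.

(** A bound independent of [n], which serves as the dominating function in expectation. The
    increments of the weight telescope to at most [e T]. *)
Lemma drift_sum_bound n (S G : R) : (forall t, t \in `[0, T] -> `|U t| <= S) ->
  \int[mu]_(r in `]0, T]) `|f r| <= G ->
  `|drift_sum n| <= e T * S ^+ 2 + 2 * (e T * S * G).
Proof.
move=> US fG.
have S0 : 0 <= S.
  by apply: le_trans (normr_ge0 _) (US 0 _); rewrite in_itv/= lexx ltW.
have eT i : (i <= n.+1)%N -> e (grid n i) <= e T.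
  by move=> h; rewrite expR_homo// grid_leT.
apply: (le_trans (ler_normB _ _)); apply: lerD.
  rewrite ger0_norm; last first.
    apply: sumr_ge0 => i _; rewrite mulr_ge0 ?sqr_ge0// subr_ge0.
    by rewrite expR_homo// grid_le.
  apply: (@le_trans _ _ (\sum_(i < n.+1) (e (grid n i.+1) - e (grid n i)) * S ^+ 2)).
    apply: ler_sum => i _; rewrite ler_wpM2l//.
      by rewrite subr_ge0 expR_homo// grid_le.
    rewrite -[_ ^+ 2]real_normK ?num_real// lerXn2r// ?nnegrE//.
    by apply: US; exact: grid_itv.
  rewrite -mulr_suml ler_wpM2r ?sqr_ge0//.
  rewrite -(big_mkord xpredT (fun i => e (grid n i.+1) - e (grid n i))).
  by rewrite telescope_sumr// gridT lerBlDr lerDl expR_ge0.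
rewrite normrM ger0_norm// ler_pM2l//.
apply: (le_trans (ler_norm_sum _ _ _)).
apply: (@le_trans _ _ (\sum_(i < n.+1) e T * S * \int[mu]_(r in `]grid n i, grid n i.+1]) `|f r|)).
  apply: ler_sum => i _; rewrite !normrM.
  have iS : mu.-integrable `]grid n i, grid n i.+1] (EFin \o f).
    by apply: integrableS fi => //; exact: grid_subset.
  apply: ler_pM => //; last by apply: le_normr_Rintegral.
  apply: ler_pM => //; first by rewrite ger0_norm ?expR_ge0// eT// ltnW.
  by apply: US; apply: grid_itv => //; exact: ltnW.
rewrite -mulr_sumr -(Rintegral_grid T0 (leqnn n.+1)) ?gridT//; last exact: (integrable_norm fi).
by rewrite ler_wpM2l// mulr_ge0// expR_ge0.
Qed.

Variables (K K' : R -> R).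
Hypothesis (cK : {within `[0, T], continuous K}) (cK' : {within `[0, T], continuous K'}).
Hypothesis (ndK : forall s t, 0 <= s -> s <= t -> t <= T -> K s <= K t).
Hypothesis (ndK' : forall s t, 0 <= s -> s <= t -> t <= T -> K' s <= K' t).

(** Up to sign, [D] is the finite variation part of the process; [V] is a continuous nondecreasing
    function whose increments dominate those of [D]. *)
Let D t := \int[mu]_(r in `]0, t]) f r + (K t - K' t).
Let V t := \int[mu]_(r in `[0, t]) `|f r| + (K t + K' t).

Let f_itv (h : R -> R) x y : 0 <= x -> x <= y -> y <= T ->
  mu.-integrable `]0, T] (EFin \o h) ->
  \int[mu]_(r in `]0, y]) h r - \int[mu]_(r in `]0, x]) h r = \int[mu]_(r in `]x, y]) h r.
Proof.
move=> x0 xy yT hi; apply: (@Rintegral_itvB R h (BRight 0) (BRight y) x).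
- by apply: integrableS hi => //; apply: subset_itvl; rewrite bnd_simp.
- by rewrite bnd_simp.
- by rewrite bnd_simp.
Qed.

Let normf_i : mu.-integrable `]0, T] (EFin \o (fun r => `|f r|)).
Proof. exact: (integrable_norm fi). Qed.

Let V0E y : 0 <= y -> y <= T ->
  \int[mu]_(r in `[0, y]) `|f r| = \int[mu]_(r in `]0, y]) `|f r|.
Proof.
move=> y0 yT; rewrite Rintegral_itv_obnd_cbnd//.
by apply: integrableS normf_i => //; apply: subset_itvl; rewrite bnd_simp.
Qed.

Let DV x y : 0 <= x -> x <= y -> y <= T -> `|D y - D x| <= V y - V x.
Proof.
move=> x0 xy yT; have y0 := le_trans x0 xy; have xT := le_trans xy yT.
rewrite /D /V !V0E//.
rewrite opprD addrACA f_itv// [leRHS](_ : _ = \int[mu]_(r in `]x, y]) `|f r| +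
    ((K y - K x) + (K' y - K' x))); last by rewrite -(f_itv x0 xy yT normf_i); ring.
apply: (le_trans (ler_normD _ _)); apply: lerD.
  apply: le_normr_Rintegral => //; apply: integrableS fi => //.
  by move=> r /=; rewrite !in_itv/= => /andP[h1 h2]; rewrite (le_lt_trans x0 h1) (le_trans h2).
have := ndK x0 xy yT; have := ndK' x0 xy yT; rewrite ler_norml; lra.
Qed.

Let cV : {within `[0, T], continuous V}.
Proof.
have := parameterized_integral_continuous (ltW T0) (integrable_norm fi0).
by move=> cI x; apply: cvgD; [exact: cI|apply: cvgD; [exact: cK|exact: cK']].
Qed.

Definition variation_sum n : R :=
  \sum_(i < n.+1) e (grid n i) * (\int[mu]_(r in `]grid n i, grid n i.+1]) f r +
    (K (grid n i.+1) - K (grid n i) - (K' (grid n i.+1) - K' (grid n i)))) ^+ 2.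

Let variation_sum_le n :
  `|variation_sum n| <= e T * \sum_(i < n.+1) (D (grid n i.+1) - D (grid n i)) ^+ 2.
Proof.
rewrite ger0_norm; last by apply: sumr_ge0 => i _; rewrite mulr_ge0 ?sqr_ge0 ?expR_ge0.
rewrite mulr_sumr; apply: ler_sum => i _.
rewrite [X in _ <= _ * X ^+ 2](_ : _ = \int[mu]_(r in `]grid n i, grid n i.+1]) f r +
    (K (grid n i.+1) - K (grid n i) - (K' (grid n i.+1) - K' (grid n i)))); last first.
  rewrite -(f_itv _ _ _ fi); [rewrite /D; ring|exact: grid_ge0|exact: grid_le|exact: grid_leT].
by rewrite ler_wpM2r ?sqr_ge0// expR_homo// grid_leT// ltnW.
Qed.

Lemma variation_sum_cvg : variation_sum n @[n --> \oo] --> (0 : R).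
Proof.
apply: (cvg0_le variation_sum_le).
rewrite -[X in _ --> X](mulr0 (e T)); apply: cvgMr.
exact: (quadratic_variation_cvg T0 cV DV).
Qed.

(** [V] is nondecreasing and starts at 0, so each of its increments is at most [V T], and the sum of
    their squares is at most [V T ^+ 2]. *)
Lemma variation_sum_bound n (G : R) : \int[mu]_(r in `]0, T]) `|f r| <= G ->
  K 0 = 0 -> K' 0 = 0 ->
  `|variation_sum n| <= e T * (G + (K T + K' T)) ^+ 2.
Proof.
move=> fG K0 K'0; apply: (le_trans (variation_sum_le n)).
rewrite ler_wpM2l ?expR_ge0//; have T0' := ltW T0.
have V00 : V 0 = 0 by rewrite /V K0 K'0 V0E// set_itvoc0 Rintegral_set0 !addr0.
have Vmono x y : 0 <= x -> x <= y -> y <= T -> V x <= V y.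
  by move=> x0 xy yT; rewrite -subr_ge0; apply: le_trans (DV x0 xy yT).
have VT : V T <= G + (K T + K' T) by rewrite /V V0E// lerD2r.
have VT0 : 0 <= V T by rewrite -V00 Vmono.
apply: (@le_trans _ _ (V T ^+ 2)); last by rewrite lerXn2r// nnegrE// (le_trans VT0).
have VS : V T = \sum_(i < n.+1) (V (grid n i.+1) - V (grid n i)).
  rewrite -(big_mkord xpredT (fun i => V (grid n i.+1) - V (grid n i))).
  by rewrite (telescope_sumr (fun i => V (grid n i)))// gridT grid0 V00 subr0.
rewrite expr2 [X in _ <= _ * X]VS mulr_sumr.
apply: ler_sum => i _.
have h := DV (grid_ge0 T0 n i) (grid_le T0 n (leqnSn i)) (grid_leT T0 (ltn_ord i)).
rewrite -real_normK ?num_real// expr2; apply: ler_pM => //.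
apply: (le_trans h).
have := Vmono _ _ (lexx _) (grid_ge0 T0 n i) (grid_leT T0 (ltnW (ltn_ord i))).
have := Vmono _ _ (grid_ge0 T0 n i.+1) (grid_leT T0 (ltn_ord i)) (lexx _).
by rewrite V00; lra.
Qed.

End path.
End energy_paths.

(** * Energy inequality *)

Section energy.
Context (R : realType) (T gamma : R) (disp : measure_display)
  (Omega : measurableType disp) (P : probability Omega R).
Hypotheses (T0 : 0 < T) (g0 : 0 <= gamma).
Notation mu := (@lebesgue_measure R).
Local Notation grid := (grid T).
Local Notation e := (fun t : R => expR (gamma * t)).

(** [z] stands for the squared norm of the integrand of [M]; [S] and [G] dominate the paths of [U]
    and the integral of [|f|]; [B] bounds the reflection sums asymptotically and is all that is
    retained of the Skorokhod conditions. *)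
Variables (U f z K K' M : R -> Omega -> R) (S G B : Omega -> R).
Hypothesis cU : forall w, {within `[0, T], continuous (U^~ w)}.
Hypothesis mU : forall t, t \in `[0, T] -> measurable_fun setT (U t).
Hypothesis US : forall t w, t \in `[0, T] -> `|U t w| <= S w.
Hypothesis sS : sqint P S.
Hypothesis fi : forall w, mu.-integrable `[0, T] (EFin \o (f^~ w)).
Hypothesis fG : forall w, \int[mu]_(r in `]0, T]) `|f r w| <= G w.
Hypothesis sG : sqint P G.
Hypothesis cK : forall w, {within `[0, T], continuous (K^~ w)}.
Hypothesis cK' : forall w, {within `[0, T], continuous (K'^~ w)}.
Hypothesis ndK : forall w s t, 0 <= s -> s <= t -> t <= T -> K s w <= K t w.
Hypothesis ndK' : forall w s t, 0 <= s -> s <= t -> t <= T -> K' s w <= K' t w.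
Hypothesis K0 : forall w, K 0 w = 0.
Hypothesis K'0 : forall w, K' 0 w = 0.
Hypothesis mK : forall t, t \in `[0, T] -> measurable_fun setT (K t).
Hypothesis mK' : forall t, t \in `[0, T] -> measurable_fun setT (K' t).
Hypothesis sK : sqint P (K T).
Hypothesis sK' : sqint P (K' T).
Hypothesis sM : forall s t, 0 <= s -> s <= t -> t <= T ->
  sqint P (fun w => M t w - M s w).
Hypothesis oM : forall s t, 0 <= s -> s <= t -> t <= T ->
  \int[P]_w (U s w * (M t w - M s w)) = 0.
Hypothesis z0 : forall r w, 0 <= z r w.
Hypothesis zi : forall w, mu.-integrable `]0, T] (EFin \o (z^~ w)).
Hypothesis zint : forall s t, 0 <= s -> s <= t -> t <= T ->
  rint P (fun w => \int[mu]_(r in `]s, t]) z r w).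
Hypothesis iM : forall s t, 0 <= s -> s <= t -> t <= T ->
  \int[P]_w ((M t w - M s w) ^+ 2) = \int[P]_w (\int[mu]_(r in `]s, t]) z r w).
Hypothesis iQ : rint P (fun w => \int[mu]_(r in `]0, T]) (e r * z r w)).
Hypothesis UE : forall w s t, 0 <= s -> s <= t -> t <= T ->
  U t w - U s w = - (\int[mu]_(r in `]s, t]) f r w) - (K t w - K s w)
    + (K' t w - K' s w) + (M t w - M s w).
Hypothesis iB : rint P B.
Hypothesis hB : forall w eps, 0 < eps -> \forall n \near \oo,
  \sum_(i < n.+1) e (grid n i) * U (grid n i) w *
    (K (grid n i.+1) w - K (grid n i) w - (K' (grid n i.+1) w - K' (grid n i) w))
  <= B w + eps.

Let U2 t : t \in `[0, T] -> sqint P (U t).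
Proof. by move=> tT; apply: sqint_le sS => [|w]; [exact: mU|exact: US]. Qed.

Let gt n i : (i <= n.+1)%N -> grid n i \in `[0, T].
Proof. exact: grid_itv. Qed.

Let Fi n i w := \int[mu]_(r in `]grid n i, grid n i.+1]) f r w.
Let dK n i w := K (grid n i.+1) w - K (grid n i) w - (K' (grid n i.+1) w - K' (grid n i) w).
Let dM n i w := M (grid n i.+1) w - M (grid n i) w.

Let UEi n i w : (i < n.+1)%N ->
  U (grid n i.+1) w - U (grid n i) w = - Fi n i w - dK n i w + dM n i w.
Proof.
move=> ni; rewrite UE//; last exact: grid_leT.
- by rewrite /Fi /dK /dM; ring.
- exact: grid_ge0.
- exact: grid_le.
Qed.

Let mdM n i : (i < n.+1)%N -> sqint P (dM n i).
Proof.
by move=> ni; apply: sM; [exact: grid_ge0|exact: grid_le|exact: grid_leT].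
Qed.

Let mdK n i : (i < n.+1)%N -> measurable_fun setT (dK n i).
Proof.
move=> ni; have h1 := gt ni; have h0 := gt (ltnW ni : (i <= n.+1)%N).
by apply: measurable_funB; apply: measurable_funB; [exact: mK|exact: mK|exact: mK'|exact: mK'].
Qed.

(** Measurability in the outcome is read off the equation for [U], since [f] is only given path by
    path. *)
Let mFi n i : (i < n.+1)%N -> measurable_fun setT (Fi n i).
Proof.
move=> ni; have h1 := gt ni; have h0 := gt (ltnW ni : (i <= n.+1)%N).
rewrite (_ : Fi n i = fun w => dM n i w - dK n i w - (U (grid n i.+1) w - U (grid n i) w)).
  apply: measurable_funB; first exact: measurable_funB (mdM ni).1 (mdK ni).
  by apply: measurable_funB; exact: mU.
by apply/funext => w; rewrite UEi//; ring.
Qed.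

Let Rn n w := drift_sum T gamma (U^~ w) (f^~ w) n.
Let Vn n w := variation_sum T gamma (f^~ w) (K^~ w) (K'^~ w) n.
Let Bn n w := \sum_(i < n.+1) e (grid n i) * U (grid n i) w * dK n i w.
(** The excess of the reflection sum over its bound. The sum itself need not converge, but its
    excess tends to 0 and is dominated. *)
Let Pn n w := Num.max 0 (Bn n w - B w).
Let Mn n w := \sum_(i < n.+1) e (grid n i) * U (grid n i) w * dM n i w.
Let Nn n w := \sum_(i < n.+1) e (grid n i) * dM n i w ^+ 2.

Definition energy_drift w := drift_integral T gamma (U^~ w) (f^~ w).

Let mUg n i : (i <= n.+1)%N -> measurable_fun setT (U (grid n i)).
Proof. by move=> ni; apply: mU; exact: gt. Qed.

Let mRn n : measurable_fun setT (Rn n).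
Proof.
apply: measurable_funB.
  apply: measurable_sum => i; apply: measurable_funM => //.
  exact: measurable_funX (mUg (ltn_ord i)).
apply: measurable_funM => //; apply: measurable_sum => i.
apply: measurable_funM; last exact: mFi.
by apply: measurable_funM => //; apply: mUg; exact: ltnW.
Qed.

Let mVn n : measurable_fun setT (Vn n).
Proof.
apply: measurable_sum => i; apply: measurable_funM => //; apply: measurable_funX.
by apply: measurable_funD; [exact: mFi|exact: mdK].
Qed.

Let mBn n : measurable_fun setT (Bn n).
Proof.
apply: measurable_sum => i; apply: measurable_funM; last exact: mdK.
by apply: measurable_funM => //; apply: mUg; exact: ltnW.
Qed.

Let S0 w : 0 <= S w.
Proof. by apply: le_trans (normr_ge0 _) (US (t := 0) w _); rewrite in_itv/= lexx ltW. Qed.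

Let Rn_lim : rint P energy_drift /\
  \int[P]_w Rn n w @[n --> \oo] --> \int[P]_w energy_drift w.
Proof.
apply: (rint_dominated (G := fun w => e T * S w ^+ 2 + 2 * (e T * S w * G w))) => //.
- move=> w; exact: (drift_sum_cvg T0 (@cU w) (fi w)).
- move=> n w; apply: (drift_sum_bound T0 g0 (fi w)) => // t tT; exact: US.
- apply: rintD; first exact: rintZ sS.2.
  apply: rintZ; under eq_fun do rewrite -mulrA.
  by apply: rintZ; exact: sqint_mul.
Qed.

Let rint_Rn n : rint P (Rn n).
Proof.
apply: (rint_le (Y := fun w => e T * S w ^+ 2 + 2 * (e T * S w * G w))) => //.
- move=> w; apply: (drift_sum_bound T0 g0 (fi w)) => // t tT; exact: US.
- apply: rintD; first exact: rintZ sS.2.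
  apply: rintZ; under eq_fun do rewrite -mulrA.
  by apply: rintZ; exact: sqint_mul.
Qed.

Let VG w := e T * (G w + (K T w + K' T w)) ^+ 2.

Let iVG : rint P VG.
Proof.
by apply: rintZ; apply: (_ : sqint P _).2; apply: sqintD => //; exact: sqintD.
Qed.

Let VnG n w : `|Vn n w| <= VG w.
Proof. exact: (variation_sum_bound T0 g0 (fi w) (ndK w) (ndK' w)). Qed.

Let Vn_lim : \int[P]_w Vn n w @[n --> \oo] --> (0 : R).
Proof.
have cVn w : Vn n w @[n --> \oo] --> (0 : R).
  exact: (variation_sum_cvg T0 g0 (fi w) (@cK w) (@cK' w) (ndK w) (ndK' w)).
have [_] := rint_dominated (X := fun=> 0) mVn cVn VnG iVG.
by rewrite Rintegral_cst// mul0r.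
Qed.

Let BG w := e T * (S w * (K T w + K' T w)) + `|B w|.

Let iBG : rint P BG.
Proof.
apply: rintD; last exact: rint_norm.
by apply: rintZ; apply: sqint_mul => //; exact: sqintD.
Qed.

Let BnG n w : `|Bn n w| <= e T * (S w * (K T w + K' T w)).
Proof.
have KS (H : R -> R) : H 0 = 0 -> H T = \sum_(i < n.+1) (H (grid n i.+1) - H (grid n i)).
  move=> H0; rewrite -(big_mkord xpredT (fun i => H (grid n i.+1) - H (grid n i))).
  by rewrite (telescope_sumr (fun i => H (grid n i)))// gridT grid0 H0 subr0.
rewrite (KS (K^~ w) (K0 w)) (KS (K'^~ w) (K'0 w)) -big_split/= mulrA mulr_sumr.
apply: (le_trans (ler_norm_sum _ _ _)); apply: ler_sum => i _.
have h0 := grid_ge0 T0 n i; have h1 := grid_le T0 n (leqnSn i).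
have h2 := grid_leT T0 (ltn_ord i).
have k1 := ndK w h0 h1 h2; have k2 := ndK' w h0 h1 h2.
rewrite !normrM; apply: ler_pM => //.
  apply: ler_pM => //; first by rewrite ger0_norm ?expR_ge0// expR_homo// (le_trans h1).
  by apply: US; apply: gt; exact: ltnW.
by rewrite /dK ler_norml; lra.
Qed.

Let PnG n w : `|Pn n w| <= BG w.
Proof.
have := BnG n w; have := normr_ge0 (Bn n w); have := normr_ge0 (B w).
rewrite /BG /Pn => h1 h2 h3.
rewrite ger0_norm ?le_max ?lexx// ge_max; apply/andP; split; first lra.
have := ler_norm (Bn n w); have := ler_norm (- B w); rewrite normrN; lra.
Qed.

Let mPn n : measurable_fun setT (Pn n).
Proof.
apply: measurable_maxr => //; apply: measurable_funB => //.
exact: rint_measurable iB.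
Qed.

Let rint_Pn n : rint P (Pn n). Proof. exact: rint_le (mPn n) (PnG n) iBG. Qed.

Let Pn_lim : \int[P]_w Pn n w @[n --> \oo] --> (0 : R).
Proof.
have cPn w : Pn n w @[n --> \oo] --> (0 : R).
  apply/cvgr0Pnorm_le => eps eps0.
  have := hB w eps0; apply: filterS => n h.
  by rewrite ger0_norm ?le_max ?lexx// ge_max (ltW eps0)/= lerBlDl.
have [_] := rint_dominated (X := fun=> 0) mPn cPn PnG iBG.
by rewrite Rintegral_cst// mul0r.
Qed.

Let sUg n i : (i <= n.+1)%N -> sqint P (U (grid n i)).
Proof. by move=> ni; apply: U2; exact: gt. Qed.

Let rint_Mn n : rint P (Mn n) /\ \int[P]_w Mn n w = 0.
Proof.
have iT (i : 'I_n.+1) : rint P (fun w => e (grid n i) * U (grid n i) w * dM n i w).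
  under eq_fun do rewrite -mulrA.
  apply: rintZ; apply: sqint_mul; first by apply: sUg; exact: ltnW.
  exact: mdM.
split; first exact: rint_sum.
rewrite Rintegral_sum// big1// => i _.
under eq_Rintegral do rewrite -mulrA.
rewrite RintegralZl//; last first.
  apply: sqint_mul; first by apply: sUg; exact: ltnW.
  exact: mdM.
rewrite oM ?mulr0//; [exact: grid_ge0|exact: grid_le|exact: grid_leT].
Qed.

Let Qz w := \int[mu]_(r in `]0, T]) (e r * z r w).

(** The isometry applies cell by cell with the weight frozen at the left endpoint. Freezing loses at
    most the factor [expR (- (gamma * (T / n.+1%:R)))], which tends to 1. *)
Let rint_Nn n : rint P (Nn n) /\
  expR (- (gamma * (T / n.+1%:R))) * \int[P]_w Qz w <= \int[P]_w Nn n w.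
Proof.
have iT (i : 'I_n.+1) : rint P (fun w => e (grid n i) * dM n i w ^+ 2).
  by apply: rintZ; exact: (mdM (ltn_ord i)).2.
split; first exact: rint_sum.
rewrite Rintegral_sum//.
have zig (i : 'I_n.+1) : rint P (fun w => \int[mu]_(r in `]grid n i, grid n i.+1]) z r w).
  by apply: zint; [exact: grid_ge0|exact: grid_le|exact: grid_leT].
rewrite [leRHS](_ : _ = \int[P]_w (\sum_(i < n.+1)
    e (grid n i) * \int[mu]_(r in `]grid n i, grid n i.+1]) z r w)); last first.
  rewrite Rintegral_sum => [|i]; last exact: rintZ.
  apply: eq_bigr => i _; rewrite RintegralZl; [|by []|exact: (mdM (ltn_ord i)).2].
  rewrite RintegralZl; [|by []|exact: zig].
  by congr (_ * _); apply: iM; [exact: grid_ge0|exact: grid_le|exact: grid_leT].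
rewrite [leLHS](_ : _ = \int[P]_w (expR (- (gamma * (T / n.+1%:R))) * Qz w)); last first.
  by rewrite RintegralZl.
apply: le_Rint.
- exact: rintZ.
- by apply: rint_sum => i; exact: rintZ.
move=> w.
have ez : mu.-integrable `]0, T] (EFin \o (fun r => e r * z r w)).
  apply: integrable_continuousM => //.
  by apply: continuous_subspaceT => x; exact: continuous_expRM.
have := Rintegral_grid T0 (leqnn n.+1) ez; rewrite gridT /Qz => ->.
rewrite mulr_sumr; apply: ler_sum => i _.
have iS (h : R -> R) : mu.-integrable `]0, T] (EFin \o h) ->
    mu.-integrable `]grid n i, grid n i.+1] (EFin \o h).
  by move=> ih; apply: integrableS ih => //; exact: grid_subset.
have iZ (c : R) (h : R -> R) : mu.-integrable `]0, T] (EFin \o h) ->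
    mu.-integrable `]grid n i, grid n i.+1] (EFin \o (fun r => c * h r)).
  move=> ih; rewrite (_ : EFin \o _ = (fun r => c%:E * (h r)%:E)%E)//.
  by apply: integrableZl => //; exact: iS.
rewrite -!RintegralZl//; [|exact: iS|exact: iS].
apply: le_Rintegral => //; [exact: iZ|exact: iZ|].
move=> r; rewrite /= in_itv/= => /andP[r1 r2].
rewrite mulrA ler_wpM2r// -expRD ler_expR -mulrN -mulrDr ler_wpM2l//.
by rewrite addrC lerBlDr -(grid_step T n i) addrC subrK.
Qed.

Lemma energy_estimate : rint P energy_drift /\
  \int[P]_w (U 0 w ^+ 2) + \int[P]_w energy_drift w + 3 / 4 * \int[P]_w Qz w
  <= e T * \int[P]_w (U T w ^+ 2) + 2 * \int[P]_w B w.
Proof.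
have [iPsi cR] := Rn_lim; split => //.
have tT : T \in `[0, T] by rewrite in_itv/= lexx ltW.
have t0 : 0 \in `[0, T] by rewrite in_itv/= lexx ltW.
pose C := e T * \int[P]_w (U T w ^+ 2) - \int[P]_w (U 0 w ^+ 2) + 2 * \int[P]_w B w.
(* What the expected discrete inequality leaves on its left-hand side: the martingale sum has mean
   zero, [Nn] is replaced by its lower bound, and every remaining term converges. *)
pose x n := \int[P]_w Rn n w - 2 * \int[P]_w Pn n w - 3 * \int[P]_w Vn n w
  + 3 / 4 * (expR (- (gamma * (T / n.+1%:R))) * \int[P]_w Qz w).
have xC n : x n <= C.
  have rVn : rint P (Vn n) by exact: rint_le (mVn n) (VnG n) iVG.
  have [rMn eMn] := rint_Mn n; have [rNn eNn] := rint_Nn n.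
  have U2T := (U2 tT).2; have U20 := (U2 t0).2.
  have : \int[P]_w (Rn n w - 2 * Pn n w - 3 * Vn n w + 3 / 4 * Nn n w + 2 * Mn n w) <=
      \int[P]_w (e T * U T w ^+ 2 - U 0 w ^+ 2 + 2 * B w).
    apply: le_Rint.
    - by apply: rintD; [apply: rintD; [do 2 (apply: rintB; last exact: rintZ)|exact: rintZ]|exact: rintZ].
    - by apply: rintD; [apply: rintB => //; exact: rintZ|exact: rintZ].
    move=> w.
    have := discrete_energy (e := fun i => e (grid n i)) (u := fun i => U (grid n i) w)
      (f := Fi n ^~ w) (c := dK n ^~ w) (dm := dM n ^~ w) (m := n.+1)
      (fun i => expR_ge0 _) (fun i ni => UEi w ni).
    rewrite gridT grid0 mulr0 expR0 mul1r.
    have : Bn n w - B w <= Pn n w by rewrite le_max lexx orbT.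
    rewrite /Rn /drift_sum /Vn /variation_sum /Bn /Mn /Nn /dK /Fi /=; lra.
  have j1 := rintZ 2 (rint_Pn n); have j2 := rintB (rint_Rn n) j1.
  have j3 := rintZ 3 rVn; have j4 := rintB j2 j3.
  have j5 := rintZ (3 / 4) rNn; have j6 := rintD j4 j5; have j7 := rintZ 2 rMn.
  rewrite (RintegralD measurableT j6 j7) (RintegralD measurableT j4 j5).
  rewrite (RintegralB measurableT j2 j3) (RintegralB measurableT (rint_Rn n) j1).
  rewrite (RintegralZl 2 measurableT rMn) (RintegralZl _ measurableT rNn).
  rewrite (RintegralZl _ measurableT rVn) (RintegralZl _ measurableT (rint_Pn n)) eMn => h.
  have eR : \int[P]_w (e T * U T w ^+ 2 - U 0 w ^+ 2 + 2 * B w) = C.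
    have i1 : rint P (fun w => e T * U T w ^+ 2) by exact: rintZ.
    have i2 : rint P (fun w => e T * U T w ^+ 2 - U 0 w ^+ 2) by exact: rintB.
    by rewrite (RintegralD measurableT i2 (rintZ 2 iB)) (RintegralB measurableT i1 U20) !RintegralZl.
  by move: h; rewrite eR /x; lra.
have cx : x n @[n --> \oo] --> \int[P]_w energy_drift w - 2 * 0 - 3 * 0 + 3 / 4 * (1 * \int[P]_w Qz w).
  apply: cvgD; first (apply: cvgB; [apply: cvgB => //|]); try exact: cvgMr.
  apply: cvgMr; apply: cvgMl.
  rewrite -[X in _ --> X]expR0; apply: continuous_cvg; first exact: continuous_expR.
  rewrite -[X in _ --> X]oppr0; apply: cvgN.
  rewrite -[X in _ --> X](mulr0 gamma); apply: cvgMr.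
  rewrite -[X in _ --> X](mulr0 T); apply: cvgMr.
  exact: cvg_harmonic.
have : limn x <= C by apply: limr_le; [apply/cvg_ex; eexists; exact: cx|exact: nearW].
by rewrite (cvg_lim _ cx)// /C; lra.
Qed.

End energy.

(** * Square-integrable processes *)

Section joint_measurability_more.
Context (R : realType) (T : R) (disp : measure_display)
  (Omega : measurableType disp) (P : probability Omega R).
Notation mu := (@lebesgue_measure R).
Implicit Types f : R -> Omega -> R.

Section on_domain.
Variable D : set (measurableTypeR R).
Hypotheses (mD : measurable D) (DT : D `<=` `[0, T]).

Lemma jmeas_Rintegral f : jmeas T f ->
  measurable_fun setT (fun w => \int[mu]_(r in D) f r w).
Proof.
move=> mf; pose fp r w := Num.max (f r w) 0; pose fn r w := Num.max (- f r w) 0.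
have m0 : jmeas T (fun (_ : R) (_ : Omega) => (0 : R)) by exact: jmeas_cst.
have mfp : jmeas T fp by apply: measurable_maxr.
have mfn : jmeas T fn.
  by apply: measurable_maxr => //; exact: (measurableT_comp (@oppr_measurable R setT) mf).
have fp0 r w : 0 <= fp r w by rewrite le_max lexx orbT.
have fn0 r w : 0 <= fn r w by rewrite le_max lexx orbT.
have H1 := iterint_measurable mD DT mfp fp0.
have H2 := iterint_measurable mD DT mfn fn0.
have := emeasurable_funB H1 H2 => H.
have := measurableT_comp (@fine_measurable R setT measurableT) H.
apply: eq_measurable_fun => w _ /=.
rewrite /Rintegral [in RHS]integralE; congr (fine (_ - _)%E).
- by apply: eq_integral => r _; rewrite /fp funeposE /= EFin_max.
- by apply: eq_integral => r _; rewrite /fn funenegE /= EFin_max.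
Qed.

Lemma rint_Rintegral f : jmeas T f -> (forall r w, 0 <= f r w) ->
  (forall w, mu.-integrable D (EFin \o (f^~ w))) ->
  (\int[P]_w \int[mu]_(r in D) (f r w)%:E < +oo)%E ->
  rint P (fun w => \int[mu]_(r in D) f r w).
Proof.
move=> mf f0 fi foo; apply: rint_ge0.
- exact: jmeas_Rintegral.
- by move=> w; exact: Rintegral_ge0.
- apply: le_lt_trans foo; rewrite le_eqVlt; apply/orP; left; apply/eqP.
  by apply: eq_integral => w _; rewrite /Rintegral fineK//; apply: integrable_fin_num (fi w).
Qed.

Lemma iterint_Rintegral f : (forall w, mu.-integrable D (EFin \o (f^~ w))) ->
  rint P (fun w => \int[mu]_(r in D) f r w) ->
  (\int[P]_w \int[mu]_(r in D) (f r w)%:E = (\int[P]_w (\int[mu]_(r in D) f r w))%:E)%E.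
Proof.
move=> fi ri; rewrite -integral_rint//.
by apply: eq_integral => w _; rewrite /Rintegral fineK//; apply: integrable_fin_num (fi w).
Qed.

End on_domain.

Hypothesis T0 : 0 < T.
Local Notation grid := (grid T).

Lemma grid_bracket n r : 0 < r -> r <= T ->
  exists2 i : 'I_n.+1, grid n i < r & r <= grid n i.+1.
Proof.
move=> r0 rT.
have ex : exists k, (k <= n.+1)%N && (r <= grid n k) by exists n.+1; rewrite leqnn gridT.
have [k /andP[kn rk] kmin] := ex_minnP ex.
case: k kn rk kmin => [|k] kn rk kmin; first by move: rk; rewrite grid0 leNgt r0.
exists (Ordinal kn) => //=; rewrite ltNge; apply/negP => rk'.
by have := kmin k; rewrite rk' (ltnW kn) ltnn => /(_ isT).
Qed.

(** A continuous process is the pointwise limit of its left-endpoint step approximations. Time 0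
    lies in no half-open cell and gets an indicator of its own. *)
Lemma jmeas_continuous (X : R -> Omega -> R) :
  (forall t, t \in `[0, T] -> measurable_fun setT (X t)) ->
  (forall w, {within `[0, T], continuous (X^~ w)}) -> jmeas T X.
Proof.
move=> mX cX.
pose Xn n r w := \1_[set 0] r * X 0 w +
  \sum_(i < n.+1) \1_`]grid n i, grid n i.+1] r * X (grid n i) w.
have mXn n : jmeas T (Xn n).
  apply: jmeasD.
    apply: jmeasM; first by apply: jmeas_time; exact: measurable_indic.
    by apply: jmeas_rv; apply: mX; rewrite in_itv/= lexx ltW.
  apply: jmeas_sum => i; apply: jmeasM.
    by apply: jmeas_time; exact: measurable_indic.
  by apply: jmeas_rv; apply: mX; apply: grid_itv => //; exact: ltnW.
apply: (measurable_fun_cvg (h := fun n (p : R * Omega) => Xn n p.1 p.2)) => //.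
move=> [r w] [/= rT _].
move: (rT); rewrite /= in_itv/= le_eqVlt => /andP[/predU1P[<-|r0] rT'].
  apply: cvg_near_cst; apply: nearW => n.
  rewrite /Xn indicE mem_set// mul1r big1 ?addr0// => i _.
  by rewrite indicE memNset ?mul0r//= in_itv/= ltNge (grid_ge0 T0).
apply/cvgrPdist_le => eps eps0.
apply: filterS (uniform_continuity T0 eps0 (cX w)) => n H.
have [i ri1 ri2] := grid_bracket n r0 rT'.
have -> : Xn n r w = X (grid n i) w.
  rewrite /Xn indicE memNset ?mul0r ?add0r; last by move=> /= r00; move: r0; rewrite r00 ltxx.
  rewrite (bigD1 i)//= indicE mem_set ?mul1r; last by rewrite /= in_itv/= ri1.
  rewrite big1 ?addr0// => j ji; rewrite indicE memNset ?mul0r//= in_itv/= => /andP[rj1 rj2].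
  have : (i < j)%N || (j < i)%N by rewrite -neq_ltn eq_sym.
  move=> /orP[ij|ij].
    by have := le_trans ri2 (grid_le T0 n ij); rewrite leNgt rj1.
  by have := le_trans rj2 (grid_le T0 n ij); rewrite leNgt ri1.
apply: H => //; first by apply: grid_itv => //; exact: ltnW.
rewrite -(grid_step T n i) ger0_norm ?subr_ge0 ?(ltW ri1)// lerD2r//.
Qed.

Definition path_sup (X : R -> Omega -> R) (w : Omega) : R :=
  Num.sqrt (fine (path_sup2 T X w)).

(** By continuity the supremum is the limit of the maxima over the uniform grids, which makes it
    measurable although it runs over uncountably many times. *)
Lemma path_sup_facts (X : R -> Omega -> R) :
  (forall t, t \in `[0, T] -> measurable_fun setT (X t)) ->
  (forall w, {within `[0, T], continuous (X^~ w)}) ->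
  [/\ measurable_fun setT (path_sup X),
      forall t w, t \in `[0, T] -> `|X t w| <= path_sup X w &
      forall w, path_sup2 T X w = (path_sup X w ^+ 2)%:E].
Proof.
move=> mX cX.
have t00 : 0 \in `[0, T] by rewrite in_itv/= lexx ltW.
have ub w t : t \in `[0, T] -> ((`|X t w| ^+ 2)%:E <= path_sup2 T X w)%E.
  by move=> tT; apply: ereal_sup_ubound; exists t.
have fin w : path_sup2 T X w \is a fin_num.
  have [M M0 HM] := continuous_bounded (cX w).
  rewrite ge0_fin_numE; last by apply: le_trans (ub w 0 t00); rewrite lee_fin sqr_ge0.
  apply: (@le_lt_trans _ _ (M ^+ 2)%:E); last exact: ltry.
  apply: ge_ereal_sup => _ [t tT <-]; rewrite lee_fin lerXn2r// ?nnegrE//.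
  exact: HM.
pose s w := fine (path_sup2 T X w).
have sE w : path_sup2 T X w = (s w)%:E by rewrite /s fineK.
have ubs w t : t \in `[0, T] -> `|X t w| ^+ 2 <= s w.
  by move=> tT; rewrite -lee_fin -sE; exact: ub.
have s0 w : 0 <= s w by apply: le_trans (ubs w 0 t00); exact: sqr_ge0.
have E2 w : path_sup X w ^+ 2 = s w by exact: sqr_sqrtr (s0 w).
split.
- have msqrt : measurable_fun setT (Num.sqrt : R -> R).
    by apply: continuous_measurable_fun => x; exact: sqrt_continuous.
  suff : measurable_fun setT s by exact: measurableT_comp.
  pose a n w := \big[Num.max/0]_(i < n.+2) `|X (grid n i) w| ^+ 2.
  have ma n : measurable_fun setT (a n).
    rewrite /a; elim: (index_enum _) => [|i r IH].
      by under eq_fun do rewrite big_nil; exact: measurable_cst.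
    under eq_fun do rewrite big_cons.
    apply: measurable_maxr => //; apply: measurable_funX; apply: measurableT_comp => //.
    by apply: mX; apply: grid_itv => //; rewrite -ltnS.
  apply: (measurable_fun_cvg (h := a)) => // w _.
  apply/cvgrPdist_le => eps eps0.
  have [M M0 HM] := continuous_bounded (cX w).
  (* The squares are compared through x^2 - y^2 = (x - y)(x + y) with x + y at most 2 M; the added 1
     covers [M] = 0. *)
  have M1 : 0 < 2 * (2 * M + 1) by rewrite mulr_gt0// ltr_wpDl// mulr_ge0.
  have eps2 : 0 < eps / (2 * (2 * M + 1)) by rewrite divr_gt0.
  apply: filterS (uniform_continuity T0 eps2 (cX w)) => n H.
  have as_ : a n w <= s w.
    apply: bigmax_le => // i _; apply: ubs; apply: grid_itv => //.
    by rewrite -ltnS.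
  rewrite ger0_norm ?subr_ge0// lerBlDr -lee_fin -sE.
  apply: ge_ereal_sup => _ [t tT <-]; rewrite lee_fin.
  have [i [ti1 ti2]] : exists i : 'I_n.+2, grid n i <= t /\ t - grid n i <= T / n.+1%:R.
    move: (tT); rewrite /= in_itv/= le_eqVlt => /andP[/predU1P[<-|t0] tT'].
      by exists ord0; rewrite grid0 subr0 lexx divr_ge0// ltW.
    have [i ti1 ti2] := grid_bracket n t0 tT'.
    exists (widen_ord (leqnSn _) i) => /=; split; first exact: ltW.
    by rewrite -(grid_step T n i) lerD2r.
  have giT : grid n i \in `[0, T] by apply: grid_itv => //; rewrite -ltnS.
  apply: (@le_trans _ _ (eps + `|X (grid n i) w| ^+ 2)); last first.
    by rewrite lerD2l; apply: (@le_bigmax _ _ _ _ (fun i : 'I_n.+2 => `|X (grid n i) w| ^+ 2)).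
  have h := H t (grid n i) tT giT.
  rewrite ger0_norm ?subr_ge0// in h; have {}h := h ti2.
  have h1 := HM t tT; have h2 := HM _ giT.
  set x := `|X t w| in h1 *; set y := `|X (grid n i) w| in h2 *.
  have ab : x - y <= eps / (2 * (2 * M + 1)) by apply: le_trans h; exact: lerB_dist.
  have : (x - y) * (x + y) <= eps / (2 * (2 * M + 1)) * (2 * M).
    apply: (@le_trans _ _ (eps / (2 * (2 * M + 1)) * (x + y))).
      by apply: ler_wpM2r ab; rewrite addr_ge0 /x /y.
    by rewrite ler_pM2l// mulr_natl mulr2n lerD.
  have : eps / (2 * (2 * M + 1)) * (2 * M) <= eps.
    rewrite -mulrA ler_piMr ?(ltW eps0)// mulrC ler_pdivrMr// mul1r.
    lra.
  have -> : (x - y) * (x + y) = x ^+ 2 - y ^+ 2 by ring.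
  lra.
- move=> t w tT; rewrite -(@ler_pXn2r _ 2)// ?nnegrE ?sqrtr_ge0//.
  by rewrite E2; exact: ubs.
- by move=> w; rewrite sE E2.
Qed.

End joint_measurability_more.

(** Completeness passes measurability on to almost everywhere equal functions. This relates the
    integrals of the claim, whose integrands are not cut off, to those of the proof. *)
Lemma complete_integral_ae_eq d (T : measurableType d) (R : realType)
    (P : probability T R) (f g : T -> \bar R) : measure_is_complete P ->
  measurable_fun setT f -> {ae P, forall w, f w = g w} ->
  measurable_fun setT g /\ (\int[P]_w g w = \int[P]_w f w)%E.
Proof.
move=> cP mf fg.
have fg' : ae_eq P setT f g by apply: filterS fg => w.
have mg : measurable_fun setT g by exact: (ae_measurable_fun cP fg').
by split => //; apply: ae_eq_integral => //; apply: ae_eq_sym.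
Qed.

Lemma measurable_pair_on d d1 d2 (X : measurableType d) (X1 : measurableType d1)
    (X2 : measurableType d2) (D : set X) (f : X -> X1) (g : X -> X2) :
  measurable D -> measurable_fun D f -> measurable_fun D g ->
  measurable_fun D (fun x => (f x, g x)).
Proof.
move=> mD mf mg; apply: (measurability _ (measurable_prod_measurableType _ _)).
move=> _ [_ [A mA [C mC <-]] <-].
rewrite (_ : _ `&` _ = (D `&` f @^-1` A) `&` (D `&` g @^-1` C)).
  by apply: measurableI; [exact: mf|exact: mg].
by rewrite setIACA setIid; congr (_ `&` _).
Qed.

Section square_integrable_processes.
Context (R : realType) (T : R) (disp : measure_display)
  (Omega : measurableType disp) (P : probability Omega R).
Hypothesis T0 : 0 < T.
Notation mu := (@lebesgue_measure R).
Implicit Types f g : R -> Omega -> R.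

(** Square integrability is demanded on every path, so that time integrals are real numbers without
    exceptional sets; cutting off makes this available. *)
Definition l2p f := [/\ jmeas T f,
  forall w, mu.-integrable `[0, T] (EFin \o (fun r => f r w ^+ 2)) &
  rint P (fun w => \int[mu]_(r in `]0, T]) (f r w ^+ 2))].

Let m0T : measurable (`[0, T]%classic : set (measurableTypeR R)).
Proof. exact: measurable_itv. Qed.

Let moT : measurable (`]0, T]%classic : set (measurableTypeR R)).
Proof. exact: measurable_itv. Qed.

Let sub0T : (`]0, T]%classic : set R) `<=` `[0, T].
Proof. by apply: subset_itvr; rewrite bnd_simp. Qed.

Lemma l2p_itvoc f w : l2p f -> mu.-integrable `]0, T] (EFin \o (fun r => f r w ^+ 2)).
Proof. by move=> [_ /(_ w) fi _]; exact: integrableS fi. Qed.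

Lemma l2p_le f g : jmeas T f ->
  (forall r w, r \in `[0, T] -> `|f r w| <= `|g r w|) -> l2p g -> l2p f.
Proof.
move=> mf fg lg; have [mg ig rg] := lg.
have fg2 r w : r \in `[0, T] -> f r w ^+ 2 <= g r w ^+ 2.
  by move=> rT; rewrite -[leLHS]real_normK ?num_real// -[leRHS]real_normK ?num_real// lerXn2r// ?nnegrE// fg.
have fi w : mu.-integrable `[0, T] (EFin \o (fun r => f r w ^+ 2)).
  apply: (le_integrable m0T _ _ (ig w)).
    by apply/measurable_EFinP; exact: jmeas_section (jmeasX 2 mf).
  move=> r rT; rewrite /= lee_fin !ger0_norm ?sqr_ge0//.
  by apply: fg2; rewrite inE in rT *.
split => //; apply: rint_le rg.
  by apply: (jmeas_Rintegral moT sub0T); exact: jmeasX.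
move=> w; rewrite ger0_norm; last by apply: Rintegral_ge0 => r _; exact: sqr_ge0.
apply: le_Rintegral => //; [exact: integrableS (fi w)|exact: integrableS (ig w)|].
by move=> r rT; apply: fg2; exact: sub0T.
Qed.

Lemma l2pZ c f : l2p f -> l2p (fun r w => c * f r w).
Proof.
move=> lf; have [mf fi rf] := lf; split.
- by apply: jmeasM => //; exact: jmeas_cst.
- move=> w; rewrite (_ : EFin \o _ = (fun r => (c ^+ 2)%:E * (f r w ^+ 2)%:E)%E).
    exact: (integrableZl m0T _ (fi w)).
  by apply/funext => r; rewrite /= exprMn EFinM.
- rewrite (_ : (fun w => _) = fun w => c ^+ 2 * \int[mu]_(r in `]0, T]) (f r w ^+ 2)).
    exact: rintZ.
  apply/funext => w; rewrite -(RintegralZl _ moT (l2p_itvoc w lf)).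
  by apply: eq_Rintegral => r _; rewrite exprMn.
Qed.

Lemma l2pD f g : l2p f -> l2p g -> l2p (fun r w => f r w + g r w).
Proof.
move=> lf lg; have [mf fi rf] := lf; have [mg gi rg] := lg.
have fgi w : mu.-integrable `[0, T] (EFin \o (fun r => 2 * (f r w ^+ 2 + g r w ^+ 2))).
  rewrite (_ : EFin \o _ = (fun r => 2%:E * ((f r w ^+ 2)%:E + (g r w ^+ 2)%:E))%E)//.
  exact: (integrableZl m0T _ (integrableD m0T (fi w) (gi w))).
have l2 r w : (f r w + g r w) ^+ 2 <= 2 * (f r w ^+ 2 + g r w ^+ 2).
  have := sqr_ge0 (f r w - g r w); lra.
have hi w : mu.-integrable `[0, T] (EFin \o (fun r => (f r w + g r w) ^+ 2)).
  apply: (le_integrable m0T _ _ (fgi w)).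
    by apply/measurable_EFinP; exact: jmeas_section (jmeasX 2 (jmeasD mf mg)).
  move=> r rT; rewrite /= lee_fin !ger0_norm ?sqr_ge0//.
  by rewrite mulr_ge0// addr_ge0// sqr_ge0.
split => //; first exact: jmeasD.
apply: (rint_le _ _ (rintZ 2 (rintD rf rg))).
  by apply: (jmeas_Rintegral moT sub0T); apply: jmeasX; exact: jmeasD.
move=> w; rewrite ger0_norm; last by apply: Rintegral_ge0 => r _; exact: sqr_ge0.
have i1 := l2p_itvoc w lf; have i2 := l2p_itvoc w lg.
rewrite -(RintegralD moT i1 i2) -(RintegralZl _ moT (integrableD moT i1 i2)).
by apply: le_Rintegral => //; [exact: integrableS (hi w)|exact: integrableS (fgi w)].
Qed.

Lemma l2p_rv S : sqint P S -> l2p (fun _ w => S w).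
Proof.
move=> [mS iS]; split; first exact: jmeas_rv.
- move=> w; apply: continuous_compact_integrable; first exact: segment_compact.
  by apply: continuous_subspaceT => r; exact: cvg_cst.
- rewrite (_ : (fun w => _) = fun w => T * S w ^+ 2); first exact: rintZ.
  apply/funext => w; rewrite Rintegral_cst//= lebesgue_measure_itv/= lte_fin T0.
  by rewrite sube0/= mulrC.
Qed.

Lemma l2p_integrable f w : l2p f -> mu.-integrable `[0, T] (EFin \o (f^~ w)).
Proof.
move=> [mf fi rf].
have i1 : mu.-integrable `[0, T] (EFin \o (fun _ : R => 1 : R)).
  apply: continuous_compact_integrable; first exact: segment_compact.
  by apply: continuous_subspaceT => r; exact: cvg_cst.
apply: (le_integrable m0T _ _ (integrableD m0T i1 (fi w))).
  by apply/measurable_EFinP; exact: jmeas_section.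
move=> r rT; rewrite /= lee_fin [leRHS]ger0_norm ?addr_ge0 ?sqr_ge0//.
rewrite -[f r w ^+ 2]real_normK ?num_real//.
have := sqr_ge0 (`|f r w| - 1); have := normr_ge0 (f r w); lra.
Qed.

Lemma l2p_norm f : l2p f -> l2p (fun r w => `|f r w|).
Proof.
by move=> lf; apply: l2p_le (lf); [have [mf _ _] := lf; exact: jmeas_norm|move=> r w _; rewrite normr_id].
Qed.

Lemma l2p_L1 f w : l2p f ->
  (\int[mu]_(r in `]0, T]) `|f r w|) ^+ 2 <= T * \int[mu]_(r in `]0, T]) (f r w ^+ 2).
Proof.
move=> lf; set I := \int[mu]_(r in `]0, T]) `|f r w|.
(* The time average of |f|: the inequality expresses that the variance of |f| in time is
   nonnegative. *)
pose m := I / T.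
have i1 : mu.-integrable `]0, T] (EFin \o (fun r => `|f r w|)).
  by apply: integrableS (l2p_integrable w (l2p_norm lf)).
have ic (c : R) : mu.-integrable `]0, T] (EFin \o (fun _ : R => c)).
  apply: (@integrableS _ _ _ mu `[0, T]) => //.
  apply: continuous_compact_integrable; first exact: segment_compact.
  by apply: continuous_subspaceT => r; exact: cvg_cst.
have i2 : mu.-integrable `]0, T] (EFin \o (fun r => 2 * m * `|f r w|)).
  rewrite (_ : EFin \o _ = (fun r => (2 * m)%:E * `|f r w|%:E)%E)//.
  exact: (integrableZl moT _ i1).
have : 0 <= \int[mu]_(r in `]0, T]) (f r w ^+ 2 - 2 * m * `|f r w| + m ^+ 2).
  apply: Rintegral_ge0 => r _; rewrite -[f r w ^+ 2]real_normK ?num_real//.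
  by have := sqr_ge0 (`|f r w| - m); lra.
have i3 := l2p_itvoc w lf.
rewrite (RintegralD moT (integrableB moT i3 i2) (ic _)) (RintegralB moT i3 i2).
rewrite (RintegralZl _ moT i1) Rintegral_cst//= lebesgue_measure_itv/= lte_fin T0 sube0/= -/I.
move=> h; rewrite mulrC -ler_pdivrMr//.
have mE : m * T = I by rewrite /m divfK// gt_eqF.
have -> : I ^+ 2 / T = m * I by rewrite /m expr2 mulrAC.
have mE2 : m ^+ 2 * T = m * I by rewrite expr2 -mulrA mE.
lra.
Qed.

Lemma l2p_sqint f : l2p f -> sqint P (fun w => \int[mu]_(r in `]0, T]) `|f r w|).
Proof.
move=> lf; have [mf fi rf] := lf; have mI := jmeas_Rintegral moT sub0T (jmeas_norm mf).
split => //; apply: (rint_le _ _ (rintZ T rf)); first exact: measurable_funX.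
by move=> w; rewrite ger0_norm ?sqr_ge0//; exact: l2p_L1.
Qed.

Lemma l2p_expR gamma f : 0 <= gamma -> l2p f ->
  (forall w, mu.-integrable `]0, T]
     (EFin \o (fun r => expR (gamma * r) * f r w ^+ 2))) /\
  rint P (fun w => \int[mu]_(r in `]0, T]) (expR (gamma * r) * f r w ^+ 2)).
Proof.
move=> g0 lf; have [mf fi rf] := lf.
have ei w : mu.-integrable `]0, T] (EFin \o (fun r => expR (gamma * r) * f r w ^+ 2)).
  apply: (integrable_continuousM _ (l2p_itvoc w lf)).
  exact/continuous_subspaceT/continuous_expRM.
split => //; apply: (rint_le _ _ (rintZ (expR (gamma * T)) rf)).
  apply: (jmeas_Rintegral moT sub0T); apply: jmeasM; last exact: jmeasX.
  by apply: jmeas_time; apply: continuous_measurable_fun; exact: continuous_expRM.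
move=> w; rewrite ger0_norm; last first.
  by apply: Rintegral_ge0 => r _; rewrite mulr_ge0 ?expR_ge0 ?sqr_ge0.
have i1 := l2p_itvoc w lf; rewrite -(RintegralZl _ moT i1).
apply: le_Rintegral => //; first exact: (integrableZl moT _ i1).
move=> r; rewrite /= in_itv/= => /andP[_ rT].
by rewrite ler_wpM2r ?sqr_ge0// ler_expR ler_wpM2l.
Qed.

End square_integrable_processes.

(** * Energy inequality for reflected processes *)

Lemma absorb_drift (R : realFieldType) (u0 D cU bh z x H : R) :
  cU - bh - 1 / 4 * z <= D -> u0 + D + 3 / 4 * z <= x + 2 * H ->
  u0 + cU + 1 / 2 * z <= x + bh + 2 * H.
Proof. lra. Qed.

Section reflected_energy.
Context (R : realType) (T : R) (d : nat) (disp : measure_display)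
  (Omega : measurableType disp) (P : probability Omega R)
  (W : R -> Omega -> 'rV[R]_d) (J : countType) (B : J -> R -> Omega -> 'rV[R]_d).
Hypothesis hN : noise_setting P T W B.
Hypothesis T0 : 0 < T.
Local Notation F := (brownian_filtration P T W B).
Local Notation fmeas := (fmeas T P W B).
Local Notation l2p := (l2p T P).
Local Notation grid := (grid T).
Notation mu := (@lebesgue_measure R).

Variable O : set Omega.
Hypotheses (mO : measurable O) (nO : P.-negligible (~` O)).
Let chi w : R := \1_O w.

Lemma fmeas_indic t : fmeas t chi.
Proof.
have FO : @measurable _ (g_sigma_algebraType (F t)) O.
  rewrite -(setCK O); apply: measurableC; apply: sub_sigma_algebra.
  exact: filtration_negligible.
exact: (@measurable_indic _ (g_sigma_algebraType (F t)) R setT O FO).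
Qed.

Lemma conull_ae (Q : Omega -> Prop) : (forall w, O w -> Q w) -> {ae P, forall w, Q w}.
Proof. by move=> OQ; apply: negligibleS nO => w /= nQ Ow; apply: nQ; exact: OQ. Qed.

Variables (Z Z' : R -> Omega -> 'rV[R]_d) (M M' : R -> Omega -> R).
Hypotheses (pZ : progressive T F (Z : R -> Omega -> borel_rV R d))
  (pZ' : progressive T F (Z' : R -> Omega -> borel_rV R d)).
Hypotheses (iM : ito_integral P T F W Z M) (iM' : ito_integral P T F W Z' M').

Definition cut_norm r w := chi w * enorm (Z r w - Z' r w).
Definition cut_martingale t w := chi w * (M t w - M' t w).
Hypothesis lz : l2p cut_norm.

Section increments.
Variables s t : R.
Hypotheses (s0 : 0 <= s) (st : s <= t) (tT : t <= T).

Let N w := (M t w - M' t w) - (M s w - M' s w).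

Let sN : sqint P N. Proof. exact: (ito_sqint hN pZ pZ' iM iM' s0 st tT). Qed.

Let mchi : measurable_fun setT chi. Proof. exact: measurable_indic. Qed.

Let cutE w : cut_martingale t w - cut_martingale s w = chi w * N w.
Proof. by rewrite /cut_martingale /N -mulrBr. Qed.

Lemma cut_martingale_sqint : sqint P (fun w => cut_martingale t w - cut_martingale s w).
Proof.
under eq_fun do rewrite cutE.
apply: sqint_le (sqint_norm sN); first by apply: measurable_funM => //; exact: sN.1.
by move=> w; rewrite normrM ler_piMl// /chi indicE; case: (_ \in _); rewrite ?normr1 ?normr0.
Qed.

Lemma cut_martingale_orth X : fmeas s X -> sqint P X ->
  \int[P]_w (X w * (cut_martingale t w - cut_martingale s w)) = 0.
Proof.
(* The indicator of [O] is absorbed by [X], which remains measurable at time [s]. *)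
move=> fX sX; under eq_Rintegral do rewrite cutE mulrA.
apply: (ito_orth hN pZ pZ' iM iM' s0 st tT).
  by apply: measurable_funM => //; exact: fmeas_indic.
apply: sqint_le (sqint_norm sX); first by apply: measurable_funM => //; exact: sX.1.
by move=> w; rewrite normrM ler_piMr// /chi indicE; case: (_ \in _); rewrite ?normr1 ?normr0.
Qed.

Let mst : measurable (`]s, t]%classic : set (measurableTypeR R)).
Proof. exact: measurable_itv. Qed.

Let sub_st : (`]s, t]%classic : set R) `<=` `[0, T].
Proof.
move=> r /=; rewrite !in_itv/= => /andP[sr rt].
by rewrite (le_trans s0 (ltW sr)) (le_trans rt tT).
Qed.

Let sub_oT : (`]s, t]%classic : set R) `<=` `]0, T].
Proof.
move=> r /=; rewrite !in_itv/= => /andP[sr rt].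
by rewrite (le_lt_trans s0 sr) (le_trans rt tT).
Qed.

Let zi w : mu.-integrable `]s, t] (EFin \o (fun r => cut_norm r w ^+ 2)).
Proof. by have [_ /(_ w) zi _] := lz; apply: integrableS zi => //; exact: measurable_itv. Qed.

Lemma cut_norm_rint : rint P (fun w => \int[mu]_(r in `]s, t]) (cut_norm r w ^+ 2)).
Proof.
have [mz _ rz] := lz; apply: rint_le rz.
  by apply: (jmeas_Rintegral mst sub_st); exact: jmeasX.
move=> w; rewrite ger0_norm; last by apply: Rintegral_ge0 => r _; exact: sqr_ge0.
rewrite /Rintegral fine_le//.
- exact: integrable_fin_num (zi w).
- exact: integrable_fin_num (l2p_itvoc w lz).
have moT : measurable (`]0, T]%classic : set (measurableTypeR R)) by exact: measurable_itv.
have mz2 := measurable_int _ (l2p_itvoc w lz).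
apply: (@ge0_subset_integral _ _ R mu _ _ mst moT _ mz2 _ sub_oT).
by move=> r _; rewrite /= lee_fin sqr_ge0.
Qed.

Lemma cut_isometry :
  \int[P]_w ((cut_martingale t w - cut_martingale s w) ^+ 2) =
  \int[P]_w (\int[mu]_(r in `]s, t]) (cut_norm r w ^+ 2)).
Proof.
have e1 := ito_isometry hN pZ pZ' iM iM' s0 st tT.
have [mz _ _] := lz.
have e2 := iterint_Rintegral mst zi cut_norm_rint.
have e3 : (\int[P]_w \int[mu]_(r in `]s, t]) (cut_norm r w ^+ 2)%:E =
    \int[P]_w \int[mu]_(r in `]s, t]) (enorm (Z r w - Z' r w) ^+ 2)%:E)%E.
  apply: ae_eq_integral => //.
  - apply: (iterint_measurable mst sub_st) => [|r w]; [exact: jmeasX|exact: sqr_ge0].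
  - apply: (iterint_measurable mst sub_st) => [|r w]; last exact: sqr_ge0.
    by apply: jmeas_enorm2B => k; exact: (progressive_coord hN _ (ltW T0)).
  - apply: conull_ae => w Ow _; apply: eq_integral => r _.
    by rewrite /cut_norm /chi indicE mem_set// mul1r.
have e4 : \int[P]_w ((cut_martingale t w - cut_martingale s w) ^+ 2) = \int[P]_w (N w ^+ 2).
  apply: Rintegral_ae_eq.
  - exact: measurable_funX cut_martingale_sqint.1.
  - exact: measurable_funX sN.1.
  - by apply: conull_ae => w Ow; rewrite cutE /chi indicE mem_set// mul1r.
by rewrite e4; apply: EFin_inj; rewrite -e2 e3 e1.
Qed.

End increments.

Section bound.
Variables (a b c gamma : R).
Hypotheses (a0 : 0 <= a) (c0 : 0 <= c) (gE : gamma = a + c).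
Local Notation e := (fun t : R => expR (gamma * t)).
Variables (U f h K K' : R -> Omega -> R) (S H : Omega -> R).
Hypothesis cU : forall w, {within `[0, T], continuous (U^~ w)}.
Hypothesis fU : forall t, t \in `[0, T] -> fmeas t (U t).
Hypothesis US : forall t w, t \in `[0, T] -> `|U t w| <= S w.
Hypothesis sS : sqint P S.
Hypothesis lf : l2p f.
Hypothesis lh : l2p h.
Hypothesis cK : forall w, {within `[0, T], continuous (K^~ w)}.
Hypothesis cK' : forall w, {within `[0, T], continuous (K'^~ w)}.
Hypothesis ndK : forall w s t, 0 <= s -> s <= t -> t <= T -> K s w <= K t w.
Hypothesis ndK' : forall w s t, 0 <= s -> s <= t -> t <= T -> K' s w <= K' t w.
Hypothesis K0 : forall w, K 0 w = 0.
Hypothesis K'0 : forall w, K' 0 w = 0.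
Hypothesis mK : forall t, t \in `[0, T] -> measurable_fun setT (K t).
Hypothesis mK' : forall t, t \in `[0, T] -> measurable_fun setT (K' t).
Hypothesis sK : sqint P (K T).
Hypothesis sK' : sqint P (K' T).
Hypothesis UE : forall w s t, 0 <= s -> s <= t -> t <= T ->
  U t w - U s w = - (\int[mu]_(r in `]s, t]) f r w) - (K t w - K s w)
    + (K' t w - K' s w) + (cut_martingale t w - cut_martingale s w).
Hypothesis iH : rint P H.
Hypothesis hH : forall w eps, 0 < eps -> \forall n \near \oo,
  \sum_(i < n.+1) e (grid n i) * U (grid n i) w *
    (K (grid n i.+1) w - K (grid n i) w - (K' (grid n i.+1) w - K' (grid n i) w))
  <= H w + eps.
Hypothesis fle : forall r w, r \in `[0, T] ->
  2 * (U r w * f r w) <= a * U r w ^+ 2 + b * h r w ^+ 2 + cut_norm r w ^+ 2 / 4.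

Let g0 : 0 <= gamma. Proof. by rewrite gE addr_ge0. Qed.

Let mU t : t \in `[0, T] -> measurable_fun setT (U t).
Proof. by move=> tT; apply: (fmeas_measurable hN _ (fU tT)); move: tT; rewrite in_itv/= => /andP[]. Qed.

Let lU : l2p U.
Proof.
apply: (l2p_le _ _ (l2p_rv T0 sS)); first exact: jmeas_continuous.
by move=> r w rT; rewrite [leRHS]ger0_norm ?US// (le_trans _ (US w rT)).
Qed.

Local Notation EI X := (\int[P]_w (\int[mu]_(r in `]0, T]) (expR (gamma * r) * X r w ^+ 2))).

(** With [gamma = a + c], the hypothesis [fle] bounds the drift integrand from below by c U^2 - b
    h^2 - z^2 / 4, up to the weight, where z is [cut_norm]. Of the coefficient 3/4 in the energy
    inequality, 1/2 is then left. *)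
Lemma reflected_energy_bound :
  \int[P]_w (U 0 w ^+ 2) + c * EI U + 1 / 2 * EI cut_norm
  <= expR (gamma * T) * \int[P]_w (U T w ^+ 2) + b * EI h + 2 * \int[P]_w H w.
Proof.
have [iz rz] := l2p_expR g0 lz; have [iU rU] := l2p_expR g0 lU.
have [ih rh] := l2p_expR g0 lh.
have moT : measurable (`]0, T]%classic : set (measurableTypeR R)) by exact: measurable_itv.
have fi w : mu.-integrable `[0, T] (EFin \o (f^~ w)) := l2p_integrable w lf.
have oM s t : 0 <= s -> s <= t -> t <= T ->
    \int[P]_w (U s w * (cut_martingale t w - cut_martingale s w)) = 0.
  move=> s0 st tT; have sT : s \in `[0, T] by rewrite in_itv/= s0 (le_trans st).
  apply: (cut_martingale_orth s0 st tT (fU sT)).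
  by apply: sqint_le sS => [|w]; [exact: mU|exact: US].
have [rD] := energy_estimate T0 g0 cU mU US sS fi (fun w => lexx _) (l2p_sqint T0 lf)
  cK cK' ndK ndK' K0 K'0 mK mK' sK sK' cut_martingale_sqint oM (fun r w => sqr_ge0 _)
  (fun w => l2p_itvoc w lz)
  (fun s t s0 _ tT => cut_norm_rint s0 tT) cut_isometry rz UE iH hH.
set Dr := energy_drift _ _ _ _ in rD *.
set IU := fun w => \int[mu]_(r in `]0, T]) (expR (gamma * r) * U r w ^+ 2) in rU *.
set Ih := fun w => \int[mu]_(r in `]0, T]) (expR (gamma * r) * h r w ^+ 2) in rh *.
set Iz := fun w => \int[mu]_(r in `]0, T]) (expR (gamma * r) * cut_norm r w ^+ 2) in rz *.
have drift w : c * IU w - b * Ih w - 1 / 4 * Iz w <= Dr w.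
  have [d1 d2] := drift_integrable gamma (@cU w) (fi w).
  have dI : mu.-integrable `]0, T]
      (EFin \o (fun r => gamma * e r * U r w ^+ 2 - 2 * (e r * U r w * f r w))).
    have := integrableB moT d1 (integrableZl moT 2 d2).
    apply: eq_integrable => // r _.
    by rewrite /= -?EFinM -?EFinB; congr EFin; ring.
  have i1 := integrableZl moT c (iU w); have i2 := integrableZl moT b (ih w).
  have i3 := integrableZl moT (1 / 4) (iz w); have i4 := integrableB moT i1 i2.
  rewrite /IU /Ih /Iz -(RintegralZl c moT (iU w)) -(RintegralZl b moT (ih w)).
  rewrite -(RintegralZl (1 / 4) moT (iz w)) -(RintegralB moT i1 i2) -(RintegralB moT i4 i3).
  rewrite /Dr /energy_drift /drift_integral; apply: le_Rintegral => //.
  exact: (integrableB moT i4 i3).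
  move=> r rT; have {}rT : r \in `[0, T].
    by move: rT; rewrite /= !in_itv/= => /andP[/ltW -> ->].
  have := ler_wpM2l (expR_ge0 (gamma * r)) (@fle r w rT).
  rewrite gE; lra.
have j1 := rintZ c rU; have j2 := rintZ b rh; have j3 := rintZ (1 / 4) rz.
have j4 := rintB j1 j2; have j5 := rintB j4 j3.
have := le_Rint j5 rD drift.
rewrite (RintegralB measurableT j4 j3) (RintegralB measurableT j1 j2).
rewrite (RintegralZl _ measurableT rU) (RintegralZl _ measurableT rh).
rewrite (RintegralZl _ measurableT rz).
exact: absorb_drift.
Qed.

End bound.
End reflected_energy.

(** * Regularization of paths *)

Section good_paths.
Context (R : realType) (T : R) (d : nat) (disp : measure_display)
  (Omega : measurableType disp) (P : probability Omega R)
  (W : R -> Omega -> 'rV[R]_d) (J : countType) (B : J -> R -> Omega -> 'rV[R]_d).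
Hypothesis hN : noise_setting P T W B.
Hypothesis T0 : 0 < T.
Local Notation F := (brownian_filtration P T W B).
Local Notation fmeas := (fmeas T P W B).
Local Notation l2p := (l2p T P).
Local Notation grid := (grid T).
Notation mu := (@lebesgue_measure R).

Let m0T : measurable (`[0, T]%classic : set (measurableTypeR R)).
Proof. exact: measurable_itv. Qed.

Let moT : measurable (`]0, T]%classic : set (measurableTypeR R)).
Proof. exact: measurable_itv. Qed.

Variables (C0 : R) (xi : Omega -> R) (g : Omega -> R -> R -> 'rV[R]_d -> R)
  (L Y : R -> Omega -> R) (Z : R -> Omega -> 'rV[R]_d) (K M : R -> Omega -> R).

(** The properties of a solution that hold almost surely, at a fixed outcome; the obstacle
    inequality appears for all times at once. *)
Record good_path (w : Omega) : Prop := GoodPath {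
  good_Y : {within `[0, T], continuous (Y^~ w)} ;
  good_L : {within `[0, T], continuous (L^~ w)} ;
  good_K : {within `[0, T], continuous (K^~ w)} ;
  good_Khomo : forall s t, 0 <= s -> s <= t -> t <= T -> K s w <= K t w ;
  good_K0 : K 0 w = 0 ;
  good_lip : forall t y1 y2 z1 z2, t \in `[0, T] ->
     `|g w t y1 z1 - g w t y2 z2| <= C0 * (`|y1 - y2| + enorm (z1 - z2)) ;
  good_g0 : (\int[mu]_(r in `[0%R, T]) (`|g w r 0 0| ^+ 2)%:E < +oo)%E ;
  good_Z : (\int[mu]_(r in `[0%R, T]) (enorm (Z r w) ^+ 2)%:E < +oo)%E ;
  good_LY : forall t, t \in `[0, T] -> L t w <= Y t w ;
  good_eq : forall t, t \in `[0, T] ->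
        Y t w = xi w + \int[mu]_(s in `[t, T]) g w s (Y s w) (Z s w)
          + K T w - K t w - (M T w - M t w) ;
  good_dK : stieltjes_integral_eq0 T (fun t => Y t w - L t w) (fun t => K t w) }.

Let iterint_ae_finite (f : R -> Omega -> R) : jmeas T f -> (forall r w, 0 <= f r w) ->
  (\int[P]_w \int[mu]_(r in `[0%R, T]) (f r w)%:E < +oo)%E ->
  {ae P, forall w, (\int[mu]_(r in `[0%R, T]) (f r w)%:E < +oo)%E}.
Proof.
move=> mf f0 foo; pose I w := (\int[mu]_(r in `[0%R, T]) (f r w)%:E)%E.
have I0 w : (0 <= I w)%E by exact: iterint_ge0.
have iI : P.-integrable setT I.
  apply/integrableP; split; first exact: (iterint_measurable m0T (fun r h => h) mf f0).
  by under eq_integral => w _ do rewrite gee0_abs//.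
apply: filterS (integrable_ae measurableT iI) => w /(_ Logic.I).
by rewrite ge0_fin_numE.
Qed.

(** The obstacle inequality is given with an exceptional set that depends on the time. The grids
    have countably many points, and continuity carries the inequality from them to all times. *)
Lemma le_ae_le_path : {ae P, forall w, {within `[0, T], continuous (Y^~ w)}} ->
  {ae P, forall w, {within `[0, T], continuous (L^~ w)}} ->
  (forall t, t \in `[0, T] -> {ae P, forall w, L t w <= Y t w}) ->
  {ae P, forall w, forall t, t \in `[0, T] -> L t w <= Y t w}.
Proof.
move=> aY aL aLY.
have aG : {ae P, forall w, forall n i, (i <= n.+1)%N -> L (grid n i) w <= Y (grid n i) w}.
  apply: ae_foralln => n; apply: ae_foralln => i.
  have [ni|ni] := leqP i n.+1; last by apply: aeW.
  by apply: filterS (aLY _ (grid_itv T0 ni)) => w h _.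
apply: filterS (filterI aY (filterI aL aG)) => w [cY [cL LY]] t tT.
rewrite leNgt; apply/negP => YL.
have cD : {within `[0, T], continuous (fun t => Y t w - L t w)}.
  by move=> x; apply: cvgB; [exact: cY|exact: cL].
(* Half of the supposed violation at [t], so that the inequality would still fail at a nearby grid
   point. *)
have e0 : 0 < (L t w - Y t w) / 2 by rewrite divr_gt0// subr_gt0.
have [n _ /(_ n (leqnn n)) H] := uniform_continuity T0 e0 cD.
have [i [ni ti1 ti2]] : exists i, [/\ (i <= n.+1)%N, grid n i <= t & t - grid n i <= T / n.+1%:R].
  move: (tT); rewrite in_itv/= le_eqVlt => /andP[/predU1P[<-|t0] tT'].
    by exists 0%N; rewrite grid0 subr0 lexx divr_ge0// ltW.
  have [i ti1 ti2] := grid_bracket n t0 tT'.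
  exists i; split; [exact: ltnW (ltn_ord i)|exact: ltW|].
  by rewrite -(grid_step T n i) lerD2r.
have := H t (grid n i) tT (grid_itv T0 ni).
rewrite [`|t - _|]ger0_norm ?subr_ge0// => /(_ ti2).
rewrite ler_norml => /andP[h _].
have := LY n i ni; lra.
Qed.

Hypothesis SA : standard_assumptions P T F C0 xi g L.

Lemma good_path_ae : space_S2 P T F Y -> space_L2_rV P T F Z -> space_A2c P T F K ->
  {ae P, forall w, forall t, t \in `[0, T] ->
        Y t w = xi w + \int[mu]_(s in `[t, T]) g w s (Y s w) (Z s w)
          + K T w - K t w - (M T w - M t w)} ->
  (forall t, t \in `[0, T] -> {ae P, forall w, L t w <= Y t w}) ->
  {ae P, forall w,
     stieltjes_integral_eq0 T (fun t => Y t w - L t w) (fun t => K t w)} ->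
  {ae P, forall w, good_path w}.
Proof.
have [_ [_ [aLip [[pg0 ig0] [_ [_ [[_ aL _] _]]]]]]] := SA.
move=> [_ aY _] [pZ iZ] [[_ aK _] aKh aK0] aE aLY aS.
have jg0 : jmeas T (fun r w => g w r 0 0).
  exact: (progressive_measurable hN (ltW T0) pg0).
have ag0 := iterint_ae_finite (jmeasX 2 (jmeas_norm jg0)) (fun r w => sqr_ge0 _) ig0.
have jZ := jmeas_enorm2 (fun k => progressive_coord hN k (ltW T0) pZ).
have aZ := iterint_ae_finite jZ (fun r w => sqr_ge0 _) iZ.
have aLY' := le_ae_le_path aY aL aLY.
apply: filterS (filterI aY (filterI aL (filterI aK (filterI aKh (filterI aK0 (filterI aLip
  (filterI ag0 (filterI aZ (filterI aLY' (filterI aE aS)))))))))).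
by move=> w [? [? [? [? [? [? [? [? [? [? ?]]]]]]]]]]; split.
Qed.

End good_paths.

(** * Processes cut off outside a set of probability one *)

Section cutoff_processes.
Context (R : realType) (T : R) (d : nat) (disp : measure_display)
  (Omega : measurableType disp) (P : probability Omega R)
  (W : R -> Omega -> 'rV[R]_d) (J : countType) (B : J -> R -> Omega -> 'rV[R]_d).
Hypothesis hN : noise_setting P T W B.
Hypothesis T0 : 0 < T.
Local Notation F := (brownian_filtration P T W B).
Local Notation fmeas := (fmeas T P W B).
Local Notation l2p := (l2p T P).
Notation mu := (@lebesgue_measure R).

Let m0T : measurable (`[0, T]%classic : set (measurableTypeR R)).
Proof. exact: measurable_itv. Qed.

Let moT : measurable (`]0, T]%classic : set (measurableTypeR R)).
Proof. exact: measurable_itv. Qed.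

Variable O : set Omega.
Hypotheses (mO : measurable O) (nO : P.-negligible (~` O)).

Definition cutoff (X : R -> Omega -> R) t w := \1_O w * X t w.

Lemma cutE X t w : O w -> cutoff X t w = X t w.
Proof. by move=> Ow; rewrite /cutoff indicE mem_set// mul1r. Qed.

Lemma cut0 X t w : ~ O w -> cutoff X t w = 0.
Proof. by move=> Ow; rewrite /cutoff indicE memNset// mul0r. Qed.

Lemma cut_continuous X w : (O w -> {within `[0, T], continuous (X^~ w)}) ->
  {within `[0, T], continuous ((cutoff X)^~ w)}.
Proof.
move=> cX; have [Ow|Ow] := pselect (O w).
  by rewrite (_ : _ ^~ w = X^~ w); [exact: cX|apply/funext => t; exact: cutE].
rewrite (_ : _ ^~ w = fun=> 0); last by apply/funext => t; exact: cut0.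
by apply: continuous_subspaceT => r; exact: cvg_cst.
Qed.

Lemma cut_jmeas f : jmeas T f -> jmeas T (cutoff f).
Proof. by move=> mf; apply: jmeasM => //; apply: jmeas_rv; exact: measurable_indic. Qed.

Lemma cut_fmeas t X : fmeas t (X t) -> fmeas t (cutoff X t).
Proof. by move=> mX; apply: measurable_funM => //; exact: fmeas_indic. Qed.

(** The last identity concerns the original process: its path supremum agrees almost surely with the
    measurable one of the cut-off process, and [P] is complete. *)
Lemma cut_path_sup X : adapted T F X ->
  (forall w, O w -> {within `[0, T], continuous (X^~ w)}) ->
  [/\ forall t, t \in `[0, T] -> fmeas t (cutoff X t),
      forall w, {within `[0, T], continuous ((cutoff X)^~ w)},
      forall t w, t \in `[0, T] -> `|cutoff X t w| <= path_sup T (cutoff X) w,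
      measurable_fun setT (path_sup T (cutoff X)) &
      (\int[P]_w path_sup2 T X w = \int[P]_w (path_sup T (cutoff X) w ^+ 2)%:E)%E].
Proof.
move=> aX cX.
have fX t : t \in `[0, T] -> fmeas t (cutoff X t) by move=> tT; apply: cut_fmeas; exact: aX.
have ccX w : {within `[0, T], continuous ((cutoff X)^~ w)}.
  by apply: cut_continuous; exact: cX.
have mX t : t \in `[0, T] -> measurable_fun setT (cutoff X t).
  by move=> tT; apply: (fmeas_measurable hN _ (fX t tT)); move: tT; rewrite in_itv/= => /andP[].
have [mS leS S2] := path_sup_facts T0 mX ccX.
have Pc : measure_is_complete P by have [] := hN.
have [_ eI] : measurable_fun setT (path_sup2 T X) /\
    (\int[P]_w path_sup2 T X w = \int[P]_w path_sup2 T (cutoff X) w)%E.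
  apply: complete_integral_ae_eq => //.
    rewrite (_ : path_sup2 T _ = fun w => (path_sup T (cutoff X) w ^+ 2)%:E); last exact/funext.
    by apply/measurable_EFinP; exact: measurable_funX.
  apply: (conull_ae nO) => w Ow; rewrite /path_sup2; congr ereal_sup.
  by apply: eq_imagel => t _; rewrite cutE.
by split => //; rewrite eI; apply: eq_integral => w _; rewrite S2.
Qed.

Lemma cut_S2 X : space_S2 P T F X ->
  (forall w, O w -> {within `[0, T], continuous (X^~ w)}) ->
  [/\ forall t, t \in `[0, T] -> fmeas t (cutoff X t),
      forall w, {within `[0, T], continuous ((cutoff X)^~ w)},
      forall t w, t \in `[0, T] -> `|cutoff X t w| <= path_sup T (cutoff X) w &
      sqint P (path_sup T (cutoff X))].
Proof.
move=> [aX _ foo] cX; have [fX ccX leS mS eI] := cut_path_sup aX cX.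
split => //; split => //; apply: rint_ge0; first exact: measurable_funX.
  by move=> w; exact: sqr_ge0.
by rewrite -eI.
Qed.

(** Relates an iterated integral of the claim, over the closed interval and without cut-off, to a
    real-valued integral over the half-open interval, which fits the grids. *)
Lemma cut_iterint (q q0 : R -> Omega -> R) : jmeas T q -> (forall r w, 0 <= q r w) ->
  (forall w, mu.-integrable `]0, T] (EFin \o (q^~ w))) ->
  rint P (fun w => \int[mu]_(r in `]0, T]) q r w) ->
  (forall r w, O w -> q0 r w = q r w) ->
  (\int[P]_w \int[mu]_(r in `[0%R, T]) (q0 r w)%:E =
   (\int[P]_w (\int[mu]_(r in `]0, T]) q r w))%:E)%E.
Proof.
move=> mq q_ge0 qi rq qE; have Pc : measure_is_complete P by have [] := hN.
have mI := iterint_measurable m0T (fun r h => h) mq q_ge0.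
have ae w : O w -> (\int[mu]_(r in `[0%R, T]) (q r w)%:E =
    \int[mu]_(r in `[0%R, T]) (q0 r w)%:E)%E.
  by move=> Ow; apply: eq_integral => r _; rewrite qE.
have [_ ->] := complete_integral_ae_eq Pc mI (conull_ae nO ae).
rewrite -(iterint_Rintegral moT qi rq); apply: eq_integral => w _.
by rewrite integral_itv_obnd_cbnd//; exact: measurable_int (qi w).
Qed.

Lemma l2p_cut (f : R -> Omega -> R) : jmeas T f ->
  (forall w, O w -> (\int[mu]_(r in `[0%R, T]) (f r w ^+ 2)%:E < +oo)%E) ->
  (\int[P]_w \int[mu]_(r in `[0%R, T]) (f r w ^+ 2)%:E < +oo)%E -> l2p (cutoff f).
Proof.
move=> mf fO foo; have mc := cut_jmeas mf.
have ci w : mu.-integrable `[0, T] (EFin \o (fun r => cutoff f r w ^+ 2)).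
  have mw : measurable_fun (`[0, T]%classic : set (measurableTypeR R)) (fun r => cutoff f r w ^+ 2).
    exact: (jmeas_section w (jmeasX 2 mc)).
  apply/integrableP; split; first exact/measurable_EFinP.
  under eq_integral => r _ do rewrite /= ger0_norm ?sqr_ge0//.
  have [Ow|Ow] := pselect (O w).
    by under eq_integral => r _ do rewrite cutE//; exact: fO.
  by under eq_integral => r _ do rewrite cut0// expr0n/=; rewrite integral0.
split => //.
have : rint P (fun w => \int[mu]_(r in `[0, T]) (cutoff f r w ^+ 2)).
  apply: (rint_Rintegral m0T (fun r h => h) (jmeasX 2 mc) (fun r w => sqr_ge0 _) ci).
  apply: le_lt_trans foo; apply: (iterint_le (T := T)) => //.
  - exact: jmeasX.
  - exact: jmeasX.
  - by move=> r w; exact: sqr_ge0.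
  - move=> r w; have [Ow|Ow] := pselect (O w); first by rewrite cutE.
    by rewrite cut0// expr0n sqr_ge0.
congr rint; apply/funext => w; rewrite -Rintegral_itv_obnd_cbnd//.
have sub0T : (`]0, T]%classic : set R) `<=` `[0, T] by apply: subset_itvr; rewrite bnd_simp.
exact: (integrableS m0T moT sub0T (ci w)).
Qed.

Lemma jmeas_driver (g : Omega -> R -> R -> 'rV[R]_d -> R) (Y : R -> Omega -> R)
    (Z : R -> Omega -> 'rV[R]_d) :
  measurable_fun [set p : Omega * R * R * borel_rV R d | p.1.1.2 \in `[0, T]]
    (fun p : Omega * R * R * borel_rV R d => g p.1.1.1 p.1.1.2 p.1.2 p.2) ->
  jmeas T Y -> progressive T F (Z : R -> Omega -> borel_rV R d) ->
  jmeas T (fun r w => g w r (Y r w) (Z r w)).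
Proof.
move=> mg mY pZ.
have mD : measurable (`[0%R, T] `*` [set: Omega] : set (measurableTypeR R * Omega)).
  by apply: measurableX => //; exact: measurable_itv.
have mZ := progressive_measurable hN (ltW T0) pZ.
have m1 : measurable_fun (`[0%R, T] `*` [set: Omega])
    (fun p : R * Omega => ((p.2, p.1), Y p.1 p.2)).
  apply: measurable_pair_on => //; apply: measurable_pair_on => //.
    by apply: measurable_funTS; exact: measurable_snd.
  by apply: measurable_funTS; exact: measurable_fst.
have m2 := measurable_pair_on mD m1 mZ.
have mF : measurable [set p : Omega * R * R * borel_rV R d | p.1.1.2 \in `[0, T]].
  have m3 : measurable_fun setT (fun p : Omega * R * R * borel_rV R d => p.1.1.2).
    exact: (measurableT_comp measurable_snd (measurableT_comp measurable_fst measurable_fst)).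
  by have := m3 measurableT _ (measurable_itv `[0, T]); rewrite setTI.
apply: (measurable_comp mF _ mg m2).
by move=> _ [[r w] [/= rT _] <-].
Qed.

End cutoff_processes.

(** * A priori estimate of K *)

Lemma increments_sum_le (R : realType) (T : R) n (v : nat -> R) (k : R -> R) (c : R) :
  k 0 = 0 ->
  (forall i, (i < n.+1)%N -> v i * (k (grid T n i.+1) - k (grid T n i)) <=
    c * (k (grid T n i.+1) - k (grid T n i))) ->
  \sum_(i < n.+1) v i * (k (grid T n i.+1) - k (grid T n i)) <= c * k T.
Proof.
move=> k0 H; apply: (@le_trans _ _ (\sum_(i < n.+1) c * (k (grid T n i.+1) - k (grid T n i)))).
  by apply: ler_sum => i _; exact: H.
rewrite -mulr_sumr -(big_mkord xpredT (fun i => k (grid T n i.+1) - k (grid T n i))).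
by rewrite telescope_sumr// gridT grid0 k0 subr0.
Qed.

Section zero_integral.
Context (R : realType) (d : nat) (T : R) (disp : measure_display)
  (Omega : measurableType disp) (P : probability Omega R)
  (F : R -> set (set Omega)) (W : R -> Omega -> 'rV[R]_d).

Lemma progressive0 : progressive T F (fun (_ : R) (_ : Omega) => 0 : borel_rV R d).
Proof. by move=> t tT; exact: measurable_cst. Qed.

(** Makes zero admissible as the second process, so that the energy bound for differences also
    applies to a single solution. *)
Lemma ito_integral0 : 0 <= T ->
  ito_integral P T F W (fun _ _ => 0) (fun _ _ => 0).
Proof.
move=> T0; split.
- by move=> t tT; exact: measurable_cst.
- by apply: aeW => w; apply: continuous_subspaceT => r; exact: cvg_cst.
have p1 i : (i < 0)%N -> (0 : R) <= 0 by [].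
have p2 i : (i < 0)%N ->
  measurable_fun setT ((fun=> 0) : g_sigma_algebraType (F 0) -> borel_rV R d) by [].
have p3 : exists M : R, forall i (w : Omega), (i < 0)%N -> enorm (0 : 'rV[R]_d) <= M by exists 0.
pose H := @SimpleProcess R d Omega T F 0 (fun=> 0) (fun _ _ => 0) (lexx 0) p1 T0 p2 p3.
exists (fun=> H); split.
  rewrite (_ : (fun _ => _) = fun=> 0%E); first exact: cvg_cst.
  apply/funext => n; apply: integral0_eq => w _; apply: integral0_eq => t _.
  rewrite /sp_value big_ord0 subr0 enorm_sqr big1// => k _.
  by rewrite mxE expr0n.
move=> t tT; rewrite (_ : (fun _ => _) = fun=> 0%E); first exact: cvg_cst.
apply/funext => n; apply: integral0_eq => w _.
by rewrite /sp_integral big_ord0 subr0 normr0 expr0n.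
Qed.

End zero_integral.

Lemma sqr_add3_le (R : realDomainType) (a b c a2 c2 : R) :
  a ^+ 2 <= a2 -> c ^+ 2 <= c2 -> (a + b + c) ^+ 2 <= 3 * (a2 + b ^+ 2 + c2).
Proof.
have := sqr_ge0 (a - b); have := sqr_ge0 (a - c); have := sqr_ge0 (b - c).
lra.
Qed.

Lemma sqr_add4 (R : realDomainType) (a b c d : R) :
  (a + b + c + d) ^+ 2 <= 4 * (a ^+ 2 + b ^+ 2 + c ^+ 2 + d ^+ 2).
Proof.
rewrite -subr_ge0 (_ : _ - _ = (a - b) ^+ 2 + (a - c) ^+ 2 + (a - d) ^+ 2
  + (b - c) ^+ 2 + (b - d) ^+ 2 + (c - d) ^+ 2); last by ring.
by rewrite !addr_ge0// sqr_ge0.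
Qed.

(** * Constants of the a priori estimate *)

Section apriori_constant.
Context (R : realType) (C0 T : R).

(** [eT] is the weight at time T for the exponent used with a single solution. [alpha] is large
    enough to absorb the coefficients of [u0], [IU] and [Iz] in the bound of [k2], the last one
    against the factor 1/2; [beta] is the coefficient of [A] there. The outer 2 in the constant
    undoes the halving of [k2]. *)
Let eT : R := expR ((3 * C0 + 4 * C0 ^+ 2 + 1) * T).
Let alpha := 12 + 36 * C0 ^+ 2 * T.
Let beta := 8 + 12 * C0 ^+ 2 * T ^+ 2.

Definition apriori_constant :=
  2 * (alpha * eT * (2 + C0 * T + 2 / (2 * eT * alpha)^-1) + beta).

Hypotheses (c0 : 0 <= C0) (T0 : 0 < T).

Let alpha0 : 0 < alpha.
Proof. by rewrite ltr_wpDr// mulr_ge0 ?(ltW T0)// mulr_ge0// sqr_ge0. Qed.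

Lemma apriori_constant_ge0 : 0 <= apriori_constant.
Proof.
rewrite mulr_ge0// addr_ge0//.
  rewrite mulr_ge0//; first by rewrite mulr_ge0 ?expR_ge0// ltW.
  rewrite !addr_ge0//; first by rewrite mulr_ge0// ltW.
  by rewrite invrK !mulr_ge0 ?expR_ge0// ltW.
by rewrite addr_ge0// mulr_ge0 ?sqr_ge0// mulr_ge0// sqr_ge0.
Qed.

(* The free parameter kappa absorbs the K_T-term of the energy estimate into
   the left-hand side: alpha * eT * kappa = 1/2. *)
Lemma apriori_arith (A k2 u0 IU Iz : R) : 0 <= A -> 0 <= u0 -> 0 <= IU -> 0 <= Iz ->
  (forall kappa, 0 < kappa ->
    u0 + IU + 1 / 2 * Iz <= eT * (2 + C0 * T + 2 / kappa) * A + eT * kappa * k2) ->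
  k2 <= 4 * (u0 + 2 * A + 3 * C0 ^+ 2 * T * (IU + T * A + Iz) + Iz) ->
  k2 <= apriori_constant * A.
Proof.
move=> A0 u00 I0 z0 H k2_le.
have eT0 : 0 < eT by exact: expR_gt0.
have kappa0 : 0 < (2 * eT * alpha)^-1 by rewrite invr_gt0 !mulr_gt0.
have := H _ kappa0; set E := u0 + IU + 1 / 2 * Iz.
set c := 2 + C0 * T + 2 / _ => hE.
have q0 : 0 <= 12 * C0 ^+ 2 * T by rewrite !mulr_ge0 ?sqr_ge0// ltW.
have : k2 <= alpha * E + beta * A.
  have := mulr_ge0 q0 u00; have := mulr_ge0 q0 I0; have := mulr_ge0 q0 z0.
  move: k2_le; rewrite /alpha /beta /E; lra.
have := ler_wpM2l (ltW alpha0) hE.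
have hk : alpha * (eT * (2 * eT * alpha)^-1 * k2) = k2 / 2.
  by field; rewrite !gt_eqF.
rewrite /apriori_constant -/c; lra.
Qed.

End apriori_constant.

Lemma young_sum (R : realFieldType) (s g k kappa : R) : 0 < kappa ->
  2 * ((s + g) * k) <= 2 / kappa * s ^+ 2 + 2 / kappa * g ^+ 2 + kappa * k ^+ 2.
Proof.
move=> kappa0; rewrite -subr_ge0.
have -> : 2 / kappa * s ^+ 2 + 2 / kappa * g ^+ 2 + kappa * k ^+ 2 - 2 * ((s + g) * k)
    = kappa^-1 * (((s + g) - kappa * k) ^+ 2 + (s - g) ^+ 2).
  by field; rewrite gt_eqF.
by rewrite mulr_ge0 ?invr_ge0 ?(ltW kappa0)// addr_ge0// sqr_ge0.
Qed.

Lemma energy_arith (R : realFieldType)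
    (u0 IU Iz uT Gb Hb G2 S2 A k2 eT C0 T k kappa : R) :
  u0 + IU + 1 / 2 * Iz <= eT * uT + C0 * Gb + 2 * Hb ->
  eT * uT <= eT * (2 * A) -> C0 * Gb <= C0 * (eT * T * G2) ->
  2 * Hb <= eT * (k * S2 + k * G2 + kappa * k2) ->
  eT * (C0 * T) * G2 <= eT * (C0 * T) * A -> eT * k * (S2 + G2) <= eT * k * A ->
  u0 + IU + 1 / 2 * Iz <= eT * (2 + C0 * T + k) * A + eT * kappa * k2.
Proof. lra. Qed.

(** * Energy inequality for a single solution and the second moment of [K] *)

Section solution.
Context (R : realType) (T : R) (d : nat) (disp : measure_display)
  (Omega : measurableType disp) (P : probability Omega R)
  (W : R -> Omega -> 'rV[R]_d) (J : countType) (B : J -> R -> Omega -> 'rV[R]_d).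
Hypothesis hN : noise_setting P T W B.
Hypothesis T0 : 0 < T.
Local Notation F := (brownian_filtration P T W B).
Local Notation fmeas := (fmeas T P W B).
Local Notation l2p := (l2p T P).
Notation mu := (@lebesgue_measure R).

Let m0T : measurable (`[0, T]%classic : set (measurableTypeR R)).
Proof. exact: measurable_itv. Qed.

Let moT : measurable (`]0, T]%classic : set (measurableTypeR R)).
Proof. exact: measurable_itv. Qed.

Variable O : set Omega.
Hypotheses (mO : measurable O) (nO : P.-negligible (~` O)).
Local Notation cutoff := (cutoff O).

Variables (C0 : R) (xi : Omega -> R) (g : Omega -> R -> R -> 'rV[R]_d -> R)
  (L Y : R -> Omega -> R) (Z : R -> Omega -> 'rV[R]_d) (K M : R -> Omega -> R).
Hypothesis c0 : 0 <= C0.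
Hypothesis SA : standard_assumptions P T F C0 xi g L.
Hypotheses (S2Y : space_S2 P T F Y) (L2Z : space_L2_rV P T F Z) (A2K : space_A2c P T F K).
Hypothesis hO : forall w, O w -> good_path T C0 xi g L Y Z K M w.

Lemma cut_enorm_l2p : l2p (cutoff (fun r w => enorm (Z r w))).
Proof.
have [pZ iZ] := L2Z.
have jZ := jmeas_enorm2 (fun k => progressive_coord hN k (ltW T0) pZ).
apply: (l2p_cut mO) => //; last by move=> w /hO/good_Z.
have msqrt : measurable_fun setT (Num.sqrt : R -> R).
  by apply: continuous_measurable_fun => x; exact: sqrt_continuous.
have := measurableT_comp msqrt jZ; apply: eq_measurable_fun => p _ /=.
by rewrite sqrtr_sqr ger0_norm ?enorm_ge0.
Qed.

Lemma cut_driver0_l2p : l2p (cutoff (fun r w => g w r 0 0)).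
Proof.
have [_ [_ [_ [[pg0 ig0] _]]]] := SA.
apply: (l2p_cut mO).
- exact: (progressive_measurable hN (ltW T0) pg0).
- move=> w /hO/good_g0.
  by under eq_integral => r _ do rewrite real_normK ?num_real//.
- have eI w : (\int[mu]_(r in `[0%R, T]) (g w r 0 0 ^+ 2)%:E =
      \int[mu]_(r in `[0%R, T]) (`|g w r 0 0| ^+ 2)%:E)%E.
    by apply: eq_integral => r _; rewrite real_normK ?num_real.
  by under eq_integral => w _ do rewrite eI.
Qed.

Lemma cut_driver_le y z r w : r \in `[0, T] ->
  `|cutoff (fun r w => g w r (y r w) (z r w)) r w - cutoff (fun r w => g w r 0 0) r w| <=
  C0 * (`|cutoff y r w| + cutoff (fun r w => enorm (z r w)) r w).
Proof.
move=> rT; have [Ow|Ow] := pselect (O w); last by rewrite !cut0// subrr !normr0 addr0 mulr0.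
rewrite !cutE//; apply: (le_trans (good_lip (hO Ow) _ _ _ _ rT)).
by rewrite !subr0.
Qed.

(** The processes are arbitrary, because the driver of the second equation will also be evaluated
    along the first solution. *)
Lemma cut_driver_l2p y z : l2p (cutoff y) ->
  progressive T F (z : R -> Omega -> borel_rV R d) ->
  l2p (cutoff (fun r w => enorm (z r w))) ->
  l2p (cutoff (fun r w => g w r (y r w) (z r w))).
Proof.
move=> ly pz lz; have [mg _] := SA.
have l1 := l2pD (l2p_norm cut_driver0_l2p) (l2pZ C0 (l2pD (l2p_norm ly) lz)).
apply: (l2p_le _ _ l1).
  have := cut_jmeas mO (jmeas_driver hN T0 mg (let: And3 my _ _ := ly in my) pz).
  rewrite /jmeas; apply: eq_measurable_fun => -[r w] _ /=.
  by have [Ow|Ow] := pselect (O w); [rewrite !cutE|rewrite !cut0].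
move=> r w rT; have h := cut_driver_le y z w rT.
have z0 : 0 <= cutoff (fun r w => enorm (z r w)) r w.
  by rewrite mulr_ge0// ?enorm_ge0// indicE.
rewrite [leRHS]ger0_norm; last by rewrite addr_ge0// mulr_ge0// addr_ge0.
rewrite -lerBlDl; apply: le_trans h.
exact: lerB_dist.
Qed.

Local Notation f := (fun r w => g w r (Y r w) (Z r w)).

Lemma cut_Y_l2p : l2p (cutoff Y).
Proof.
have [fY cY leY sY] := cut_S2 hN T0 nO S2Y (fun w Ow => good_Y (hO Ow)).
apply: (l2p_le _ _ (l2p_rv T0 sY)).
  apply: jmeas_continuous => // t tT; apply: (fmeas_measurable hN _ (fY t tT)).
  by move: tT; rewrite in_itv/= => /andP[].
by move=> r w rT; rewrite [leRHS]ger0_norm ?leY// (le_trans _ (leY r w rT)).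
Qed.

Lemma cut_f_l2p : l2p (cutoff f).
Proof. by apply: cut_driver_l2p cut_Y_l2p L2Z.1 cut_enorm_l2p. Qed.

Lemma solution_increment w s t : 0 <= s -> s <= t -> t <= T ->
  cutoff Y t w - cutoff Y s w = - (\int[mu]_(r in `]s, t]) cutoff f r w)
    - (cutoff K t w - cutoff K s w) + (cutoff M t w - cutoff M s w).
Proof.
move=> s0 st tT; have [Ow|Ow] := pselect (O w); last first.
  under eq_Rintegral => r _ do rewrite cut0//.
  by rewrite !cut0// Rintegral_cst ?mul0r; [ring|exact: measurable_itv].
have fi := l2p_integrable w cut_f_l2p.
have E x : x \in `[0, T] -> Y x w = xi w + \int[mu]_(r in `[x, T]) cutoff f r w
    + K T w - K x w - (M T w - M x w).
  move=> xT; rewrite (good_eq (hO Ow) xT); congr (_ + _ + _ - _ - _).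
  by apply: eq_Rintegral => r _; rewrite cutE.
have sT := le_trans st tT; have t0 := le_trans s0 st.
rewrite !cutE// (E s) ?in_itv/= ?s0// (E t) ?in_itv/= ?t0//.
have ix x : 0 <= x -> mu.-integrable `]x, T] (EFin \o ((cutoff f)^~ w)).
  move=> x0; have sub : (`]x, T]%classic : set R) `<=` `[0, T].
    by apply: subset_itv; rewrite bnd_simp.
  have mx : measurable (`]x, T]%classic : set (measurableTypeR R)) by exact: measurable_itv.
  exact: (integrableS m0T mx sub fi).
rewrite -(Rintegral_itv_obnd_cbnd (ix s s0)) -(Rintegral_itv_obnd_cbnd (ix t t0)).
have := @Rintegral_itvB R ((cutoff f)^~ w) (BRight s) (BRight T) t (ix s s0).
rewrite !bnd_simp => /(_ st tT) => <-; ring.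
Qed.

Lemma solution_terminal w : O w -> Y T w = xi w.
Proof.
move=> Ow; rewrite (good_eq (hO Ow)) ?in_itv/= ?lexx ?ltW//.
by rewrite set_itv1 Rintegral_set1; ring.
Qed.

Lemma cut_K_facts :
  [/\ forall w, {within `[0, T], continuous ((cutoff K)^~ w)},
      forall w s t, 0 <= s -> s <= t -> t <= T -> cutoff K s w <= cutoff K t w,
      forall w, cutoff K 0 w = 0,
      forall t, t \in `[0, T] -> measurable_fun setT (cutoff K t) &
      sqint P (cutoff K T)].
Proof.
have [S2K _ _] := A2K; have TT : T \in `[0, T] by rewrite in_itv/= lexx ltW.
have [fK cK leK sK] := cut_S2 hN T0 nO S2K (fun w Ow => good_K (hO Ow)).
have mK t : t \in `[0, T] -> measurable_fun setT (cutoff K t).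
  by move=> tT; apply: (fmeas_measurable hN _ (fK t tT)); move: tT; rewrite in_itv/= => /andP[].
split => //.
- move=> w s t s0 st tT; have [Ow|Ow] := pselect (O w); last by rewrite !cut0.
  by rewrite !cutE//; exact: good_Khomo (hO Ow) _ _ s0 st tT.
- by move=> w; have [Ow|Ow] := pselect (O w); [rewrite cutE// (good_K0 (hO Ow))|rewrite cut0].
- by apply: sqint_le sK => [|w]; [exact: mK|exact: leK].
Qed.

Local Notation g0 := (fun r w => g w r 0 0).
Let G w := \int[mu]_(r in `]0, T]) `|cutoff g0 r w|.
Let SL := path_sup T (cutoff L).

(** The real-valued version of [data_size]; the terminal value of [Y] stands for [xi], with which it
    agrees on [O]. *)
Definition cut_size w := cutoff Y T w ^+ 2 + G w ^+ 2 + SL w ^+ 2.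

Let Pc : measure_is_complete P. Proof. by have [] := hN. Qed.

Let TT : T \in `[0, T]. Proof. by rewrite in_itv/= lexx ltW. Qed.

Let tT_le t : t \in `[0, T] -> t <= T. Proof. by rewrite in_itv/= => /andP[]. Qed.

Let sYT : sqint P (cutoff Y T).
Proof.
have [fY cY leY sY] := cut_S2 hN T0 nO S2Y (fun w Ow => good_Y (hO Ow)).
by apply: sqint_le sY => [|w]; [exact: (fmeas_measurable hN _ (fY T TT))|exact: leY].
Qed.

Let sG : sqint P G. Proof. exact: l2p_sqint cut_driver0_l2p. Qed.

Let S2L : space_S2 P T F L. Proof. by have [_ [_ [_ [_ [_ [_ []]]]]]] := SA. Qed.

Let sSL : sqint P SL.
Proof. by have [_ _ _ ] := cut_S2 hN T0 nO S2L (fun w Ow => good_L (hO Ow)). Qed.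

Lemma cut_size_rint : rint P cut_size.
Proof. by apply: rintD; [apply: rintD|]; [exact: sYT.2|exact: sG.2|exact: sSL.2]. Qed.

Lemma cut_sizeE w : O w -> data_size T xi g L w = (cut_size w)%:E.
Proof.
move=> Ow; rewrite /data_size -(solution_terminal Ow) -(cutE Y T Ow).
have [fL cL _ _] := cut_S2 hN T0 nO S2L (fun w Ow => good_L (hO Ow)).
have mL t : t \in `[0, T] -> measurable_fun setT (cutoff L t).
  by move=> tT; apply: (fmeas_measurable hN (tT_le tT)); exact: fL.
have [_ _ S2] := path_sup_facts T0 mL cL.
have -> : path_sup2 T L w = (SL w ^+ 2)%:E.
  rewrite -S2 /path_sup2; congr ereal_sup.
  by apply: eq_imagel => t _; rewrite cutE.
have li := l2p_integrable w (l2p_norm cut_driver0_l2p).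
have -> : (\int[mu]_(s in `[0%R, T]) `|g w s 0 0|%:E = (G w)%:E)%E.
  rewrite /G Rintegral_itv_obnd_cbnd; last first.
    have sub0T : (`]0, T]%classic : set R) `<=` `[0, T] by apply: subset_itvr; rewrite bnd_simp.
    exact: (integrableS m0T moT sub0T li).
  rewrite /Rintegral fineK; last exact: integrable_fin_num li.
  by apply: eq_integral => r _; rewrite cutE.
by rewrite -EFin_expe -!EFinD /cut_size real_normK ?num_real.
Qed.

Definition drift0 t w := \int[mu]_(r in `[0, t]) cutoff g0 r w.

Let sub0t t : t <= T -> (`[0, t]%classic : set R) `<=` `[0, T].
Proof. by move=> tT; apply: subset_itvl; rewrite bnd_simp. Qed.

Lemma drift0_continuous w : {within `[0, T], continuous (drift0^~ w)}.
Proof.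
exact: parameterized_integral_continuous (ltW T0) (l2p_integrable w cut_driver0_l2p).
Qed.

(** The measurability of time integrals is applied on the space endowed with [F t] and with horizon
    [t], where progressive measurability at [t] is joint measurability. *)
Lemma drift0_fmeas t : t \in `[0, T] -> fmeas t (drift0 t).
Proof.
move=> tT; have [_ [_ [_ [[pg0 _] _]]]] := SA.
have mt : measurable (`[0, t]%classic : set (measurableTypeR R)) by exact: measurable_itv.
apply: (@jmeas_Rintegral R t _ (g_sigma_algebraType (F t)) _ mt (fun r h => h)).
apply: jmeasM; last exact: pg0.
by apply: jmeas_rv; exact: fmeas_indic.
Qed.

Lemma drift0_increment w s t : 0 <= s -> s <= t -> t <= T ->
  drift0 t w - drift0 s w = \int[mu]_(r in `]s, t]) cutoff g0 r w.
Proof.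
move=> s0 st tT; have fi := l2p_integrable w cut_driver0_l2p.
have mt : measurable (`[0, t]%classic : set (measurableTypeR R)) by exact: measurable_itv.
have it := integrableS m0T mt (sub0t tT) fi.
by apply: (@Rintegral_itvB R ((cutoff g0)^~ w) (BLeft 0) (BRight t) s it); rewrite bnd_simp.
Qed.

Lemma drift0_le w t : t \in `[0, T] -> `|drift0 t w| <= G w.
Proof.
move=> tT; have fi := l2p_integrable w cut_driver0_l2p.
have mt : measurable (`[0, t]%classic : set (measurableTypeR R)) by exact: measurable_itv.
have it := integrableS m0T mt (sub0t (tT_le tT)) fi.
have li := l2p_integrable w (l2p_norm cut_driver0_l2p).
apply: (le_trans (le_normr_Rintegral mt it)).
rewrite /G Rintegral_itv_obnd_cbnd; last first.
  have sub0T : (`]0, T]%classic : set R) `<=` `[0, T] by apply: subset_itvr; rewrite bnd_simp.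
  exact: (integrableS m0T moT sub0T li).
rewrite /Rintegral fine_le//.
- exact: integrable_fin_num (integrable_norm it).
- exact: integrable_fin_num li.
apply: (@ge0_subset_integral _ _ R mu _ _ mt m0T _ (measurable_int _ li) _ (sub0t (tT_le tT))).
by move=> r _; rewrite /= lee_fin.
Qed.


Hypothesis iM : ito_integral P T F W Z M.

(** Young's inequality for 2 C0 |U| (|U| + G + z): the three products contribute 2 C0, C0 and 4 C0^2
    to the coefficient of U^2, and leave C0 G^2 and z^2 / 4. *)
Let a := 3 * C0 + 4 * C0 ^+ 2.
Let gamma := a + 1.
Local Notation e := (fun t : R => expR (gamma * t)).
Let eT := expR (gamma * T).
Let U t w := cutoff Y t w + drift0 t w.
Let fh r w := cutoff f r w - cutoff g0 r w.
Let zn := cutoff (fun r w => enorm (Z r w)).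
Let K_ w := cutoff K T w.
(** Where [K] increases, [Y] equals [L], so [U] is the sum of [L] and [drift0] and at most [SL + G];
    the total mass of [K] is [K_]. *)
Let H w := eT * ((SL w + G w) * K_ w).

Let a0 : 0 <= a. Proof. by rewrite addr_ge0// mulr_ge0// sqr_ge0. Qed.
Let gamma0 : 0 <= gamma. Proof. by rewrite addr_ge0. Qed.
Let eT1 : 1 <= eT. Proof. by rewrite -expR0 ler_expR mulr_ge0// ltW. Qed.
Let e_le t : t <= T -> e t <= eT. Proof. exact: expR_homo. Qed.
Let G0 w : 0 <= G w. Proof. by apply: Rintegral_ge0 => r _; exact: normr_ge0. Qed.
Let SL0 w : 0 <= SL w. Proof. exact: sqrtr_ge0. Qed.

Let K_ge0 w : 0 <= K_ w.
Proof.
have [_ ndK K0 _ _] := cut_K_facts; rewrite -(K0 w).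
by apply: ndK => //; exact: ltW.
Qed.

Let L_le w t : t \in `[0, T] -> `|cutoff L t w| <= SL w.
Proof.
by have [_ _ leL _] := cut_S2 hN T0 nO S2L (fun w Ow => good_L (hO Ow)); exact: leL.
Qed.

Let U_facts : [/\ forall w, {within `[0, T], continuous (U^~ w)},
  forall t, t \in `[0, T] -> fmeas t (U t),
  forall t w, t \in `[0, T] -> `|U t w| <= path_sup T (cutoff Y) w + G w &
  sqint P (fun w => path_sup T (cutoff Y) w + G w)].
Proof.
have [fY cY leY sY] := cut_S2 hN T0 nO S2Y (fun w Ow => good_Y (hO Ow)).
split.
- by move=> w x; apply: cvgD; [exact: cY|exact: drift0_continuous].
- by move=> t tT; apply: measurable_funD; [exact: fY|exact: drift0_fmeas].
- move=> t w tT; apply: (le_trans (ler_normD _ _)).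
  by apply: lerD; [exact: leY|exact: drift0_le].
- exact: sqintD.
Qed.

Let lfh : l2p fh.
Proof.
rewrite (_ : fh = fun r w => cutoff f r w + -1 * cutoff g0 r w).
  by apply: l2pD; [exact: cut_f_l2p|apply: l2pZ; exact: cut_driver0_l2p].
by apply/funext => r; apply/funext => w; rewrite mulN1r.
Qed.

(** The Lipschitz bound between (Y, Z) and (0, 0), with Y rewritten as [U - drift0]; this is how [G]
    enters. *)
Let fh_le r w : r \in `[0, T] -> `|fh r w| <= C0 * (`|U r w| + G w + zn r w).
Proof.
move=> rT; apply: (le_trans (cut_driver_le Y Z w rT)).
rewrite ler_wpM2l// lerD2r.
rewrite (_ : cutoff Y r w = U r w - drift0 r w); last by rewrite /U addrK.
apply: (le_trans (ler_normB _ _)); rewrite lerD2l; exact: drift0_le.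
Qed.

Let UE w s t : 0 <= s -> s <= t -> t <= T ->
  U t w - U s w = - (\int[mu]_(r in `]s, t]) fh r w) - (cutoff K t w - cutoff K s w)
    + (0 - 0) + (cut_martingale O M (fun _ _ => 0) t w - cut_martingale O M (fun _ _ => 0) s w).
Proof.
move=> s0 st tT.
have mst : measurable (`]s, t]%classic : set (measurableTypeR R)) by exact: measurable_itv.
have sub : (`]s, t]%classic : set R) `<=` `[0, T] by apply: subset_itv; rewrite bnd_simp.
have i1 := integrableS m0T mst sub (l2p_integrable w cut_f_l2p).
have i2 := integrableS m0T mst sub (l2p_integrable w cut_driver0_l2p).
rewrite (RintegralB mst i1 i2) -(drift0_increment w s0 st tT) /cut_martingale !subr0.
change (\1_O w * M t w) with (cutoff M t w); change (\1_O w * M s w) with (cutoff M s w).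
by have := solution_increment w s0 st tT; rewrite /U; lra.
Qed.

Let hH w eps : 0 < eps -> \forall n \near \oo,
  \sum_(i < n.+1) e (grid T n i) * U (grid T n i) w *
    (cutoff K (grid T n i.+1) w - cutoff K (grid T n i) w - (0 - 0))
  <= H w + eps.
Proof.
move=> eps0; have [_ ndK K0 _ _] := cut_K_facts.
have [Ow|Ow] := pselect (O w); last first.
  apply: nearW => n; rewrite big1 => [|i _]; last by rewrite !cut0// !subr0 mulr0.
  by rewrite addr_ge0 ?(ltW eps0)// mulr_ge0 ?expR_ge0// mulr_ge0// addr_ge0.
have K1 : 0 < eT * (K_ w + 1) by rewrite mulr_gt0 ?expR_gt0// ltr_wpDl.
(* The accuracy is such that [eT] times it times [K_ w] stays below [eps]; the added 1 covers [K_ w]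
   = 0. *)
have eta0 : 0 < eps / (eT * (K_ w + 1)) by rewrite divr_gt0.
have cD : {within `[0, T], continuous (fun t => Y t w - L t w)}.
  by move=> x; apply: cvgB; [exact: (good_Y (hO Ow))|exact: (good_L (hO Ow))].
have D0 t : t \in `[0, T] -> 0 <= Y t w - L t w.
  by move=> tT; rewrite subr_ge0; exact: good_LY (hO Ow) _ tT.
apply: filterS (stieltjes_grid T0 eta0 cD D0 (good_dK (hO Ow))) => n Hn.
under eq_bigr => i _ do rewrite subr0 subr0.
apply: (@le_trans _ _ (eT * (eps / (eT * (K_ w + 1)) + SL w + G w) * K_ w)).
  apply: (@increments_sum_le _ _ n (fun i => e (grid T n i) * U (grid T n i) w) ((cutoff K)^~ w)) => // i ni.
  have gi : grid T n i \in `[0, T] by apply: grid_itv => //; exact: ltnW.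
  have dK : 0 <= cutoff K (grid T n i.+1) w - cutoff K (grid T n i) w.
    by rewrite subr_ge0; apply: ndK; [exact: grid_ge0|exact: grid_le|exact: grid_leT].
  apply: (@le_trans _ _ (e (grid T n i) * ((eps / (eT * (K_ w + 1)) + SL w + G w) *
    (cutoff K (grid T n i.+1) w - cutoff K (grid T n i) w)))).
    rewrite -mulrA ler_wpM2l ?expR_ge0//.
    have h1 := Hn i ni; have h2 := L_le w gi; have h3 := drift0_le w gi.
    move: h1 h2 dK; rewrite /U !cutE// => h1.
    have h4 := ler_norm (L (grid T n i) w); have h5 := ler_norm (drift0 (grid T n i) w).
    move=> h2 dK.
    have : (L (grid T n i) w + drift0 (grid T n i) w) * (K (grid T n i.+1) w - K (grid T n i) w)
        <= (SL w + G w) * (K (grid T n i.+1) w - K (grid T n i) w).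
      by apply: ler_wpM2r => //; lra.
    lra.
  rewrite -[leRHS]mulrA; apply: ler_wpM2r.
    by rewrite mulr_ge0// !addr_ge0// ltW.
  by apply: e_le; apply: grid_leT => //; exact: ltnW.
have -> : eT * (eps / (eT * (K_ w + 1)) + SL w + G w) * K_ w =
    H w + eT * (eps / (eT * (K_ w + 1))) * K_ w by rewrite /H; ring.
rewrite lerD2l (_ : _ * K_ w = eps * (K_ w / (K_ w + 1))); last first.
  by field; rewrite !gt_eqF// ?ltr_wpDl// expR_gt0.
rewrite ler_piMr ?(ltW eps0)// ler_pdivrMr ?mul1r ?lerDl//.
by rewrite ltr_wpDl.
Qed.


Let znE : cut_norm O Z (fun _ _ => 0) = zn.
Proof. by apply/funext => r; apply/funext => w; rewrite /cut_norm subr0. Qed.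

Let lU : l2p U.
Proof.
have [cU fU US sS] := U_facts; apply: (l2p_le _ _ (l2p_rv T0 sS)).
  apply: jmeas_continuous => // t tT; apply: (fmeas_measurable hN (tT_le tT)); exact: fU.
by move=> r w rT; rewrite [leRHS]ger0_norm ?US// (le_trans _ (US r w rT)).
Qed.

Let IU w := \int[mu]_(r in `]0, T]) (e r * U r w ^+ 2).
Let Iz w := \int[mu]_(r in `]0, T]) (e r * zn r w ^+ 2).

Let rIU : rint P IU. Proof. by have [] := l2p_expR gamma0 lU. Qed.
Let rIz : rint P Iz. Proof. by have [] := l2p_expR gamma0 cut_enorm_l2p. Qed.

Let sU t : t \in `[0, T] -> sqint P (U t).
Proof.
move=> tT; have [_ fU US sS] := U_facts.
by apply: sqint_le sS => [|w]; [apply: (fmeas_measurable hN (tT_le tT)); exact: fU|exact: US].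
Qed.

Let sK : sqint P K_. Proof. by have [] := cut_K_facts. Qed.

Let T00 : 0 \in `[0, T]. Proof. by rewrite in_itv/= lexx ltW. Qed.

Let A := \int[P]_w cut_size w.
Let k2 := \int[P]_w (K_ w ^+ 2).

Let A_split : [/\ A = \int[P]_w (cutoff Y T w ^+ 2) + \int[P]_w (G w ^+ 2) + \int[P]_w (SL w ^+ 2),
  0 <= \int[P]_w (cutoff Y T w ^+ 2), 0 <= \int[P]_w (G w ^+ 2) & 0 <= \int[P]_w (SL w ^+ 2)].
Proof.
split; try by apply: Rintegral_ge0 => w _; exact: sqr_ge0.
rewrite /A /cut_size (RintegralD measurableT (rintD sYT.2 sG.2) sSL.2).
by rewrite (RintegralD measurableT sYT.2 sG.2).
Qed.

Let U_terminal : \int[P]_w (U T w ^+ 2) <= 2 * A.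
Proof.
have [-> x0 g0 s0] := A_split.
have : \int[P]_w (U T w ^+ 2) <=
    \int[P]_w (2 * (cutoff Y T w ^+ 2 + G w ^+ 2)).
  apply: le_Rint; [exact: (sU TT).2|exact: rintZ (rintD sYT.2 sG.2)|move=> w].
  have : drift0 T w ^+ 2 <= G w ^+ 2.
    by rewrite -[leLHS]real_normK ?num_real// lerXn2r ?nnegrE// drift0_le.
  rewrite /U; have := sqr_ge0 (cutoff Y T w - drift0 T w); lra.
rewrite (RintegralZl 2 measurableT (rintD sYT.2 sG.2)) (RintegralD measurableT sYT.2 sG.2).
lra.
Qed.

(** The reflected energy bound with [c] = 1 and zero as second process. Young's inequality separates
    [SL + G] from [K_]; its weight [kappa] stays free, so that the term with [k2] can be absorbed
    later. *)
Let energy_solution (kappa : R) : 0 < kappa ->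
  \int[P]_w (U 0 w ^+ 2) + \int[P]_w IU w + 1 / 2 * \int[P]_w Iz w <=
  eT * (2 + C0 * T + 2 / kappa) * A + eT * kappa * k2.
Proof.
move=> kappa0; have [cU fU US sS] := U_facts.
have [cK ndK K0 mK sK'] := cut_K_facts.
have rH : rint P H by apply: rintZ; apply: sqint_mul => //; exact: sqintD.
have fle r w : r \in `[0, T] -> 2 * (U r w * fh r w) <=
    a * U r w ^+ 2 + C0 * G w ^+ 2 + cut_norm O Z (fun _ _ => 0) r w ^+ 2 / 4.
  move=> rT; rewrite znE; have h := fh_le w rT.
  have : U r w * fh r w <= `|U r w| * (C0 * (`|U r w| + G w + zn r w)).
    by apply: (le_trans (ler_norm _)); rewrite normrM ler_wpM2l.
  have := mulr_ge0 c0 (sqr_ge0 (`|U r w| - G w)).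
  have := sqr_ge0 (2 * C0 * `|U r w| - zn r w / 2).
  rewrite -[U r w ^+ 2]real_normK ?num_real// /a; lra.
have lz : l2p (cut_norm O Z (fun _ _ => 0)) by rewrite znE; exact: cut_enorm_l2p.
have c0K (w : Omega) : {within `[0, T], continuous (fun _ : R => 0 : R)}.
  by apply: continuous_subspaceT => r; exact: cvg_cst.
have s0 : sqint P (fun=> 0 : R) by apply: (@sqint_bounded _ _ _ P _ 0) => // w; rewrite normr0.
have p0 : progressive T F (fun (_ : R) (_ : Omega) => 0 : borel_rV R d) by exact: progressive0.
have ito0 : ito_integral P T F W (fun _ _ => 0) (fun _ _ => 0) by exact: ito_integral0 (ltW T0).
have := reflected_energy_bound hN T0 mO nO L2Z.1 p0 iM ito0
  lz a0 ler01 erefl cU fU US sS lfh (l2p_rv T0 sG) cK c0K ndK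
  (fun _ _ _ _ _ _ => lexx _) K0 (fun _ => erefl) mK (fun _ _ => measurable_cst _) sK s0 UE rH hH fle.
rewrite znE (mul1r (Rintegral _ _ _)) => main.
have [iG rG] := l2p_expR gamma0 (l2p_rv T0 sG).
have G_bound : \int[P]_w (\int[mu]_(r in `]0, T]) (e r * G w ^+ 2)) <=
    eT * T * \int[P]_w (G w ^+ 2).
  rewrite -(RintegralZl _ measurableT sG.2); apply: le_Rint => //; first exact: rintZ sG.2.
  move=> w; apply: (@le_trans _ _ (\int[mu]_(r in `]0, T]) (eT * G w ^+ 2))).
    have sub0T : (`]0, T]%classic : set R) `<=` `[0, T] by apply: subset_itvr; rewrite bnd_simp.
    have icst : mu.-integrable `]0, T] (EFin \o (fun _ : R => eT * G w ^+ 2)).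
      apply: (integrableS m0T moT sub0T); apply: continuous_compact_integrable.
        exact: segment_compact.
      by apply: continuous_subspaceT => r; exact: cvg_cst.
    apply: (le_Rintegral moT (iG w) icst).
    by move=> r; rewrite /= in_itv/= => /andP[_ rT]; rewrite ler_wpM2r ?sqr_ge0// e_le.
  rewrite Rintegral_cst//= lebesgue_measure_itv/= lte_fin T0 sube0/=.
  by rewrite mulrAC.
have H_bound : 2 * \int[P]_w H w <= eT * ((2 / kappa) * \int[P]_w (SL w ^+ 2) +
    (2 / kappa) * \int[P]_w (G w ^+ 2) + kappa * k2).
  have j1 := rintZ (2 / kappa) sSL.2; have j2 := rintZ (2 / kappa) sG.2.
  have j3 := rintZ kappa sK.2; have j4 := rintD j1 j2; have j5 := rintD j4 j3.
  rewrite -(RintegralZl _ measurableT rH) -(RintegralZl _ measurableT sSL.2).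
  rewrite -(RintegralZl _ measurableT sG.2) -(RintegralZl _ measurableT sK.2).
  rewrite -(RintegralD measurableT j1 j2) -(RintegralD measurableT j4 j3).
  rewrite -(RintegralZl _ measurableT j5); apply: le_Rint; [exact: rintZ|exact: rintZ|move=> w].
  rewrite /H mulrCA; apply: ler_wpM2l; first exact: ltW (lt_le_trans ltr01 eT1).
  exact: young_sum.
have [AE x0 g0 s0'] := A_split.
have eTp : 0 < eT by exact: lt_le_trans ltr01 eT1.
have m1 := ler_wpM2l (ltW eTp) U_terminal.
have m2 := ler_wpM2l c0 G_bound.
have m3 : eT * (C0 * T) * \int[P]_w (G w ^+ 2) <= eT * (C0 * T) * A.
  apply: ler_wpM2l; last by rewrite AE -addrA addrCA lerDl addr_ge0.
  by rewrite mulr_ge0 ?(ltW eTp)// mulr_ge0// ltW.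
have m4 : eT * (2 / kappa) * (\int[P]_w (SL w ^+ 2) + \int[P]_w (G w ^+ 2)) <= eT * (2 / kappa) * A.
  apply: ler_wpM2l; last by rewrite AE -addrA [leLHS]addrC lerDr.
  by rewrite mulr_ge0 ?(ltW eTp)// divr_ge0// ltW.
exact: energy_arith main m1 m2 H_bound m3 m4.
Qed.

(** Cauchy-Schwarz in time and the Lipschitz bound; as [e r] is at least 1, the weighted integrals
    dominate the unweighted ones. *)
Let fh_sq w : (\int[mu]_(r in `]0, T]) fh r w) ^+ 2 <=
  3 * C0 ^+ 2 * T * (IU w + T * G w ^+ 2 + Iz w).
Proof.
have sub0T : (`]0, T]%classic : set R) `<=` `[0, T] by apply: subset_itvr; rewrite bnd_simp.
have fi := integrableS m0T moT sub0T (l2p_integrable w lfh).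
have h1 : (\int[mu]_(r in `]0, T]) fh r w) ^+ 2 <= T * \int[mu]_(r in `]0, T]) (fh r w ^+ 2).
  apply: le_trans (l2p_L1 T0 w lfh).
  rewrite -[leLHS]real_normK ?num_real// lerXn2r ?nnegrE ?Rintegral_ge0//.
  exact: (le_normr_Rintegral moT fi).
have [iU _] := l2p_expR gamma0 lU; have [iz _] := l2p_expR gamma0 cut_enorm_l2p.
have icst : mu.-integrable `]0, T] (EFin \o (fun _ : R => G w ^+ 2)).
  apply: (integrableS m0T moT sub0T); apply: continuous_compact_integrable.
    exact: segment_compact.
  by apply: continuous_subspaceT => r; exact: cvg_cst.
have j1 := integrableD moT (iU w) icst; have j2 := integrableD moT j1 (iz w).
apply: (le_trans h1).
rewrite [leRHS](_ : _ = T * (3 * C0 ^+ 2 * (IU w + T * G w ^+ 2 + Iz w))); last by ring.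
rewrite ler_pM2l//.
have -> : 3 * C0 ^+ 2 * (IU w + T * G w ^+ 2 + Iz w) = 3 * C0 ^+ 2 *
    \int[mu]_(r in `]0, T]) (e r * U r w ^+ 2 + G w ^+ 2 + e r * zn r w ^+ 2).
  rewrite (RintegralD moT j1 (iz w)) (RintegralD moT (iU w) icst) Rintegral_cst//=.
  by rewrite lebesgue_measure_itv/= lte_fin T0 sube0/= [G w ^+ 2 * T]mulrC.
rewrite -(RintegralZl _ moT j2).
apply: (le_Rintegral moT (l2p_itvoc w lfh) (integrableZl moT _ j2)) => r rT.
change (fh r w ^+ 2 <= 3 * C0 ^+ 2 * (e r * U r w ^+ 2 + G w ^+ 2 + e r * zn r w ^+ 2)).
have r0 : 0 <= r by move: rT; rewrite /= in_itv/= => /andP[/ltW].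
have e1 : 1 <= e r by rewrite -expR0 ler_expR mulr_ge0.
have h := fh_le w (sub0T _ rT).
apply: (@le_trans _ _ ((C0 * (`|U r w| + G w + zn r w)) ^+ 2)).
  by rewrite -[leLHS]real_normK ?num_real// lerXn2r ?nnegrE//; apply: le_trans h.
rewrite exprMn [leRHS](_ : _ = C0 ^+ 2 * (3 * (e r * U r w ^+ 2 + G w ^+ 2 + e r * zn r w ^+ 2))); last by ring.
apply: ler_wpM2l; first exact: sqr_ge0.
have u1 : `|U r w| ^+ 2 <= e r * U r w ^+ 2 by rewrite real_normK ?num_real// ler_peMl ?sqr_ge0.
have z1 : zn r w ^+ 2 <= e r * zn r w ^+ 2 by rewrite ler_peMl ?sqr_ge0.
exact: sqr_add3_le.
Qed.

Let dM w := cut_martingale O M (fun _ _ => 0) T w - cut_martingale O M (fun _ _ => 0) 0 w.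

Let dM_sq : sqint P dM /\ \int[P]_w (dM w ^+ 2) <= \int[P]_w Iz w.
Proof.
have p0 : progressive T F (fun (_ : R) (_ : Omega) => 0 : borel_rV R d) by exact: progressive0.
have ito0 : ito_integral P T F W (fun _ _ => 0) (fun _ _ => 0) by exact: ito_integral0 (ltW T0).
have lz : l2p (cut_norm O Z (fun _ _ => 0)) by rewrite znE; exact: cut_enorm_l2p.
have sM := cut_martingale_sqint hN mO L2Z.1 p0 iM ito0 (lexx 0) (ltW T0) (lexx T).
split => //.
have := cut_isometry hN T0 mO nO L2Z.1 p0 iM ito0 lz (lexx 0) (ltW T0) (lexx T).
rewrite znE => ->; have [_ _ rz] := cut_enorm_l2p.
apply: le_Rint => // w; have [iz _] := l2p_expR gamma0 cut_enorm_l2p.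
apply: (le_Rintegral moT (l2p_itvoc w cut_enorm_l2p) (iz w)) => r.
rewrite /= in_itv/= => /andP[/ltW r0 _].
by rewrite ler_peMl ?sqr_ge0// -expR0 ler_expR mulr_ge0.
Qed.

(** The equation over [0, T] gives K_T = U_0 - U_T - (integral of [fh]) + (martingale increment).
    The factor 4 comes from squaring four terms, and the isometry bounds the last one. *)
Let k2_le : k2 <= 4 * (\int[P]_w (U 0 w ^+ 2) + 2 * A +
  3 * C0 ^+ 2 * T * (\int[P]_w IU w + T * A + \int[P]_w Iz w) + \int[P]_w Iz w).
Proof.
have [sM eM] := dM_sq.
have j1 := (sU T00).2; have j2 := (sU TT).2; have j3 := rintZ T sG.2.
have j4 := rintD rIU j3; have j5 := rintD j4 rIz.
have j6 := rintZ (3 * C0 ^+ 2 * T) j5; have j7 := rintD j1 j2; have j8 := rintD j7 j6.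
have j9 := rintD j8 sM.2.
have : k2 <= \int[P]_w (4 * (U 0 w ^+ 2 + U T w ^+ 2 +
    3 * C0 ^+ 2 * T * (IU w + T * G w ^+ 2 + Iz w) + dM w ^+ 2)).
  apply: le_Rint; [exact: sK.2|exact: rintZ|move=> w].
  have := UE w (lexx 0) (ltW T0) (lexx T); rewrite subrr addr0 -/(dM w).
  have [_ _ -> _ _] := cut_K_facts; rewrite subr0 -/(K_ w) => E.
  have -> : K_ w = U 0 w + (- U T w) + (- \int[mu]_(r in `]0, T]) fh r w) + dM w.
    by move: E; set I := Rintegral _ _ _; lra.
  apply: le_trans (sqr_add4 _ _ _ _) _; rewrite !sqrrN.
  by rewrite ler_pM2l// lerD2r lerD2l; exact: fh_sq.
rewrite (RintegralZl _ measurableT j9) (RintegralD measurableT j8 sM.2).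
rewrite (RintegralD measurableT j7 j6) (RintegralD measurableT j1 j2).
rewrite (RintegralZl _ measurableT j5) (RintegralD measurableT j4 rIz).
rewrite (RintegralD measurableT rIU j3) (RintegralZl _ measurableT sG.2) => h.
apply: (le_trans h); rewrite ler_pM2l//; apply: lerD => //; apply: lerD.
  by rewrite lerD2l; exact: U_terminal.
apply: ler_wpM2l; first by rewrite mulr_ge0 ?(ltW T0)// mulr_ge0// sqr_ge0.
rewrite lerD2r lerD2l ler_pM2l//; have [-> x0 _ s0] := A_split.
by rewrite -addrA addrCA lerDl addr_ge0.
Qed.

Lemma reflected_apriori : \int[P]_w (cutoff K T w ^+ 2) <= apriori_constant C0 T * A.
Proof.
have A0 : 0 <= A.
  by have [-> x0 g0 s0] := A_split; rewrite !addr_ge0.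
have u0 : 0 <= \int[P]_w (U 0 w ^+ 2) by apply: Rintegral_ge0 => w _; exact: sqr_ge0.
have I0 : 0 <= \int[P]_w IU w.
  by apply: Rintegral_ge0 => w _; apply: Rintegral_ge0 => r _; rewrite mulr_ge0 ?expR_ge0 ?sqr_ge0.
have I1 : 0 <= \int[P]_w Iz w.
  by apply: Rintegral_ge0 => w _; apply: Rintegral_ge0 => r _; rewrite mulr_ge0 ?expR_ge0 ?sqr_ge0.
exact: (apriori_arith c0 T0 A0 u0 I0 I1 energy_solution k2_le).
Qed.

End solution.

(** * Difference of two solutions *)

(** Young's inequality twice: 2 |u| |h| with coefficients 2 / delta and delta / 2, and 2 c |u| z
    with coefficients 4 c^2 and 1/4. The term 2 c u^2 is kept as it is. *)
Lemma driver_young (R : realFieldType) (u phi h z c delta : R) :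
  0 < delta -> 0 <= c -> `|phi| <= `|h| + c * (`|u| + z) ->
  2 * (u * phi) <=
  (2 / delta + 2 * c + 4 * c ^+ 2) * u ^+ 2 + delta / 2 * h ^+ 2 + z ^+ 2 / 4.
Proof.
move=> d0 c0 H; apply: (@le_trans _ _ (2 * (`|u| * (`|h| + c * (`|u| + z))))).
  rewrite ler_pM2l// (le_trans (ler_norm _))// normrM.
  by rewrite ler_wpM2l.
rewrite -[u ^+ 2]real_normK ?num_real// -[h ^+ 2]real_normK ?num_real//.
rewrite -subr_ge0 [leRHS](_ : _ = 2 / delta * (`|u| - delta / 2 * `|h|) ^+ 2 +
  (2 * c * `|u| - z / 2) ^+ 2).
  by rewrite addr_ge0 ?sqr_ge0// mulr_ge0 ?sqr_ge0// divr_ge0// ltW.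
by field; rewrite gt_eqF.
Qed.

(** Doubling brings the coefficients on the left to 1; this is why the energy inequality is set up
    with 1/2 and [delta / 2]. *)
Lemma final_arith (R : realFieldType) (u0 EU Ez eT uT delta Eh EH x : R) : 0 <= u0 ->
  u0 + 1 / 2 * EU + 1 / 2 * Ez <= eT * uT + delta / 2 * Eh + 2 * EH -> EH <= x ->
  EU + Ez <= 2 * (eT * uT) + delta * Eh + 4 * x.
Proof. lra. Qed.

Lemma path_sup_le (R : realType) (T : R) disp (Omega : measurableType disp) (X : R -> Omega -> R) w (c : R) :
  0 < T -> 0 <= c -> (forall t, t \in `[0, T] -> `|X t w| <= c) -> path_sup T X w <= c.
Proof.
move=> T0 c0 Xc.
have le2 : (path_sup2 T X w <= (c ^+ 2)%:E)%E.
  by apply: ge_ereal_sup => _ [t tT <-]; rewrite lee_fin lerXn2r ?nnegrE// Xc.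
have ge0 : (0 <= path_sup2 T X w)%E.
  apply: (@le_trans _ _ (`|X 0 w| ^+ 2)%:E); first by rewrite lee_fin sqr_ge0.
  by apply: ereal_sup_ubound; exists 0 => //; rewrite /= in_itv/= lexx ltW.
rewrite /path_sup -[leRHS](ger0_norm c0) -sqrtr_sqr ler_wsqrtr// -lee_fin fineK//.
by rewrite ge0_fin_numE// (le_lt_trans le2)// ltry.
Qed.

(* With D = Y - L, x = L - L' and D' = Y' - L', the increment of K is charged
   only where D vanishes, and there Y - Y' <= L - L'. *)
Lemma obstacle_term (R : realFieldType) (e eT eta s dK D x D' : R) :
  0 <= e -> e <= eT -> 0 <= eta -> 0 <= dK -> D * dK <= eta * dK -> 0 <= D' ->
  `|e * x| <= s -> e * (D + x - D') * dK <= (eT * eta + s) * dK.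
Proof.
move=> e0 eeT eta0 dK0 DdK D0 xs.
have h1 := ler_wpM2l e0 DdK.
have h2 := ler_wpM2r (mulr_ge0 eta0 dK0) eeT.
have h3 := ler_wpM2r dK0 (le_trans (ler_norm _) xs).
have h4 := mulr_ge0 (mulr_ge0 e0 D0) dK0.
lra.
Qed.

Section difference_estimate.
Context (R : realType) (T : R) (d : nat) (disp : measure_display)
  (Omega : measurableType disp) (P : probability Omega R)
  (W : R -> Omega -> 'rV[R]_d) (J : countType) (B : J -> R -> Omega -> 'rV[R]_d).
Hypothesis hN : noise_setting P T W B.
Hypothesis T0 : 0 < T.
Local Notation F := (brownian_filtration P T W B).
Local Notation fmeas := (fmeas T P W B).
Local Notation l2p := (l2p T P).
Notation mu := (@lebesgue_measure R).

Let m0T : measurable (`[0, T]%classic : set (measurableTypeR R)).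
Proof. exact: measurable_itv. Qed.

Let moT : measurable (`]0, T]%classic : set (measurableTypeR R)).
Proof. exact: measurable_itv. Qed.

Variable O : set Omega.
Hypotheses (mO : measurable O) (nO : P.-negligible (~` O)).
Local Notation cutoff := (cutoff O).

Variables (C0 C0' : R) (xi xi' : Omega -> R) (g g' : Omega -> R -> R -> 'rV[R]_d -> R)
  (L L' Y Y' : R -> Omega -> R) (Z Z' : R -> Omega -> 'rV[R]_d)
  (K K' M M' : R -> Omega -> R).
Hypotheses (c0 : 0 <= C0) (c0' : 0 <= C0').
Hypotheses (SA : standard_assumptions P T F C0 xi g L)
  (SA' : standard_assumptions P T F C0' xi' g' L').
Hypotheses (S2Y : space_S2 P T F Y) (L2Z : space_L2_rV P T F Z) (A2K : space_A2c P T F K).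
Hypotheses (S2Y' : space_S2 P T F Y') (L2Z' : space_L2_rV P T F Z') (A2K' : space_A2c P T F K').
Hypotheses (iM : ito_integral P T F W Z M) (iM' : ito_integral P T F W Z' M').
Hypothesis hO : forall w, O w -> good_path T C0 xi g L Y Z K M w.
Hypothesis hO' : forall w, O w -> good_path T C0' xi' g' L' Y' Z' K' M' w.

Variable delta : R.
Hypothesis delta0 : 0 < delta.

(** The coefficient of u^2 in [driver_young] with c = C0'. The 1/2 added in [gamma] is what survives
    in front of the integral of U^2. *)
Let a := 2 / delta + 2 * C0' + 4 * C0' ^+ 2.
Let gamma := a + 1 / 2.
Local Notation e := (fun t : R => expR (gamma * t)).
Let eT := expR (gamma * T).
Let U r w := cutoff Y r w - cutoff Y' r w.
Local Notation f := (fun r w => g w r (Y r w) (Z r w)).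
Local Notation f' := (fun r w => g' w r (Y' r w) (Z' r w)).
(** The intermediate driver at which [f - f'] is split: [f - fmix] is the driver difference of the
    claim, and [fmix - f'] is controlled by the Lipschitz constant of [g'] alone. *)
Local Notation fmix := (fun r w => g' w r (Y r w) (Z r w)).
Let phi r w := cutoff f r w - cutoff f' r w.
Let h r w := cutoff f r w - cutoff fmix r w.
Let zn := cut_norm O Z Z'.
Let X t w := e t * (L t w - L' t w).
Let Se := path_sup T (cutoff X).
Let K_ w := cutoff K T w + cutoff K' T w.
Let H w := Se w * K_ w.
Let S w := path_sup T (cutoff Y) w + path_sup T (cutoff Y') w.

Let a0 : 0 <= a.
Proof.
by rewrite !addr_ge0//; [rewrite divr_ge0// ltW|rewrite mulr_ge0|rewrite mulr_ge0// sqr_ge0].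
Qed.
Let gamma0 : 0 <= gamma. Proof. by rewrite addr_ge0. Qed.
Let half0 : 0 <= 1 / 2 :> R. Proof. by []. Qed.
Let eT0 : 0 < eT. Proof. exact: expR_gt0. Qed.
Let e_le t : t <= T -> e t <= eT. Proof. exact: expR_homo. Qed.
Let tT_le t : t \in `[0, T] -> t <= T. Proof. by rewrite in_itv/= => /andP[]. Qed.
Let TT : T \in `[0, T]. Proof. by rewrite in_itv/= lexx ltW. Qed.

Let S2L : space_S2 P T F L. Proof. by have [_ [_ [_ [_ [_ [_ []]]]]]] := SA. Qed.
Let S2L' : space_S2 P T F L'. Proof. by have [_ [_ [_ [_ [_ [_ []]]]]]] := SA'. Qed.

Let lf : l2p (cutoff f).
Proof. exact: (cut_f_l2p hN T0 mO nO c0 SA S2Y L2Z hO). Qed.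
Let lf' : l2p (cutoff f').
Proof. exact: (cut_f_l2p hN T0 mO nO c0' SA' S2Y' L2Z' hO'). Qed.
Let lz : l2p (cutoff (fun r w => enorm (Z r w))).
Proof. exact: (cut_enorm_l2p hN T0 mO L2Z hO). Qed.
Let lz' : l2p (cutoff (fun r w => enorm (Z' r w))).
Proof. exact: (cut_enorm_l2p hN T0 mO L2Z' hO'). Qed.
Let lY : l2p (cutoff Y). Proof. exact: (cut_Y_l2p hN T0 nO S2Y hO). Qed.
Let lmix : l2p (cutoff fmix).
Proof. exact: (cut_driver_l2p hN T0 mO c0' SA' hO' lY L2Z.1 lz). Qed.

Let l2pB p q : l2p p -> l2p q -> l2p (fun r w => p r w - q r w).
Proof.
move=> lp lq; rewrite (_ : (fun r w => _) = fun r w => p r w + -1 * q r w).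
  by apply: l2pD => //; exact: l2pZ.
by apply/funext => r; apply/funext => w; rewrite mulN1r.
Qed.

Let lphi : l2p phi. Proof. exact: l2pB. Qed.
Let lh : l2p h. Proof. exact: l2pB. Qed.

Let lzn : l2p zn.
Proof.
have l2 := l2pD (l2pZ 2 lz) (l2pZ 2 lz').
have jz := jmeas_enorm2B (fun k => progressive_coord hN k (ltW T0) L2Z.1)
  (fun k => progressive_coord hN k (ltW T0) L2Z'.1).
apply: (l2p_le _ _ l2).
  have msqrt : measurable_fun setT (Num.sqrt : R -> R).
    by apply: continuous_measurable_fun => x; exact: sqrt_continuous.
  have := cut_jmeas mO (measurableT_comp msqrt jz : jmeas T (fun r w => Num.sqrt (enorm (Z r w - Z' r w) ^+ 2))).
  rewrite /jmeas; apply: eq_measurable_fun => p _ /=.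
  by congr (_ * _); rewrite sqrtr_sqr ger0_norm ?enorm_ge0.
move=> r w _; have [Ow|Ow] := pselect (O w); last first.
  by rewrite /zn /cut_norm indicE memNset// mul0r normr0.
rewrite !cutE// /zn /cut_norm indicE mem_set// mul1r.
rewrite !ger0_norm ?addr_ge0 ?mulr_ge0 ?enorm_ge0//.
rewrite -(@ler_pXn2r _ 2)// ?nnegrE ?addr_ge0 ?mulr_ge0 ?enorm_ge0//.
apply: (@le_trans _ _ (2 * enorm (Z r w) ^+ 2 + 2 * enorm (Z' r w) ^+ 2)).
  rewrite !enorm_sqr !mulr_sumr -big_split/=; apply: ler_sum => k _; rewrite !mxE.
  by have := sqr_ge0 (Z r w 0 k + Z' r w 0 k); lra.
have := mulr_ge0 (enorm_ge0 (Z r w)) (enorm_ge0 (Z' r w)).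
by have := sqr_ge0 (enorm (Z r w)); have := sqr_ge0 (enorm (Z' r w)); lra.
Qed.

Let phi_le r w : r \in `[0, T] -> `|phi r w| <= `|h r w| + C0' * (`|U r w| + zn r w).
Proof.
move=> rT; have [Ow|Ow] := pselect (O w); last first.
  rewrite /phi /h /U !cut0// subrr normr0 add0r mulr_ge0// addr_ge0//.
  by rewrite mulr_ge0 ?enorm_ge0// indicE.
rewrite (_ : phi r w = h r w + (cutoff fmix r w - cutoff f' r w)); last first.
  by rewrite /phi /h addrA subrK.
apply: (le_trans (ler_normD _ _)); rewrite lerD2l /U /zn /cut_norm !cutE//.
rewrite indicE mem_set// mul1r; exact: (good_lip (hO' Ow) _ _ _ _ rT).
Qed.

Let U_facts : [/\ forall w, {within `[0, T], continuous (U^~ w)},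
  forall t, t \in `[0, T] -> fmeas t (U t),
  forall t w, t \in `[0, T] -> `|U t w| <= S w & sqint P S].
Proof.
have [fY cY leY sY] := cut_S2 hN T0 nO S2Y (fun w Ow => good_Y (hO Ow)).
have [fY' cY' leY' sY'] := cut_S2 hN T0 nO S2Y' (fun w Ow => good_Y (hO' Ow)).
split.
- by move=> w x; apply: cvgB; [exact: cY|exact: cY'].
- by move=> t tT; apply: measurable_funB; [exact: fY|exact: fY'].
- move=> t w tT; apply: (le_trans (ler_normB _ _)).
  by apply: lerD; [exact: leY|exact: leY'].
- exact: sqintD.
Qed.

Let UE w s t : 0 <= s -> s <= t -> t <= T ->
  U t w - U s w = - (\int[mu]_(r in `]s, t]) phi r w) - (cutoff K t w - cutoff K s w)
    + (cutoff K' t w - cutoff K' s w) + (cut_martingale O M M' t w - cut_martingale O M M' s w).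
Proof.
move=> s0 st tT.
have mst : measurable (`]s, t]%classic : set (measurableTypeR R)) by exact: measurable_itv.
have sub : (`]s, t]%classic : set R) `<=` `[0, T] by apply: subset_itv; rewrite bnd_simp.
have i1 := integrableS m0T mst sub (l2p_integrable w lf).
have i2 := integrableS m0T mst sub (l2p_integrable w lf').
rewrite (RintegralB mst i1 i2) /cut_martingale !mulrBr.
have := solution_increment hN T0 mO nO c0 SA S2Y L2Z hO w s0 st tT.
have := solution_increment hN T0 mO nO c0' SA' S2Y' L2Z' hO' w s0 st tT.
rewrite /U -/(cutoff M t w) -/(cutoff M s w) -/(cutoff M' t w) -/(cutoff M' s w); lra.
Qed.

Let K_nd w s t : 0 <= s -> s <= t -> t <= T -> cutoff K s w <= cutoff K t w.
Proof. by have [_ ndK _ _ _] := cut_K_facts hN T0 nO A2K hO; exact: ndK. Qed.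

Let K_nd' w s t : 0 <= s -> s <= t -> t <= T -> cutoff K' s w <= cutoff K' t w.
Proof. by have [_ ndK _ _ _] := cut_K_facts hN T0 nO A2K' hO'; exact: ndK. Qed.

Let K_0 w : cutoff K 0 w = 0.
Proof. by have [_ _ -> _ _] := cut_K_facts hN T0 nO A2K hO. Qed.

Let K_0' w : cutoff K' 0 w = 0.
Proof. by have [_ _ -> _ _] := cut_K_facts hN T0 nO A2K' hO'. Qed.

Let K_ge0 w : 0 <= K_ w.
Proof.
have := @K_nd w 0 T (lexx _) (ltW T0) (lexx _); have := @K_nd' w 0 T (lexx _) (ltW T0) (lexx _).
by rewrite K_0 K_0'; exact: (fun h h' => addr_ge0 h' h).
Qed.

Let sK : sqint P K_.
Proof.
have [_ _ _ _ sK] := cut_K_facts hN T0 nO A2K hO.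
have [_ _ _ _ sK'] := cut_K_facts hN T0 nO A2K' hO'.
exact: sqintD.
Qed.

Let X_facts : [/\ forall t w, t \in `[0, T] -> `|cutoff X t w| <= Se w, sqint P Se &
  (\int[P]_w path_sup2 T X w = (\int[P]_w (Se w ^+ 2))%:E)%E].
Proof.
have [aL _ _] := S2L; have [aL' _ _] := S2L'.
have aX : adapted T F X.
  move=> t tT; apply: measurable_funM => //.
  by apply: measurable_funB; [exact: aL|exact: aL'].
have cX w : O w -> {within `[0, T], continuous (X^~ w)}.
  move=> Ow x; apply: cvgM; first exact/continuous_subspaceT/continuous_expRM.
  by apply: cvgB; [exact: (good_L (hO Ow))|exact: (good_L (hO' Ow))].
have [_ _ leX mS eI] := cut_path_sup hN T0 nO aX cX.
have [_ _ leL sL] := cut_S2 hN T0 nO S2L (fun w Ow => good_L (hO Ow)).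
have [_ _ leL' sL'] := cut_S2 hN T0 nO S2L' (fun w Ow => good_L (hO' Ow)).
have sS : sqint P Se.
  apply: (sqint_le mS _ (sqintZ eT (sqintD sL sL'))) => w.
  have p0 : 0 <= path_sup T (cutoff L) w + path_sup T (cutoff L') w.
    by rewrite addr_ge0// sqrtr_ge0.
  rewrite ger0_norm ?sqrtr_ge0//; apply: path_sup_le => //; first by rewrite mulr_ge0// ltW.
  move=> t tT.
  rewrite (_ : cutoff X t w = e t * (cutoff L t w - cutoff L' t w)); last first.
    by rewrite -[RHS]/(e t * (\1_O w * L t w - \1_O w * L' t w)) -mulrBr mulrCA.
  have et : 0 <= e t by exact: expR_ge0.
  rewrite normrM (ger0_norm et); apply: (ler_pM et (normr_ge0 _) (e_le (tT_le tT))).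
  by apply: (le_trans (ler_normB _ _)); apply: lerD; [exact: leL|exact: leL'].
by split => //; rewrite eI integral_rint//; exact: sS.2.
Qed.

Let hH w eps : 0 < eps -> \forall n \near \oo,
  \sum_(i < n.+1) e (grid T n i) * U (grid T n i) w *
    (cutoff K (grid T n i.+1) w - cutoff K (grid T n i) w -
      (cutoff K' (grid T n i.+1) w - cutoff K' (grid T n i) w))
  <= H w + eps.
Proof.
move=> eps0; have [leX _ _] := X_facts.
have Se0 : 0 <= Se w by exact: sqrtr_ge0.
have [Ow|Ow] := pselect (O w); last first.
  apply: nearW => n; rewrite big1 => [|i _]; last by rewrite !cut0// !subr0 mulr0.
  by rewrite addr_ge0 ?(ltW eps0)// mulr_ge0.
have K1 : 0 < eT * (K_ w + 1) by rewrite mulr_gt0// ltr_wpDl.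
pose eta := eps / (eT * (K_ w + 1)).
have eta0 : 0 < eta by rewrite divr_gt0.
have cD : {within `[0, T], continuous (fun t => Y t w - L t w)}.
  by move=> x; apply: cvgB; [exact: (good_Y (hO Ow))|exact: (good_L (hO Ow))].
have cD' : {within `[0, T], continuous (fun t => Y' t w - L' t w)}.
  by move=> x; apply: cvgB; [exact: (good_Y (hO' Ow))|exact: (good_L (hO' Ow))].
have D0 t : t \in `[0, T] -> 0 <= Y t w - L t w.
  by move=> tT; rewrite subr_ge0; exact: good_LY (hO Ow) _ tT.
have D0' t : t \in `[0, T] -> 0 <= Y' t w - L' t w.
  by move=> tT; rewrite subr_ge0; exact: good_LY (hO' Ow) _ tT.
apply: filterS (filterI (stieltjes_grid T0 eta0 cD D0 (good_dK (hO Ow)))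
  (stieltjes_grid T0 eta0 cD' D0' (good_dK (hO' Ow)))) => n [Hn Hn'].
(* Covers both reflection terms: U is D + x - D' with D = Y - L, x = L - L' and D' = Y' - L' for the
   increments of [K], and -U has the same form with the two solutions exchanged for those of
   [K']. *)
have term k k' (D x D' : R -> R) : (forall i, (i < n.+1)%N ->
      D (grid T n i) * (k (grid T n i.+1) - k (grid T n i)) <=
      eta * (k (grid T n i.+1) - k (grid T n i))) ->
    (forall s t, 0 <= s -> s <= t -> t <= T -> k s <= k t) -> k 0 = 0 -> k T = k' ->
    (forall t, t \in `[0, T] -> 0 <= D' t) ->
    (forall t, t \in `[0, T] -> `|e t * x t| <= Se w) ->
    \sum_(i < n.+1) e (grid T n i) * (D (grid T n i) + x (grid T n i) - D' (grid T n i)) *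
      (k (grid T n i.+1) - k (grid T n i)) <= (eT * eta + Se w) * k'.
  move=> kD ndk k0 <- D'0 xS.
  apply: (@increments_sum_le _ _ n
    (fun i => e (grid T n i) * (D (grid T n i) + x (grid T n i) - D' (grid T n i))) k) => // i ni.
  have gi : grid T n i \in `[0, T] by apply: grid_itv => //; exact: ltnW.
  have dk0 : 0 <= k (grid T n i.+1) - k (grid T n i).
    by rewrite subr_ge0; apply: ndk; [exact: grid_ge0|exact: grid_le|exact: grid_leT].
  exact: (obstacle_term (expR_ge0 _) (e_le (tT_le gi)) (ltW eta0) dk0 (kD i ni) (D'0 _ gi) (xS _ gi)).
have xS t : t \in `[0, T] -> `|e t * (L t w - L' t w)| <= Se w.
  by move=> tT; have := leX t w tT; rewrite cutE.
have xS' t : t \in `[0, T] -> `|e t * (L' t w - L t w)| <= Se w.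
  by move=> tT; rewrite -opprB mulrN normrN; exact: xS.
have kE : K^~ w = (cutoff K)^~ w by apply/funext => t; rewrite cutE.
have kE' : K'^~ w = (cutoff K')^~ w by apply/funext => t; rewrite cutE.
have S1 := @term ((cutoff K)^~ w) (cutoff K T w) (fun t => Y t w - L t w)
  (fun t => L t w - L' t w) (fun t => Y' t w - L' t w).
have S2 := @term ((cutoff K')^~ w) (cutoff K' T w) (fun t => Y' t w - L' t w)
  (fun t => L' t w - L t w) (fun t => Y t w - L t w).
have {}S1 : \sum_(i < n.+1) e (grid T n i) * U (grid T n i) w *
    (cutoff K (grid T n i.+1) w - cutoff K (grid T n i) w) <= (eT * eta + Se w) * cutoff K T w.
  apply: le_trans (S1 _ (@K_nd w) (K_0 w) erefl D0' xS); last first.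
    by move=> i ni; have := Hn i ni; rewrite !cutE.
  rewrite le_eqVlt; apply/orP; left; apply/eqP; apply: eq_bigr => i _.
  by rewrite /U (cutE Y)// (cutE Y')//; ring.
have {}S2 : \sum_(i < n.+1) - (e (grid T n i) * U (grid T n i) w) *
    (cutoff K' (grid T n i.+1) w - cutoff K' (grid T n i) w) <= (eT * eta + Se w) * cutoff K' T w.
  apply: le_trans (S2 _ (@K_nd' w) (K_0' w) erefl D0 xS'); last first.
    by move=> i ni; have := Hn' i ni; rewrite !cutE.
  rewrite le_eqVlt; apply/orP; left; apply/eqP; apply: eq_bigr => i _.
  by rewrite /U (cutE Y)// (cutE Y')//; ring.
under eq_bigr => i _ do rewrite mulrBr -mulNr.
rewrite big_split/=; apply: (le_trans (lerD S1 S2)).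
have -> : (eT * eta + Se w) * cutoff K T w + (eT * eta + Se w) * cutoff K' T w =
    H w + eT * eta * K_ w by rewrite /H /K_; ring.
rewrite lerD2l (_ : eT * eta * K_ w = eps * (K_ w / (K_ w + 1))); last first.
  by rewrite /eta; field; rewrite !gt_eqF// ltr_wpDl.
rewrite ler_piMr ?(ltW eps0)// ler_pdivrMr ?mul1r ?lerDl//.
by rewrite ltr_wpDl.
Qed.

Let lU : l2p U. Proof. exact: l2pB lY (cut_Y_l2p hN T0 nO S2Y' hO'). Qed.

Let sU t : t \in `[0, T] -> sqint P (U t).
Proof.
move=> tT; have [_ fU US sS] := U_facts.
by apply: sqint_le sS => [|w]; [apply: (fmeas_measurable hN (tT_le tT)); exact: fU|exact: US].
Qed.

Let Psi w := cut_size T O g L Y w + cut_size T O g' L' Y' w.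

Let Psi_rint : rint P Psi.
Proof.
apply: rintD.
  exact: (cut_size_rint hN T0 mO nO SA S2Y hO).
exact: (cut_size_rint hN T0 mO nO SA' S2Y' hO').
Qed.

(** The factor 4 is the 2 in front of the reflection term of the energy inequality, doubled at the
    end. Under the root, 2 comes from the square of K_T + K'_T, and the two a priori constants are
    added so that the sum of both data sizes factors out. *)
Definition difference_constant :=
  4 * Num.sqrt (2 * (apriori_constant C0 T + apriori_constant C0' T)).

Let EH_le : \int[P]_w H w <= Num.sqrt (\int[P]_w (Se w ^+ 2)) *
  (difference_constant / 4 * Num.sqrt (\int[P]_w Psi w)).
Proof.
have [_ sS _] := X_facts.
apply: (le_trans (ler_norm _)); apply: (le_trans (cauchy_schwarz_sqrt sS sK)).
rewrite ler_wpM2l ?sqrtr_ge0// /difference_constant [4 * _]mulrC mulfK ?pnatr_eq0//.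
have p0 := apriori_constant_ge0 c0 T0; have p0' := apriori_constant_ge0 c0' T0.
rewrite -sqrtrM ?mulr_ge0 ?addr_ge0// ler_wsqrtr//.
have [_ _ _ _ k1] := cut_K_facts hN T0 nO A2K hO.
have [_ _ _ _ k2] := cut_K_facts hN T0 nO A2K' hO'.
have b1 := reflected_apriori hN T0 mO nO c0 SA S2Y L2Z A2K hO iM.
have b2 := reflected_apriori hN T0 mO nO c0' SA' S2Y' L2Z' A2K' hO' iM'.
have r1 := cut_size_rint hN T0 mO nO SA S2Y hO.
have r2 := cut_size_rint hN T0 mO nO SA' S2Y' hO'.
rewrite /Psi (RintegralD measurableT r1 r2).
have A1 : 0 <= \int[P]_w cut_size T O g L Y w.
  by apply: Rintegral_ge0 => w _; rewrite /cut_size !addr_ge0 ?sqr_ge0.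
have A2 : 0 <= \int[P]_w cut_size T O g' L' Y' w.
  by apply: Rintegral_ge0 => w _; rewrite /cut_size !addr_ge0 ?sqr_ge0.
apply: (@le_trans _ _ (\int[P]_w (2 * (cutoff K T w ^+ 2 + cutoff K' T w ^+ 2)))).
  apply: le_Rint; [exact: sK.2|exact: rintZ (rintD k1.2 k2.2)|move=> w].
  rewrite -subr_ge0 (_ : _ - _ = (cutoff K T w - cutoff K' T w) ^+ 2) ?sqr_ge0//.
  by rewrite /K_; ring.
rewrite (RintegralZl _ measurableT (rintD k1.2 k2.2)) (RintegralD measurableT k1.2 k2.2).
rewrite -mulrA ler_pM2l//; apply: (le_trans (lerD b1 b2)).
have m1 := mulr_ge0 p0 A2; have m2 := mulr_ge0 p0' A1.
by rewrite mulrDl !mulrDr; apply: lerD; rewrite ?lerDl ?lerDr.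
Qed.

Let EI (q : R -> Omega -> R) := \int[P]_w (\int[mu]_(r in `]0, T]) (e r * q r w ^+ 2)).

Let weighted_iterint (q q0 : R -> Omega -> R) : l2p q ->
  (forall r w, O w -> q0 r w = e r * q r w ^+ 2) ->
  (\int[P]_w \int[mu]_(r in `[0%R, T]) (q0 r w)%:E = (EI q)%:E)%E.
Proof.
move=> lq qE; have [mq _ _] := lq; have [iq rq] := l2p_expR gamma0 lq.
have me : jmeas T (fun r (_ : Omega) => e r).
  by apply: jmeas_time; apply: continuous_measurable_fun; exact: continuous_expRM.
apply: (cut_iterint hN nO (jmeasM me (jmeasX 2 mq)) _ iq rq qE).
by move=> r w; rewrite mulr_ge0 ?expR_ge0 ?sqr_ge0.
Qed.

Lemma difference_estimate :
  (\int[P]_w \int[mu]_(t in `[0%R, T])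
      (expR (gamma * t) *
        (`|Y t w - Y' t w| ^+ 2 + enorm (Z t w - Z' t w) ^+ 2))%:E
   <= 2%:E * \int[P]_w (expR (gamma * T) * `|xi w - xi' w| ^+ 2)%:E
    + delta%:E *
      \int[P]_w \int[mu]_(t in `[0%R, T])
        (expR (gamma * t) *
          `|g w t (Y t w) (Z t w) - g' w t (Y t w) (Z t w)| ^+ 2)%:E
    + difference_constant%:E *
      sqrte (\int[P]_w
        path_sup2 T (fun t w' => expR (gamma * t) * (L t w' - L' t w'))%R w)
      * sqrte (\int[P]_w (data_size T xi g L w + data_size T xi' g' L' w)))%E.
Proof.
have [cU fU US sS] := U_facts; have [leX sSe XI] := X_facts.
have [cK _ _ mK k1] := cut_K_facts hN T0 nO A2K hO.
have [cK' _ _ mK' k2] := cut_K_facts hN T0 nO A2K' hO'.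
have fle r w : r \in `[0, T] ->
    2 * (U r w * phi r w) <= a * U r w ^+ 2 + delta / 2 * h r w ^+ 2 + zn r w ^+ 2 / 4.
  move=> rT; apply: (driver_young delta0 c0' (phi_le w rT)).
have main := reflected_energy_bound hN T0 mO nO L2Z.1 L2Z'.1 iM iM' lzn a0 half0 erefl
  cU fU US sS lphi lh cK cK' K_nd K_nd' K_0 K_0' mK mK' k1 k2 UE (sqint_mul sSe sK) hH fle.
have u0 : 0 <= \int[P]_w (U 0 w ^+ 2) by apply: Rintegral_ge0 => w _; exact: sqr_ge0.
have final := final_arith u0 main EH_le.
have Pc : measure_is_complete P by have [] := hN.
(* From here on each extended integral of the claim is identified with a real number attached to the
   cut-off processes, and the real inequality [final] applies. *)
have e1 : (\int[P]_w \int[mu]_(t in `[0%R, T])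
    (expR (gamma * t) * (`|Y t w - Y' t w| ^+ 2 + enorm (Z t w - Z' t w) ^+ 2))%:E =
    (EI U + EI zn)%:E)%E.
  have [iU rU] := l2p_expR gamma0 lU; have [iz rz] := l2p_expR gamma0 lzn.
  have me : jmeas T (fun r (_ : Omega) => e r).
    by apply: jmeas_time; apply: continuous_measurable_fun; exact: continuous_expRM.
  have [mU _ _] := lU; have [mz _ _] := lzn.
  have ri : (fun w => \int[mu]_(r in `]0, T]) (e r * U r w ^+ 2 + e r * zn r w ^+ 2)) =
      fun w => \int[mu]_(r in `]0, T]) (e r * U r w ^+ 2) + \int[mu]_(r in `]0, T]) (e r * zn r w ^+ 2).
    by apply/funext => w; exact: (RintegralD moT (iU w) (iz w)).
  rewrite (cut_iterint hN nO (q := fun r w => e r * U r w ^+ 2 + e r * zn r w ^+ 2)).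
  - by rewrite ri (RintegralD measurableT rU rz).
  - exact: jmeasD (jmeasM me (jmeasX 2 mU)) (jmeasM me (jmeasX 2 mz)).
  - by move=> r w; rewrite addr_ge0// mulr_ge0 ?expR_ge0 ?sqr_ge0.
  - by move=> w; exact: (integrableD moT (iU w) (iz w)).
  - by rewrite ri; exact: rintD.
  - move=> r w Ow; rewrite -mulrDr /U !cutE// /zn /cut_norm indicE mem_set// mul1r.
    by rewrite real_normK ?num_real.
have e2 : (\int[P]_w (expR (gamma * T) * `|xi w - xi' w| ^+ 2)%:E =
    (eT * \int[P]_w (U T w ^+ 2))%:E)%E.
  have rUT := rintZ eT (sU TT).2.
  have ae w : O w -> ((eT * U T w ^+ 2)%:E = (expR (gamma * T) * `|xi w - xi' w| ^+ 2)%:E)%E.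
    move=> Ow; rewrite /U !cutE// real_normK ?num_real//.
    by rewrite (solution_terminal T0 hO Ow) (solution_terminal T0 hO' Ow).
  have [_ ->] := complete_integral_ae_eq Pc (measurable_int _ rUT) (conull_ae nO ae).
  by rewrite integral_rint// (RintegralZl _ measurableT (sU TT).2).
have e3 := weighted_iterint (q := h)
  (q0 := fun t w => expR (gamma * t) * `|g w t (Y t w) (Z t w) - g' w t (Y t w) (Z t w)| ^+ 2) lh.
have e5 : (\int[P]_w (data_size T xi g L w + data_size T xi' g' L' w) = (\int[P]_w Psi w)%:E)%E.
  have ae w : O w -> ((Psi w)%:E = data_size T xi g L w + data_size T xi' g' L' w)%E.
    move=> Ow; rewrite (cut_sizeE hN T0 mO nO SA hO Ow).
    by rewrite (cut_sizeE hN T0 mO nO SA' hO' Ow).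
  have [_ ->] := complete_integral_ae_eq Pc (measurable_int _ Psi_rint) (conull_ae nO ae).
  exact: integral_rint.
rewrite e1 e2 e3 ?e5; last first.
  by move=> r w Ow; rewrite /h !cutE// real_normK ?num_real.
rewrite [X in sqrte X]XI /= -!EFinM -!EFinD lee_fin.
apply: (le_trans final); rewrite lerD2l.
by rewrite le_eqVlt; apply/orP; left; apply/eqP; field.
Qed.

End difference_estimate.

Theorem lemma3p5 (R : realType) (T : R) (d : nat) (C0 C0' : R)
  (hT : 0 < T) (hd : (0 < d)%N) (hC0 : 0 <= C0) (hC0' : 0 <= C0') :
  exists2 C : R, 0 < C &
  forall delta : R, 0 < delta ->
  exists2 gamma : R, 0 < gamma &
  forall (disp : measure_display) (Omega : measurableType disp)
    (P : probability Omega R) (W : R -> Omega -> 'rV[R]_d)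
    (J : countType) (B : J -> R -> Omega -> 'rV[R]_d),
  noise_setting P T W B ->
  let F := brownian_filtration P T W B in
  forall (xi xi' : Omega -> R) (g g' : Omega -> R -> R -> 'rV[R]_d -> R)
    (L L' Y Y' : R -> Omega -> R) (Z Z' : R -> Omega -> 'rV[R]_d)
    (K K' : R -> Omega -> R),
  standard_assumptions P T F C0 xi g L ->
  standard_assumptions P T F C0' xi' g' L' ->
  rbsde_solution P T F W xi g L Y Z K ->
  rbsde_solution P T F W xi' g' L' Y' Z' K' ->
  let Psi := (\int[P]_w (data_size T xi g L w + data_size T xi' g' L' w))%E in
  (\int[P]_w \int[lebesgue_measure]_(t in `[0%R, T])
      (expR (gamma * t) *
        (`|Y t w - Y' t w| ^+ 2 + enorm (Z t w - Z' t w) ^+ 2))%:E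
   <= 2%:E * \int[P]_w (expR (gamma * T) * `|xi w - xi' w| ^+ 2)%:E
    + delta%:E *
      \int[P]_w \int[lebesgue_measure]_(t in `[0%R, T])
        (expR (gamma * t) *
          `|g w t (Y t w) (Z t w) - g' w t (Y t w) (Z t w)| ^+ 2)%:E
    + C%:E *
      sqrte (\int[P]_w
        path_sup2 T (fun t w' => expR (gamma * t) * (L t w' - L' t w'))%R w)
      * sqrte Psi)%E.
Proof.
(* The constant is known to be nonnegative only; adding 1 makes it positive. *)
exists (difference_constant T C0 C0' + 1).
  by rewrite ltr_wpDl// mulr_ge0// sqrtr_ge0.
move=> delta delta0; exists (2 / delta + 2 * C0' + 4 * C0' ^+ 2 + 1 / 2).
  rewrite ltr_wpDl// !addr_ge0//; first by rewrite divr_ge0// ltW.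
    by rewrite mulr_ge0.
  by rewrite mulr_ge0// sqr_ge0.
move=> disp Omega P W J B hN F xi xi' g g' L L' Y Y' Z Z' K K' SA SA' sol sol'.
have [SY [SZ [SK [[M [iM EM]] [SL SS]]]]] := sol.
have [SY' [SZ' [SK' [[M' [iM' EM']] [SL' SS']]]]] := sol'.
have good := good_path_ae hN hT SA SY SZ SK EM SL SS.
have good' := good_path_ae hN hT SA' SY' SZ' SK' EM' SL' SS'.
(* A measurable null set off which both solutions have good paths; its complement is the set [O] of
   the cut-off. *)
have [N [mN N0 hNsub]] := filterI good good'.
have nO : P.-negligible (~` (~` N)) by rewrite setCK; exists N; split.
have hO w : (~` N) w -> good_path T C0 xi g L Y Z K M w /\ good_path T C0' xi' g' L' Y' Z' K' M' w.
  by move=> nNw; apply: contrapT => ngood; apply: nNw; exact: hNsub.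
apply: (le_trans (difference_estimate hN hT (measurableC mN) nO hC0 hC0' SA SA'
  SY SZ SK SY' SZ' SK' iM iM' (fun w Ow => (hO w Ow).1) (fun w Ow => (hO w Ow).2) delta0)).
apply: leeD2l; apply: lee_wpmul2r; first exact: sqrte_ge0.
apply: lee_wpmul2r; first exact: sqrte_ge0.
by rewrite lee_fin lerDl.
Qed.
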